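(* Let $A\in\mathbf{RM}_6$ be a reciprocal $6\times6$ matrix whose parameters $\xi_1,\dots,\xi_5\ge0$ satisfy one of the conditions (1) $\xi_2=\xi_4=2\xi_1\cos\frac{2\pi}{7},\ \xi_3=0,\ \xi_5=\xi_1$; (2) $\xi_3=\xi_5=k\xi_1,\ \xi_2=0,\ \xi_4=(k-1)^2\xi_1$; (3) $\xi_1=\xi_3=k\xi_5,\ \xi_2=(k-1)^2\xi_5,\ \xi_4=0$; where in (2), (3) $k\in\{2\cos\frac{\pi}{7},2\cos\frac{3\pi}{7}\}$. Let $E_0$ (centered at the origin) and $E$ (centered at a point $p>0$ of the real axis) be the ellipses such that $C(A)=E_0\cup E\cup(-E)$; here $E$ has foci $2\cos\frac{\pi}{7},-2\cos\frac{2\pi}{7}$ and $E_0$ has foci $\pm2\cos\frac{3\pi}{7}$ in case (1) and in cases (2), (3) with $k=2\cos\frac{3\pi}{7}$, while $E$ has foci $2\cos\frac{2\pi}{7},-2\cos\frac{3\pi}{7}$ and $E_0$ has foci $\pm2\cos\frac{\pi}{7}$ in cases (2), (3) with $k=2\cos\frac{\pi}{7}$. Then the rank-$j$ numerical ranges of $A$, $j=1,2,3$, are as follows. In case (1), or in case (2) or (3) with $k=2\cos\frac{3\pi}{7}$: $\Lambda_1(A)=\operatorname{conv}(E\cup(-E))$, $\Lambda_2(A)=\operatorname{conv}E\cap\operatorname{conv}(-E)$, $\Lambda_3(A)=\operatorname{conv}E_0$. In case (2) or (3) with $k=2\cos\frac{\pi}{7}$: $\Lambda_1(A)=\operatorname{conv}E_0$,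 $\Lambda_2(A)=\operatorname{conv}(E\cup(-E))$, $\Lambda_3(A)=\operatorname{conv}E\cap\operatorname{conv}(-E)$.
   Context: A matrix $A=(a_{ij})\in M_n(\mathbb C)$ is reciprocal, $A\in\mathbf{RM}_n$, if it is tridiagonal with zero main diagonal ($a_{ij}=0$ whenever $|i-j|\neq1$) and $a_{i,i+1}a_{i+1,i}=1$ for $i=1,\dots,n-1$. Its parameters are $\xi_j=\frac14(|a_{j,j+1}|-|a_{j+1,j}|)^2\ge 0$, $j=1,\dots,n-1$. The rank-$k$ numerical range of $A\in M_n(\mathbb C)$ is $\Lambda_k(A)=\{\lambda\in\mathbb C: PAP=\lambda P\text{ for some rank-}k\text{ orthogonal projection }P\}$. Let $\lambda_1(\theta)\ge\dots\ge\lambda_n(\theta)$ be the eigenvalues (with multiplicity) of $\operatorname{Re}(e^{i\theta}A)=\frac12(e^{i\theta}A+e^{-i\theta}A^* )$, and let $\ell_j(\theta)=e^{-i\theta}(\lambda_j(\theta)+i\mathbb R)$, $\theta\in[0,2\pi)$. The Kippenhahn curve $C(A)$ is the envelope of this family of lines. It is understood via its tangent lines: $C(A)$ is the union of given ellipses if, for every $\theta$, the multiset of lines $\ell_1(\theta),\dots,\ell_n(\theta)$ is the multiset union of the pairs of tangent lines of these ellipses parallel to $e^{-i\theta}i\mathbb R$. Ellipses may be degenerate: an ellipse with minor axis of length zero is the pair of its foci (its ''tangent lines'' being the lines through one of the foci). For a set $E\subset\mathbb C$, $-E=\{-z:z\in E\}$, and $\operatorname{conv}$ denotes the convex hull. 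*)

(* Defs.v *)
(* The complex numbers are R[i] (mathcomp-real-closed) over a realType R
   (mathcomp-analysis). *)
From Stdlib Require List.
From HB Require Import structures.
From mathcomp Require Export all_boot all_order all_algebra.
From mathcomp Require Export complex.
From mathcomp Require Export boolp classical_sets reals trigo convex.

Set Implicit Arguments.
Unset Strict Implicit.
Unset Printing Implicit Defensive.

Import Order.TTheory GRing.Theory Num.Theory.

Local Open Scope classical_set_scope.
Local Open Scope complex_scope.
Local Open Scope sesquilinear_scope.
Local Open Scope ring_scope.

Section Definitions.
Variable R : realType.
Notation C := R[i].

Definition reciprocal n (A : 'M[C]_n) : Prop :=
  (forall i j : 'I_n, (i.+1 != j)%N -> (j.+1 != i)%N -> A i j = 0) /\
  (forall i j : 'I_n, j = i.+1 :> nat -> A i j * A j i = 1).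

(* The index j is 1-based, 1 <= j <= n, whereas the rows and columns of A are
   numbered from 0: the entries used are those in positions (j - 1, j) and
   (j, j - 1) of the 0-based numbering. *)
Definition xi n (A : 'M[C]_n.+1) (j : nat) : R :=
  (Normc.normc (A (inord j.-1) (inord j))
     - Normc.normc (A (inord j) (inord j.-1))) ^+ 2 / 4.

Definition rank_numerical_range n (k : nat) (A : 'M[C]_n) : set C :=
  [set l | exists P : 'M[C]_n,
     [/\ P ^t* = P, P *m P = P, \rank P = k & P *m A *m P = l *: P]].

Definition expi (t : R) : C := cos t +i* sin t.

Definition rotated_re n (A : 'M[C]_n) (t : R) : 'M[C]_n :=
  2^-1 *: (expi t *: A + expi (- t) *: A ^t*).

(* The eigenvalues of a Hermitian matrix, with multiplicity and in
   nonincreasing order.  They are the roots of the (monic, split)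
   characteristic polynomial; these are real when H is Hermitian, the only
   case in which this is used, so that taking real parts loses nothing. *)
Definition eigenvalues n (H : 'M[C]_n) : seq R :=
  sort >=%R [seq complex.Re z | z <- sval (closed_field_poly_normal (char_poly H))].

(* The line e^{-it}(s + iR). *)
Definition line (t s : R) : set C :=
  [set z | exists u : R, z = expi (- t) * (s +i* u)].

(* An ellipse is recorded by its foci and half the length of its minor axis. *)
Record ellipse := Ellipse {
  focus1 : C;
  focus2 : C;
  semiminor : R;
  semiminor_ge0 : 0 <= semiminor }.

Definition foci (E : ellipse) : set C := [set focus1 E; focus2 E].

Definition center (E : ellipse) : C := (focus1 E + focus2 E) / 2.

Definition semimajor (E : ellipse) : R :=
  Num.sqrt (semiminor E ^+ 2 + Normc.normc ((focus1 E - focus2 E) / 2) ^+ 2).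

(* With minor axis of length zero, the ellipse is the pair of its foci, not
   the segment between them that the equation would describe. *)
Definition points (E : ellipse) : set C :=
  if semiminor E == 0 then foci E
  else [set z | Normc.normc (z - focus1 E) + Normc.normc (z - focus2 E)
                  = 2 * semimajor E].

Definition opp_ellipse (E : ellipse) : ellipse :=
  Ellipse (- focus1 E) (- focus2 E) (semiminor_ge0 E).

Lemma points_opp_ellipse (E : ellipse) :
  points (opp_ellipse E) = [set - z | z in points E].
Proof.
have nN (x : C) : Normc.normc (- x) = Normc.normc x.
  by case: x => a b /=; rewrite !sqrrN.
case: E => f g b b0; rewrite /points /semimajor /foci /=.
case: eqP => _; last first.
  have -> : (- f - - g) / 2 = - ((f - g) / 2) by rewrite -opprD mulNr.
  rewrite nN; apply/seteqP; split=> z /=.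
    move=> h; exists (- z); last by rewrite opprK.
    by rewrite -opprD -[- z - g]opprD !nN -h !opprK.
  by case=> w <- <-; rewrite -!opprD !nN.
apply/seteqP; split=> z /=.
  by case=> ->; [exists f | exists g] => //; [left|right].
by case=> w [] -> <-; [left|right].
Qed.

(* L1 and L2 are the two tangent lines of E with direction i e^{-it}.  A line
   is tangent to a nondegenerate ellipse when it meets it in exactly one point;
   the tangent lines of a pair of foci are the lines through one of the foci,
   counted twice when the same line passes through both. *)
Definition tangent_pair (t : R) (E : ellipse) (L : set C * set C) : Prop :=
  [/\ range (line t) L.1, range (line t) L.2 &
    if semiminor E == 0 then L.1 (focus1 E) /\ L.2 (focus2 E)
    else [/\ L.1 <> L.2, exists z, L.1 `&` points E = [set z]
           & exists z, L.2 `&` points E = [set z]]].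

(* C(A) is the union of the ellipses in the list Es: perm_eq is equality of
   multisets, here of lines. *)
Definition kippenhahn_union n (A : 'M[C]_n) (Es : seq ellipse) : Prop :=
  forall t : R, 0 <= t < 2 * pi ->
    exists Ls : seq (set C * set C),
      List.Forall2 (tangent_pair t) Es Ls /\
      perm_eq [seq line t s | s <- eigenvalues (rotated_re A t)]
              (flatten [seq [:: L.1; L.2] | L <- Ls]).

(* Rcomplex R is R[i] as a vector space over R. *)
Definition conv (S : set C) : set C :=
  smallest (@convex_set R (Rcomplex R)) S.

(* C(A) = E0 \cup E \cup (-E), where E0 is centered at the origin with foci
   h and -h, and E is centered on the positive real axis with foci f and g. *)
Definition kippenhahn_ellipses n (A : 'M[C]_n) (f g h : R) (E0 E : ellipse) :
    Prop :=
  [/\ center E0 = 0 /\ foci E0 = [set h%:C; - h%:C],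
      exists2 p : R, 0 < p & center E = p%:C,
      foci E = [set f%:C; g%:C] &
      kippenhahn_union A [:: E0; E; opp_ellipse E]].

Definition condition1 (A : 'M[C]_6) : Prop :=
  [/\ xi A 2 = 2 * xi A 1 * cos (2 * pi / 7),
      xi A 4 = 2 * xi A 1 * cos (2 * pi / 7),
      xi A 3 = 0 & xi A 5 = xi A 1].

Definition condition2 (k : R) (A : 'M[C]_6) : Prop :=
  [/\ xi A 3 = k * xi A 1, xi A 5 = k * xi A 1,
      xi A 2 = 0 & xi A 4 = (k - 1) ^+ 2 * xi A 1].

Definition condition3 (k : R) (A : 'M[C]_6) : Prop :=
  [/\ xi A 1 = k * xi A 5, xi A 3 = k * xi A 5,
      xi A 2 = (k - 1) ^+ 2 * xi A 5 & xi A 4 = 0].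

End Definitions.

(* Main.v *)
(* Let B = A - mu and let ^H denote the adjoint. A point mu belongs to the
   rank-k range iff B has an isotropic subspace of dimension k, and then Re
   (wB) has at least k nonnegative eigenvalues for every unimodular w. For the
   converse, if v (z0 B + B^H) = 0 with |z0| <> 1, then v is isotropic, the
   spaces { x : v B x^H = 0 } and { x : x B v^H = 0 } coincide, and on their
   quotient by v the number of nonnegative eigenvalues drops by at most one
   while the polynomial det (z B + B^H) loses the factor (z - z0) (1 -
   conj(z0) z). Iterating leaves the case k = 1, which is the Toeplitz-
   Hausdorff theorem.

   For the reciprocal matrices at hand det (z B + B^H) is a product of three
   quadratic polynomials, one for each of E0, E and -E, and the factor of an
   ellipse has no unimodular root iff mu lies strictly inside it. Hence enough
   non-unimodular roots are available at interior points; boundary points are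
   reached by shrinking mu towards 0, and the Hermitian case where all xi_j
   vanish by perturbing A, using compactness of orthonormal frames. *)
Require Import Defs.
From mathcomp Require Import all_boot all_order all_algebra complex.
From mathcomp Require Import boolp classical_sets reals trigo.
From mathcomp Require Import mathcomp_extra interval_inference functions.
From mathcomp Require Import filter topology normedtype sequences.
From mathcomp Require Import ring lra zify.
Import Order.TTheory GRing.Theory Num.Theory.
Import numFieldNormedType.Exports.
Local Open Scope classical_set_scope.
Local Open Scope ring_scope.
Set Implicit Arguments.
Unset Strict Implicit.
Unset Printing Implicit Defensive.

(** * Limits along an ultrafilter *)

Section UltraLimit.
Variable R : realType.

(** Eigenvalue counts decide membership because the ellipses are ordered in the same way in every
    direction: the k-th largest eigenvalue of Re (w A) is then one fixed function of Re w, and the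
    resulting half-planes are those of a hull or of an intersection of hulls. The heptagonal cosines
    thus enter twice, in the factorization and in this order, and the order is what differs between
    the two families of ranges.

    The obstacle is the converse, since positivity in each direction comes with a subspace depending
    on the direction. Each reduction spends one factor of the pencil, so rank 3 needs two factors
    free of unimodular roots and rank 2 needs one; which ones are available depends on the ellipses
    around mu. The factors left over must not vanish identically, for otherwise the vector v of a
    reduction may satisfy v B = 0.

    The statement ranges over all E0 and E with the given centers and foci, so their semiminor axes
    have to be recovered from the spectrum. *)

Definition rbounded (u : nat -> R) := exists M : R, forall n, `|u n| <= M.

(** An ultrafilter finer than [\oo] gives one limit functional for all bounded sequences at once,
    and a multiplicative one, so that it passes through matrix products. The rate K / n in the last
    clause is that of every approximation to come. *)
Lemma real_ultralimit : exists L : (nat -> R) -> R,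
  [/\ forall u v : nat -> R, rbounded u -> rbounded v -> L (u \+ v) = L u + L v,
      forall u v : nat -> R, rbounded u -> rbounded v -> L (u \* v) = L u * L v &
      forall (u : nat -> R) (l K : R), (forall n, `|u n - l| <= K / n.+1%:R) -> L u = l].
Proof.
have [U [UU ooU]] := @ultraFilterLemma nat \oo eventually_filter.
have UF : ProperFilter U by exact: ultra_proper.
have bc u : rbounded u -> exists l : R, u @ U --> l.
  move=> [M hM].
  have uI : U (u @^-1` `[- M, M]).
    have -> : u @^-1` `[- M, M] = setT; last exact: filterT.
    by apply/seteqP; split=> // n _ /=; rewrite in_itv /= -ler_norml.
  (* A cluster point in the compact segment is a limit, since an ultrafilter contains each preimage
     or its complement. *)
  have [l [_ ul]] := @segment_compact R (- M) M (u @ U) _ uI.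
  exists l => B lB; case: (in_ultra_setVsetC (u @^-1` B) UU) => // UnB.
  by have [y []] := ul (~` B) B UnB lB.
have limP u : rbounded u -> u @ U --> lim (u @ U).
  by move=> /bc[l ul]; rewrite (cvg_lim _ ul).
exists (fun u => lim (u @ U)); split=> [u v bu bv|u v bu bv|u l K ul].
- by apply: cvg_lim => //; apply: cvgD; exact: limP.
- by apply: cvg_lim => //; apply: cvgM; exact: limP.
- apply: cvg_lim => //.
  have : u n @[n --> \oo] --> l.
    have e0 : (fun n => K * harmonic n) n @[n --> \oo] --> (0 : R).
      by rewrite -[X in _ --> X](mulr0 K); apply: cvgM; [exact: cvg_cst|exact: cvg_harmonic].
    apply/subr_cvg0; apply/norm_cvg0P.
    apply: (@squeeze_cvgr _ _ _ _ (cst 0) (fun n => K * harmonic n)) => //; last exact: cvg_cst.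
    by near=> n; rewrite normr_ge0 /=; exact: ul.
  by move=> /(_ _ _)/= cv A nA; apply: ooU; exact: cv.
Unshelve. all: by end_near.
Qed.

Local Notation C := R[i].

Definition cbounded (u : nat -> C) := exists M : R, forall n, Normc.normc (u n) <= M.

Lemma normc_ge_Re_Im (z : C) :
  `|complex.Re z| <= Normc.normc z /\ `|complex.Im z| <= Normc.normc z.
Proof.
case: z => a b /=; rewrite -!sqrtr_sqr.
by split; apply: ler_wsqrtr; rewrite ?lerDl ?lerDr sqr_ge0.
Qed.

Lemma complex_ultralimit : exists L : (nat -> C) -> C,
  [/\ forall u v : nat -> C, cbounded u -> cbounded v -> L (u \+ v) = L u + L v,
      forall u v : nat -> C, cbounded u -> cbounded v -> L (u \* v) = L u * L v,
      forall u, cbounded u -> L (fun n => (u n)^*) = (L u)^* &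
      forall (u : nat -> C) (l : C) (K : R), (forall n, Normc.normc (u n - l) <= K /
        n.+1%:R) -> L u = l].
Proof.
have [L [LD LM Ll]] := real_ultralimit.
pose re (u : nat -> C) n := complex.Re (u n).
pose im (u : nat -> C) n := complex.Im (u n).
have bre u : cbounded u -> rbounded (re u).
  by case=> M uM; exists M => n; case: (normc_ge_Re_Im (u n)) => h _; exact: le_trans (uM n).
have bim u : cbounded u -> rbounded (im u).
  by case=> M uM; exists M => n; case: (normc_ge_Re_Im (u n)) => _ h; exact: le_trans (uM n).
have bM u v : rbounded u -> rbounded v -> rbounded (u \* v).
  move=> [M uM] [N vN]; exists (M * N) => n /=.
  by rewrite normrM; apply: ler_pM.
have Lc k : L (cst k) = k by apply: (Ll _ _ 0) => n; rewrite subrr normr0 mul0r.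
have bc k : rbounded (cst k) by exists `|k|.
have LN u : rbounded u -> L (fun n => - u n) = - L u.
  move=> bu; have -> : (fun n => - u n) = cst (-1) \* u by apply/funext => n /=; rewrite mulN1r.
  by rewrite LM // Lc mulN1r.
exists (fun u => Complex (L (re u)) (L (im u))); split=> [u v bu bv|u v bu bv|u bu|u l K ul].
- have -> : re (u \+ v) = re u \+ re v by apply/funext => n; rewrite /re /=; case: (u n) (v
  n) => [a b] [].
  have -> : im (u \+ v) = im u \+ im v by apply/funext => n; rewrite /im /=; case: (u n) (v
    n) => [a b] [].
  by rewrite !LD; auto.
- have -> : re (u \* v) = (re u \* re v) \+ (fun n => - (im u \* im v) n).
    by apply/funext => n; rewrite /re /im /=; case: (u n) (v n) => [a b] [].
  have -> : im (u \* v) = (re u \* im v) \+ (im u \* re v).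
    by apply/funext => n; rewrite /re /im /=; case: (u n) (v n) => [a b] [].
  have bN : rbounded (fun n => - (im u \* im v) n).
    by have [M h] := bM _ _ (bim _ bu) (bim _ bv); exists M => n; rewrite normrN.
  rewrite !LD ?LN ?LM; auto.
- have -> : re (fun n => (u n)^*) = re u by apply/funext => n; rewrite /re; case: (u n).
  have -> : im (fun n => (u n)^*) = (fun n => - im u n).
    by apply/funext => n; rewrite /im; case: (u n).
  by rewrite LN; auto.
- rewrite (Ll (re u) (complex.Re l) K) ?(Ll (im u) (complex.Im l) K); first by case: l {ul}.
  + move=> n; apply: le_trans (ul n); have [_] := normc_ge_Re_Im (u n - l).
    by rewrite /im; case: (u n) => ? ?; case: l {ul}.
  + move=> n; apply: le_trans (ul n); have [+ _] := normc_ge_Re_Im (u n - l).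
    by rewrite /re; case: (u n) => ? ?; case: l {ul}.
Qed.

End UltraLimit.

(** * Sesquilinear forms and limits of orthonormal frames *)

Section Adj.
Local Open Scope sesquilinear_scope.
Variable C : numClosedFieldType.
Lemma adjmxM m n p (A : 'M[C]_(m, n)) (B : 'M_(n, p)) :
  (A *m B)^t* = B^t* *m A^t*.
Proof. by rewrite trmx_mul map_mxM. Qed.

Lemma adjmxD m n (A B : 'M[C]_(m, n)) : (A + B)^t* = A^t* + B^t*.
Proof. by rewrite linearD /= map_mxD. Qed.

Lemma adjmxZ m n a (A : 'M[C]_(m, n)) : (a *: A)^t* = a^* *: A^t*.
Proof. by rewrite linearZ /= map_mxZ. Qed.

Lemma adjmx1 n : (1%:M : 'M[C]_n)^t* = 1%:M.
Proof. by rewrite trmx1 map_mx1. Qed.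

Definition sform n (B : 'M[C]_n) (x y : 'rV[C]_n) : C := (x *m B *m y^t*) 0 0.

Lemma sformDl n (B : 'M[C]_n) x y z : sform B (x + y) z = sform B x z + sform B y z.
Proof. by rewrite /sform !mulmxDl mxE. Qed.

Lemma sformDr n (B : 'M[C]_n) x y z : sform B x (y + z) = sform B x y + sform B x z.
Proof. by rewrite /sform adjmxD mulmxDr mxE. Qed.

Lemma sformZl n (B : 'M[C]_n) a x y : sform B (a *: x) y = a * sform B x y.
Proof. by rewrite /sform -!scalemxAl mxE. Qed.

Lemma sformZr n (B : 'M[C]_n) a x y : sform B x (a *: y) = a^* * sform B x y.
Proof. by rewrite /sform adjmxZ -scalemxAr mxE. Qed.

Lemma sformE n (B : 'M[C]_n) x y : x *m B *m y^t* = (sform B x y)%:M.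
Proof. by rewrite [LHS]mx11_scalar. Qed.

Lemma sform_adj n (B : 'M[C]_n) x y : (sform B x y)^* = sform (B^t*) y x.
Proof.
have -> : (sform B x y)^* = ((x *m B *m y^t*)^t*) 0 0 by rewrite [RHS]mxE [in RHS]mxE.
by rewrite !adjmxM trmxCK mulmxA.
Qed.

Lemma sformMD n (A B : 'M[C]_n) x y : sform (A + B) x y = sform A x y + sform B x y.
Proof. by rewrite /sform mulmxDr mulmxDl mxE. Qed.

Lemma sformMZ n a (B : 'M[C]_n) x y : sform (a *: B) x y = a * sform B x y.
Proof. by rewrite /sform -scalemxAr -scalemxAl mxE. Qed.

Lemma sform1E n (x : 'rV[C]_n) : sform 1%:M x x = \sum_j `|x 0 j| ^+ 2.
Proof.
rewrite /sform mulmx1 mxE; apply: eq_bigr => j _.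
by rewrite !mxE -normCK.
Qed.

Lemma sform1_ge0 n (x : 'rV[C]_n) : 0 <= sform 1%:M x x.
Proof. by rewrite sform1E sumr_ge0 // => j _; rewrite exprn_ge0. Qed.

Lemma sform1_eq0 n (x : 'rV[C]_n) : (sform 1%:M x x == 0) = (x == 0).
Proof.
rewrite sform1E psumr_eq0; last by move=> j _; rewrite exprn_ge0.
apply/allP/eqP => [h|-> j _]; last by rewrite mxE normr0 expr0n /= eqxx.
apply/rowP => j; rewrite mxE; apply/eqP.
by have := h j (mem_index_enum _); rewrite sqrf_eq0 normr_eq0.
Qed.

End Adj.

Section MatrixLimit.
Local Open Scope sesquilinear_scope.
Variables (R : realType).
Local Notation C := R[i].
Variable L : (nat -> C) -> C.
Hypothesis LD : forall u v : nat -> C, cbounded u -> cbounded v -> L (u \+ v) = L u + L v.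
Hypothesis LM : forall u v : nat -> C, cbounded u -> cbounded v -> L (u \* v) = L u * L v.
Hypothesis LJ : forall u, cbounded u -> L (fun n => (u n)^*) = (L u)^*.
Hypothesis Ll : forall (u : nat -> C) (l : C) (K : R),
  (forall n, Normc.normc (u n - l) <= K / n.+1%:R) -> L u = l.

Definition limmx m n (X : nat -> 'M[C]_(m, n)) : 'M[C]_(m, n) :=
  \matrix_(i, j) L (fun t => X t i j).

Definition mxbounded m n (X : nat -> 'M[C]_(m, n)) :=
  forall i j, cbounded (fun t => X t i j).

Lemma cboundedM u v : cbounded u -> cbounded v -> cbounded (u \* v : nat -> C).
Proof.
move=> [M uM] [N vN]; exists (M * N) => n /=; rewrite Normc.normcM.
by apply: ler_pM => //; [case: (u n) | case: (v n)] => ? ? /=; rewrite sqrtr_ge0.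
Qed.

Lemma cbounded_sum (I : eqType) (s : seq I) (F : I -> nat -> C) :
  (forall i, cbounded (F i)) ->
  cbounded (fun t => \sum_(i <- s) F i t) /\
  L (fun t => \sum_(i <- s) F i t) = \sum_(i <- s) L (F i).
Proof.
move=> bF; elim: s => [|i s [[M IHb] IHL]].
  rewrite big_nil; split; first by exists 0 => t; rewrite big_nil Normc.normc0.
  by apply: (@Ll _ _ 0) => t; rewrite big_nil subr0 Normc.normc0 mul0r.
have -> : (fun t => \sum_(k <- i :: s) F k t) = F i \+ (fun t => \sum_(k <- s) F k t).
  by apply/funext => t; rewrite big_cons.
split; last by rewrite LD ?IHL ?big_cons //; exists M.
have [N hN] := bF i; exists (N + M) => t /=.
by apply: le_trans (le_normcD _ _) _; apply: lerD.
Qed.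

Lemma mxboundedM m n p (X : nat -> 'M[C]_(m, n)) (Y : nat -> 'M[C]_(n, p)) :
  mxbounded X -> mxbounded Y -> mxbounded (fun t => X t *m Y t).
Proof.
move=> bX bY i j.
have -> : (fun t => (X t *m Y t) i j) = fun t => \sum_k ((fun t => X t i k) \* (fun t => Y
  t k j)) t.
  by apply/funext => t; rewrite mxE.
by apply: (cbounded_sum _ _).1 => k; apply: cboundedM.
Qed.

Lemma limmxM m n p (X : nat -> 'M[C]_(m, n)) (Y : nat -> 'M[C]_(n, p)) :
  mxbounded X -> mxbounded Y -> limmx (fun t => X t *m Y t) = limmx X *m limmx Y.
Proof.
move=> bX bY; apply/matrixP => i j; rewrite !mxE.
have -> : (fun t => (X t *m Y t) i j) = fun t => \sum_k ((fun t => X t i k) \* (fun t => Y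
  t k j)) t.
  by apply/funext => t; rewrite mxE.
rewrite (cbounded_sum _ _).2 => [|k]; last exact: cboundedM.
by apply: eq_bigr => k _; rewrite !mxE LM.
Qed.

Lemma normc_conj (z : C) : Normc.normc z^* = Normc.normc z.
Proof. by case: z => a b /=; rewrite sqrrN. Qed.

Lemma mxbounded_adj m n (X : nat -> 'M[C]_(m, n)) :
  mxbounded X -> mxbounded (fun t => (X t)^t*).
Proof. by move=> bX i j; have [M h] := bX j i; exists M => t; rewrite !mxE normc_conj. Qed.

Lemma limmx_adj m n (X : nat -> 'M[C]_(m, n)) :
  mxbounded X -> limmx (fun t => (X t)^t*) = (limmx X)^t*.
Proof.
move=> bX; apply/matrixP => i j; rewrite !mxE -LJ //.
by congr L; apply/funext => t; rewrite !mxE.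
Qed.

Lemma limmx_cvg m n (X : nat -> 'M[C]_(m, n)) (A : 'M[C]_(m, n)) (K : R) :
  (forall t i j, Normc.normc (X t i j - A i j) <= K / t.+1%:R) ->
  mxbounded X /\ limmx X = A.
Proof.
move=> h; split=> [i j|]; last by apply/matrixP => i j; rewrite mxE; apply: (@Ll _ _ K).
exists (K + Normc.normc (A i j)) => t.
rewrite -[X t i j](subrK (A i j)); apply: le_trans (le_normcD _ _) _.
rewrite lerD2r; apply: le_trans (h t i j) _.
have K0 : 0 <= K.
  have := h 0%N i j; rewrite divr1; apply: le_trans.
  by case: (X 0%N i j - A i j) => ? ? /=; rewrite sqrtr_ge0.
by rewrite ler_pdivrMr ?ltr0n // ler_peMr // ler1n.
Qed.

Lemma mxbounded_unitary m n (X : nat -> 'M[C]_(m, n)) :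
  (forall t, X t *m (X t)^t* = 1%:M) -> mxbounded X.
Proof.
move=> h i j; exists 1 => t.
have /matrixP/(_ i i) := h t; rewrite !mxE eqxx mulr1n => hi.
have n0 : 0 <= Normc.normc (X t i j) by case: (X t i j) => ? ? /=; rewrite sqrtr_ge0.
rewrite -(@expr_le1 _ 2) // -lecR rmorphXn /= -[(Normc.normc _)%:C%C]/(`|X t i j|).
have -> : 1%:C%C = 1 :> C by [].
rewrite -hi (bigD1 j) //= !mxE -normCK lerDl sumr_ge0 // => k _.
by rewrite !mxE -normCK exprn_ge0.
Qed.

End MatrixLimit.

Section FrameLimit.
Local Open Scope sesquilinear_scope.

(** Frames have entries of modulus at most 1, so both equations survive an ultralimit. With a
    constant matrix this gives boundary points of a range, with a constant point it gives limits of
    matrices. *)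
Lemma frame_limit (R : realType) k n (A : 'M[R[i]]_n) (mu : R[i])
    (A_ : nat -> 'M[R[i]]_n) (mu_ : nat -> R[i]) (K : R) :
  (forall t i j, Normc.normc (A_ t i j - A i j) <= K / t.+1%:R) ->
  (forall t, Normc.normc (mu_ t - mu) <= K / t.+1%:R) ->
  (forall t, exists X : 'M_(k, n), X *m X^t* = 1%:M /\ X *m A_ t *m X^t* = (mu_ t)%:M) ->
  exists X : 'M_(k, n), X *m X^t* = 1%:M /\ X *m A *m X^t* = mu%:M.
Proof.
move=> hA hmu /choice[X hX].
have [L [LD LM LJ Ll]] := complex_ultralimit R.
have bX : mxbounded X by apply: mxbounded_unitary => t; case: (hX t).
have bXJ := mxbounded_adj bX.
have [bA lA] := limmx_cvg Ll hA.
have hmu' t (i j : 'I_k) : Normc.normc ((mu_ t)%:M i j - mu%:M i j) <= K / t.+1%:R.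
  rewrite !mxE; case: eqP => _; rewrite ?mulr1n ?mulr0n //.
  by rewrite subrr Normc.normc0 (le_trans _ (hmu t)) //; case: (mu_ t - mu) => ? ? /=;
    rewrite sqrtr_ge0.
have [_ lmu] := limmx_cvg Ll hmu'.
have h1 t (i j : 'I_k) : Normc.normc ((1%:M : 'M_k) i j - (1%:M : 'M[R[i]]_k) i j) <= 0 /
  t.+1%:R.
  by rewrite subrr Normc.normc0 mul0r.
have [_ l1] := limmx_cvg Ll h1.
exists (limmx L X); split.
  rewrite -(limmx_adj LJ) // -(limmxM LD LM Ll) // -[RHS]l1.
  by congr limmx; apply/funext => t; case: (hX t).
rewrite -(limmx_adj LJ) // -{1}lA -(limmxM LD LM Ll) // -(limmxM LD LM Ll) //; last exact:
  (mxboundedM LD Ll).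
by rewrite -[RHS]lmu; congr limmx; apply/funext => t; case: (hX t).
Qed.

End FrameLimit.

(** * The Toeplitz-Hausdorff theorem *)

Section ToeplitzHausdorff.
Local Open Scope sesquilinear_scope.
Variable R : realType.
Local Notation C := R[i].
Local Notation "x %:C" := (real_complex R x) (format "x %:C") : ring_scope.

Lemma normc_ge0 (z : C) : 0 <= Normc.normc z.
Proof. by case: z => a b /=; rewrite sqrtr_ge0. Qed.

Lemma normcX2 (z : C) : Normc.normc z ^+ 2 = complex.Re z ^+ 2 + complex.Im z ^+ 2.
Proof. by case: z => a b /=; rewrite sqr_sqrtr // addr_ge0 ?sqr_ge0. Qed.

Lemma mulcJE (z : C) : z * z^* = (Normc.normc z ^+ 2)%:C.
Proof. by rewrite -normCK rmorphXn. Qed.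

Lemma conj_fixedE (z : C) : z^* = z -> z = (complex.Re z)%:C.
Proof.
case: z => a b [] /eqP; rewrite eq_sym -addr_eq0 -mulr2n mulrn_eq0 /= => /eqP ->.
by [].
Qed.

Lemma conj_real (a : R) : (a%:C)^* = a%:C.
Proof. by apply/CrealP; rewrite complex_real. Qed.

Lemma quadratic_real_root (a b c : R) : 0 < a -> 0 < c ->
  exists t : R, a * t ^+ 2 + b * t - c = 0.
Proof.
move=> a0 c0; have d0 : 0 <= b ^+ 2 + 4 * a * c by rewrite addr_ge0 ?sqr_ge0 // !mulr_ge0
  // ltW.
exists ((Num.sqrt (b ^+ 2 + 4 * a * c) - b) / (2 * a)).
have := sqr_sqrtr d0; set s := Num.sqrt _ => hs.
have -> : a * ((s - b) / (2 * a)) ^+ 2 + b * ((s - b) / (2 * a)) - c = (s ^+ 2 - b ^+ 2) /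
  (4 * a) - c.
  by field; rewrite gt_eqF.
by rewrite hs; field; rewrite gt_eqF.
Qed.

(** The sum is real iff Im (u (d - conj c)) = 0, so u is taken to be the conjugate phase of d - conj
    c. *)
Lemma phase_real (c d : C) :
  exists u : C, u * u^* = 1 /\ (u^* * c + u * d)^* = u^* * c + u * d.
Proof.
pose e := d - c^*; have [e0|e0] := eqVneq e 0.
  exists 1; rewrite rmorph1 !mul1r; split=> //.
  have -> : d = c^* by apply/eqP; rewrite -subr_eq0 -/e e0.
  by rewrite rmorphD /= conjCK addrC.
have n0 : `|e| != 0 by rewrite normr_eq0.
exists (e^* / `|e|); split.
  rewrite rmorphM /= conjCK fmorphV /= [(`|e|)^*]geC0_conj // mulrACA -invfM -expr2 normCK
    [e^* * e]mulrC.
  by rewrite divff // mulf_neq0 // conjC_eq0.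
set u := e^* / `|e|.
have ur : u * e = (u * e)^*.
  rewrite /u mulrAC [e^* * e]mulrC -normCK expr2 mulfK // geC0_conj //.
clearbody u; have de : d = e + c^* by rewrite /e subrK.
rewrite de mulrDr rmorphD rmorphD /= -ur !rmorphM /= !conjCK.
by ring.
Qed.

Lemma hausdorff_identity (F : comNzRingType) (a b t D K tau : F) :
  (1 - tau) * t ^+ 2 + (D - tau * K) * t - tau = 0 ->
  a * 1 + t * ((b - a) * D + a * K) + t ^+ 2 * b
    = (a + tau * (b - a)) * (1 + t * K + t ^+ 2).
Proof.
move=> h; apply/eqP; rewrite -subr_eq0.
have -> : a * 1 + t * ((b - a) * D + a * K) + t ^+ 2 * b
    - (a + tau * (b - a)) * (1 + t * K + t ^+ 2)
  = (b - a) * ((1 - tau) * t ^+ 2 + (D - tau * K) * t - tau) by ring.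
by rewrite h mulr0.
Qed.

Lemma cross_term (F : fieldType) (a e s s' q q' u u' : F) : e != 0 ->
  u' * q + u * q'
  = e * (u' * ((q - a * s) / e) + u * ((q' - a * s') / e)) + a * (u' * s + u * s').
Proof. by move=> e0; field. Qed.

Lemma line_identity (F : comNzRingType) (p q r s t u v : F) :
  u * v = 1 ->
  p + t * v * q + (t * u * r + t * u * (t * v * s)) = p + t * (v * q + u * r) + t ^+ 2 * s.
Proof. by move=> uv; rewrite -[t ^+ 2]mulr1 -uv; ring. Qed.

Lemma sform_line n (M : 'M[C]_n) (x y : 'rV[C]_n) (t : R) (u : C) : u * u^* = 1 ->
  sform M (x + (t%:C * u) *: y) (x + (t%:C * u) *: y)
  = sform M x x + t%:C * (u^* * sform M x y + u * sform M y x) + t%:C ^+ 2 * sform M y y.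
Proof.
move=> uu; rewrite !(sformDl, sformDr, sformZl, sformZr) rmorphM /= conj_real.
exact: line_identity.
Qed.

(** Replacing B by (B - a) / (b - a) moves the two values to 0 and 1. Along x + t u y, with t real
    and u from [phase_real], the form is then real, and asking that it be tau times the squared norm
    is a real quadratic equation in t whose extreme coefficients 1 - tau and - tau have opposite
    signs. As z is not normalised, the factor [sform 1%:M z z] appears. *)
Lemma toeplitz_hausdorff n (B : 'M[C]_n) (x y : 'rV[C]_n) (tau : R) :
  sform 1%:M x x = 1 -> sform 1%:M y y = 1 -> 0 < tau -> tau < 1 ->
  exists z : 'rV[C]_n, z != 0 /\
    sform B z z = (sform B x x + tau%:C * (sform B y y - sform B x x)) * sform 1%:M z z.
Proof.
move=> x1 y1 t0 t1; set a := sform B x x; set b := sform B y y.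
have [ab|ab] := eqVneq a b.
  exists x; split; last by rewrite x1 mulr1 -ab subrr mulr0 addr0.
  by apply: contra_eq_neq x1 => ->; rewrite /sform !mul0mx mxE eq_sym oner_eq0.
pose c := (sform B x y - a * sform 1%:M x y) / (b - a).
pose d := (sform B y x - a * sform 1%:M y x) / (b - a).
have [u [uu ur]] := phase_real c d.
have := conj_fixedE ur; set D := complex.Re _ => hD.
have kr : (u^* * sform 1%:M x y + u * sform 1%:M y x)^* = u^* * sform 1%:M x y + u * sform
  1%:M y x.
  by rewrite rmorphD [in LHS]rmorphM [X in _ + X]rmorphM /= conjCK !sform_adj adjmx1 addrC.
have := conj_fixedE kr; set K := complex.Re _ => hK.
have ba : b - a != 0 by rewrite subr_eq0 eq_sym.
have t1' : 0 < 1 - tau by rewrite subr_gt0.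
have [t ht] := quadratic_real_root (D - tau * K) t1' t0.
exists (x + (t%:C * u) *: y); split.
  (* If z vanished, x would be a unimodular multiple of y and the two values would agree. *)
  apply: contra_neq ab => z0.
  have xE : x = - (t%:C * u) *: y by apply/eqP; rewrite scaleNr -addr_eq0 z0.
  have tu : (t%:C * u) * (t%:C * u)^* = 1.
    by move: x1; rewrite xE sformZl sformZr y1 mulr1 rmorphN mulrNN.
  by rewrite /a /b [in LHS]xE sformZl sformZr rmorphN mulrA mulrNN tu mul1r.
rewrite !sform_line // x1 y1 hK.
rewrite (@cross_term _ a (b - a) (sform 1%:M x y) (sform 1%:M y x) (sform B x y) (sform B y
  x) u u^* ba) hK hD -/a mulr1 -[X in X + _ + _]mulr1.
apply: hausdorff_identity.
have /(congr1 (real_complex R)) := ht.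
by rewrite rmorphB rmorphD rmorphM rmorphB rmorph1 rmorphXn rmorphM rmorphB rmorphM.
Qed.
End ToeplitzHausdorff.

(** * Zero in the numerical range *)

Section Isotropic1.
Local Open Scope sesquilinear_scope.
Variable R : realType.
Local Notation C := R[i].
Local Notation "x %:C" := (real_complex R x) (format "x %:C") : ring_scope.

(* Equivalently, the [k]-th largest eigenvalue of [Re (w B)] is nonnegative for
   every unimodular [w]; being isotropic for [B] on a [k]-dimensional space
   implies it. *)
Definition nonneg_dim n (B : 'M[C]_n) (k : nat) : Prop :=
  forall w : C, w * w^* = 1 -> exists N : 'M[C]_n,
    (k <= \rank N)%N /\
    forall x : 'rV_n, (x <= N)%MS -> 0 <= complex.Re (w * sform B x x).

Lemma ReZ (a : R) (z : C) : complex.Re (a%:C * z) = a * complex.Re z.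
Proof. by case: z => x y /=; rewrite mul0r subr0. Qed.

Lemma normalizeP n (z : 'rV[C]_n) : z != 0 ->
  exists c : R, 0 < c /\ forall M : 'M[C]_n,
    sform M z z = c%:C * sform M (((Num.sqrt c)^-1)%:C *: z) (((Num.sqrt c)^-1)%:C *: z)
    /\ sform 1%:M (((Num.sqrt c)^-1)%:C *: z) (((Num.sqrt c)^-1)%:C *: z) = 1.
Proof.
move=> z0; have sge := sform1_ge0 z.
have sE := conj_fixedE (geC0_conj sge).
have c0 : 0 < complex.Re (sform 1%:M z z).
  rewrite lt_neqAle -lecR -sE sge andbT eq_sym; apply/eqP => r0.
  by move: sE; rewrite r0 => /eqP; rewrite [_ == _]sform1_eq0 (negPf z0).
exists (complex.Re (sform 1%:M z z)); split=> // M.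
set c := complex.Re _ in c0 sE *.
have c1 : c%:C * (((Num.sqrt c)^-1)%:C * ((Num.sqrt c)^-1)%:C) = 1.
  by rewrite -!rmorphM /= -invfM -expr2 sqr_sqrtr ?ltW // divff ?gt_eqF.
move: (((Num.sqrt c)^-1)%:C) c1 (conj_real (Num.sqrt c)^-1) => d c1 dJ.
rewrite !sformZl !sformZr dJ; split; first by rewrite (mulrA d) mulrA c1 mul1r.
by rewrite sE mulrA mulrC c1.
Qed.

(** Take a unit vector whose value q has least modulus m. If m > 0, the direction opposite to q
    supplies a unit vector with value p such that Re (conj q p) <= 0, and by convexity a point of
    the segment from q to p, closer to 0 than q, is again a value. *)
Lemma isotropic1 n (B : 'M[C]_n) : nonneg_dim B 1 ->
  exists x : 'rV_n, x != 0 /\ sform B x x = 0.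
Proof.
move=> nnB.
have nnU w : w * w^* = 1 ->
    exists2 y : 'rV_n, sform 1%:M y y = 1 & 0 <= complex.Re (w * sform B y y).
  move=> /nnB[N [rN hN]].
  have /row_subPn[i Ni] : ~~ (N <= (0 : 'M_n))%MS by rewrite submx0 -mxrank_eq0 -lt0n.
  have : row i N != 0 by rewrite -submx0.
  move=> /normalizeP[c [c0 hc]].
  exists (((Num.sqrt c)^-1)%:C *: row i N); first by have [] := hc B.
  by apply: hN; apply/scalemx_sub/row_sub.
pose S : set R := [set Normc.normc (sform B x x) | x in [set x : 'rV_n | sform 1%:M x x = 1]].
have Si : has_inf S.
  split; last by exists 0 => _ [x _ <-]; exact: normc_ge0.
  have [|y y1 _] := nnU 1; first by rewrite rmorph1 mulr1.
  by exists (Normc.normc (sform B y y)); exists y.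
pose m := inf S.
have mS x : sform 1%:M x x = 1 -> m <= Normc.normc (sform B x x).
  by move=> x1; apply: ge_inf; [case: Si | exists x].
have m0 : 0 <= m by apply: lb_le_inf; [case: Si | move=> _ [x _ <-]; exact: normc_ge0].
have [x x1 xm] : exists2 x, sform 1%:M x x = 1 & Normc.normc (sform B x x) = m.
  have /choice[X hX] : forall t : nat, exists x : 'rV_n, sform 1%:M x x = 1 /\
      Normc.normc (sform B x x) < m + t.+1%:R^-1.
    move=> t; have [|_ [x x1 <-] xm] := @inf_adherent _ S (t.+1%:R^-1) _ Si; first by
      rewrite invr_gt0 ltr0n.
    by exists x.
  have [L [LD LM LJ Ll]] := complex_ultralimit R.
  have XX t : X t *m (X t)^t* = 1%:M by have := sformE 1%:M (X t) (X t); rewrite mulmx1 (hX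
    t).1.
  have bX := mxbounded_unitary XX; have bXJ := mxbounded_adj bX.
  have hB t (i j : 'I_n) : Normc.normc (B i j - B i j) <= 0 / t.+1%:R.
    by rewrite subrr Normc.normc0 mul0r.
  have [bB lB] := limmx_cvg Ll hB.
  have h1 t (i j : 'I_n) : Normc.normc ((1%:M : 'M[C]_n) i j - (1%:M : 'M[C]_n) i j) <= 0 /
    t.+1%:R.
    by rewrite subrr Normc.normc0 mul0r.
  have [b1 l1] := limmx_cvg Ll h1.
  have lim M M_ : mxbounded M_ -> limmx L M_ = M ->
      L (fun t => sform (M_ t) (X t) (X t)) = sform M (limmx L X) (limmx L X).
    move=> bM lM; rewrite /sform -(limmx_adj LJ) // -{1}lM -(limmxM LD LM Ll) // -(limmxM
      LD LM Ll) //.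
      by rewrite mxE.
    exact: (mxboundedM LD Ll).
  exists (limmx L X).
    rewrite -(lim _ _ b1 l1) (_ : (fun t => _) = fun=> 1); last by apply/funext => t; case:
      (hX t).
    by apply: (Ll _ _ 0) => t; rewrite subrr Normc.normc0 mul0r.
  rewrite -(lim _ _ bB lB); set u := (fun t => _).
  have bu : cbounded u by apply: (mxboundedM LD Ll (mxboundedM LD Ll bX bB) bXJ).
  (* The modulus is reached through u conj u, which L respects; m <= r <= m + e with e <= 1 gives
     r^2 - m^2 <= (2 m + 1) e. *)
  have uE : L (u \* (fun t => (u t)^*)) = (m ^+ 2)%:C.
    apply: (Ll _ _ (2 * m + 1)) => t /=; rewrite mulcJE -rmorphB /=.
    have [h1' h2'] := (mS _ (hX t).1, ltW (hX t).2).
    rewrite /= expr0n addr0 sqrtr_sqr.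
    rewrite -[sform B _ _]/(u t) in h1' h2'; move: (Normc.normc (u t)) h1' h2' => r h1' h2'.
    have t0 : 0 < t.+1%:R^-1 :> R by rewrite invr_gt0 ltr0n.
    have t1 : t.+1%:R^-1 <= 1 :> R by rewrite invf_le1 ?ltr0n // ler1n.
    move: (t.+1%:R^-1) t0 t1 h2' => e e0 e1 h2'.
    have r2 : m ^+ 2 <= r ^+ 2 by rewrite ler_sqr ?nnegrE // (le_trans m0).
    by rewrite ger0_norm ?subr_ge0 //; nra.
  move: uE; rewrite LM ?LJ //; last by have [M hM] := bu; exists M => t; rewrite normc_conj.
  rewrite mulcJE => /(congr1 (@complex.Re R)) /= /eqP; rewrite eqrXn2 // ?normc_ge0 //.
  by move/eqP.
have [m00|mn0] := eqVneq m 0.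
  exists x; split; last by apply: Normc.eq0_normc; rewrite xm.
  by apply: contra_eq_neq x1 => ->; rewrite /sform !mul0mx mxE eq_sym oner_eq0.
have mp : 0 < m by rewrite lt_neqAle eq_sym mn0.
clearbody m; pose q := sform B x x.
have qn : q * q^* = (m ^+ 2)%:C by rewrite mulcJE xm.
pose w := - q^* / m%:C.
have mC : m%:C != 0 by rewrite eq_complex /= eqxx andbT.
have w1 : w * w^* = 1.
  rewrite /w [X in _ * X]rmorphM /= rmorphN /= conjCK fmorphV /= conj_real mulrACA mulrNN
    [q^* * q]mulrC qn.
  by rewrite rmorphXn /= expr2; field.
have [y y1 hy] := nnU w w1.
have [p pE] : exists p, p = sform B y y by exists (sform B y y).
have qp : complex.Re (q^* * p) <= 0.
  have : w * sform B y y = (- m^-1)%:C * (q^* * p).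
    by rewrite /w -pE rmorphN /= fmorphV /= !mulNr mulrAC [X in - X]mulrC.
  move=> e; move: hy; rewrite e ReZ mulNr oppr_ge0 pmulr_rle0 // ?invr_gt0 //.
pose Q := Normc.normc (p - q) ^+ 2.
have Q0 : 0 <= Q by rewrite exprn_ge0 // normc_ge0.
(* The squared modulus of q + tau (p - q) is at most m^2 - tau (2 m^2 - tau Q), so tau Q < 2 m^2 is
   enough; the summand m^2 in the denominator keeps tau below 1 even for small Q. *)
pose tau := m ^+ 2 / (2 * (m ^+ 2 + Q)).
have m2 : 0 < m ^+ 2 by rewrite exprn_gt0.
have d0 : 0 < m ^+ 2 + Q by rewrite ltr_wpDr.
have t0 : 0 < tau by rewrite divr_gt0 // mulr_gt0.
have tQ : tau * Q <= m ^+ 2 / 2.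
  by rewrite /tau mulrAC ler_pdivrMr ?mulr_gt0 //; nra.
have t1 : tau < 1 by rewrite ltr_pdivrMr ?mulr_gt0 //; nra.
have [z [z0 hz]] := toeplitz_hausdorff B x1 y1 t0 t1.
have [c [c0 hc]] := normalizeP z0.
have [zB zn] := hc B.
have := mS _ zn; set v := sform B (_ *: z) _.
have -> : v = q + tau%:C * (p - q).
  have cC : c%:C != 0 by rewrite eq_complex /= eqxx andbT gt_eqF.
  apply: (mulfI cC); rewrite -zB hz pE [RHS]mulrC; congr (_ * _).
  by rewrite (hc 1%:M).1 zn mulr1.
rewrite -ler_sqr ?nnegrE ?normc_ge0 // => h; exfalso; move: h; apply/negP; rewrite -ltNge.
have qm : complex.Re q ^+ 2 + complex.Im q ^+ 2 = m ^+ 2 by rewrite -normcX2 xm.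
move: qp tQ; rewrite normcX2 /Q normcX2.
move: (q) (p) qm => [q1 q2] [p1 p2] /= qm; rewrite !mul0r !subr0 !addr0 mulNr opprK => qp tQ.
have -> : (q1 + tau * (p1 - q1)) ^+ 2 + (q2 + tau * (p2 - q2)) ^+ 2 =
  (q1 ^+ 2 + q2 ^+ 2) + tau * (2 * (q1 * p1 + q2 * p2) - 2 * (q1 ^+ 2 + q2 ^+ 2)
     + tau * ((p1 - q1) ^+ 2 + (p2 - q2) ^+ 2)) by ring.
rewrite qm gtrDl pmulr_rlt0 //; lra.
Qed.
End Isotropic1.

(** * Splitting a hyperbolic plane off the pencil of a matrix *)

Section Reduction.
Local Open Scope sesquilinear_scope.
Variable R : realType.
Local Notation C := R[i].
Local Notation "x %:C" := (real_complex R x) (format "x %:C") : ring_scope.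
Local Notation "M ^P" := (map_mx polyC M) (at level 30).

(* For [z = w^2] with [w] unimodular, [z B + B^t*] is [2 w Re (w B)], so that the
   unimodular roots are the directions in which [Re (w B)] is singular. *)
Definition pencil n (B : 'M[C]_n) : {poly C} := \det ('X *: B^P + (B^t*)^P).

(** The roots of a pencil are symmetric under z -> 1 / conj z, and this is the factor of one such
    pair. In this form z = 0 is allowed, its partner being the root at infinity. *)
Definition inv_pair (z : C) : {poly C} := ('X - z%:P) * (1 - (z^*)%:P * 'X).

Lemma inv_pair_neq0 z : inv_pair z != 0.
Proof.
apply: mulf_neq0; first by rewrite polyXsubC_eq0.
by apply/eqP => /(congr1 (fun p => p.[0])) /eqP; rewrite !hornerE subr0 oner_eq0.
Qed.

Lemma pencil_horner n (B : 'M[C]_n) z : (pencil B).[z] = \det (z *: B + B^t*).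
Proof.
rewrite /pencil -horner_evalE -det_map_mx; congr (\det _).
by apply/matrixP => i j; rewrite !mxE /= /horner_eval !hornerE.
Qed.

Lemma mul_pencil m p n (B : 'M[C]_n) (X : 'M[C]_(m, n)) (Y : 'M[C]_(n, p)) :
  X^P *m ('X *: B^P + (B^t*)^P) *m Y^P = 'X *: (X *m B *m Y)^P + (X *m B^t* *m Y)^P.
Proof. by rewrite !map_mxM mulmxDr mulmxDl -scalemxAr -scalemxAl. Qed.

(* The block shape of the pencil in the basis [v, v B, U] on the right and
   [v B, v, U] on the left. *)
Lemma det_hyperbolic (F : comNzRingType) m (a b f : 'M[F]_1) (g : 'M[F]_(1, m)) (e :
  'M[F]_(m, 1)) (D : 'M[F]_m) :
  \det (block_mx b (row_mx f g) 0 (block_mx a 0 e D)) = b 0 0 * a 0 0 * \det D.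
Proof. by rewrite (@det_ublock _ 1 m.+1) (@det_lblock _ 1 m) !det_mx11 mulrA. Qed.

Lemma adjmx0 m n : (0 : 'M[C]_(m, n))^t* = 0.
Proof. by apply/matrixP => i j; rewrite !mxE rmorph0. Qed.

Lemma adjmx_inj m n : injective (fun A : 'M[C]_(m, n) => A^t*).
Proof. by move=> A A' /(congr1 (fun M => M^t*)); rewrite /= !trmxCK. Qed.

Section Step.
Variables (m : nat) (B : 'M[C]_m.+2) (v : 'rV[C]_m.+2) (z0 : C).
Hypothesis v0 : v != 0.
Hypothesis z01 : `|z0| != 1.
Hypothesis vz : z0 *: (v *m B) + v *m B^t* = 0.
Hypothesis vB0 : v *m B != 0.

Let vBa : v *m B^t* = - z0 *: (v *m B).
Proof. by apply/eqP; rewrite scaleNr -addr_eq0 addrC vz. Qed.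

Let W := kermx ((v *m B)^t*).

Let inW p (x : 'M_(p, _)) : (x <= W)%MS = (v *m B *m x^t* == 0).
Proof.
rewrite (sameP sub_kermxP eqP) -(inj_eq (@adjmx_inj _ _)) adjmxM trmxCK.
by rewrite adjmx0.
Qed.

(** The adjoint of B sends v to a multiple of [v *m B], so a vector orthogonal to v in one argument
    of the form is so in the other. *)
Let inW' p (x : 'M_(p, _)) : (x <= W)%MS -> v *m B *m x^t* = 0 /\ x *m B *m v^t* = 0.
Proof.
rewrite inW => /eqP h; split=> //; apply: adjmx_inj.
by rewrite !adjmxM trmxCK mulmxA vBa -scalemxAl h scaler0 adjmx0.
Qed.

(** Conjugation sends s = [sform B v v] to - z0 s; comparing norms gives s = 0 because z0 is not
    unimodular. *)
Let vv : v *m B *m v^t* = 0.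
Proof.
rewrite sformE; suff -> : sform B v v = 0 by rewrite raddf0.
have : (sform B v v)^* = - z0 * sform B v v.
  by rewrite sform_adj /sform vBa -scalemxAl mxE.
move=> /(congr1 Num.norm); rewrite norm_conjC normrM normrN => /eqP.
rewrite eq_sym -subr_eq0 -{2}[`|sform _ _ _|]mul1r -mulrBl mulf_eq0 subr_eq0 (negPf z01) /=
  normr_eq0.
by move/eqP.
Qed.

Let vW : (v <= W)%MS. Proof. by rewrite inW vv. Qed.

Let rW : \rank W = m.+1.
Proof. by rewrite mxrank_ker mxrank_map mxrank_tr rank_rV vB0 subSS subn0. Qed.

(** U is a basis of a complement of v in W. It stands for the quotient W / v, so that the
    compression of B to U is a matrix again, of size two less. *)
Lemma hyperbolic_split : exists U : 'M[C]_(m, m.+2),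
  row_free U /\ (v + U :=: W)%MS.
Proof.
have rU : \rank (W :\: v)%MS = m.
  have := mxrank_cap_compl W v.
  by rewrite (capmx_idPr vW) rank_rV v0 rW => -[].
have UE := eq_row_base (W :\: v)%MS; have Uf := row_base_free (W :\: v)%MS.
move: (row_base _) UE Uf; rewrite rU => U UE Uf.
exists U; split=> //.
apply: eqmx_trans (adds_eqmx (eqmx_refl _) UE) _.
rewrite addsmxC; apply: eqmx_trans (addsmx_diff_cap_eq W v).
by apply: adds_eqmx; [exact: eqmx_refl | apply/eqmx_sym/capmx_idPr].
Qed.

Variable U : 'M[C]_(m, m.+2).
Hypothesis Uf : row_free U.
Hypothesis UW : (v + U :=: W)%MS.

Lemma hyperbolic_free : row_free (col_mx v U).
Proof. by rewrite /row_free -addsmxE UW rW. Qed.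

Let U_W : (U <= W)%MS. Proof. by rewrite -UW addsmxSr. Qed.

Lemma hyperbolic_ortho :
  [/\ v *m B *m v^t* = 0, v *m B *m U^t* = 0 & U *m B *m v^t* = 0].
Proof. by have [? ?] := inW' U_W; split. Qed.

Let vBW : ~~ (v *m B <= W)%MS.
Proof.
rewrite inW; apply: contra vB0 => /eqP h.
by rewrite -sform1_eq0 /sform mulmx1 h mxE.
Qed.

Lemma full_rank : \rank (v *m B + W)%MS = m.+2.
Proof.
have := mxrank_sum_cap (v *m B) W; rewrite rank_rV vB0 rW.
suff -> : \rank (v *m B :&: W)%MS = 0%N by rewrite addn0 add1n.
apply/eqP; apply: contraNT vBW; rewrite -lt0n => h.
have : (v *m B :&: W == v *m B)%MS.
  by rewrite -(geq_leqif (mxrank_leqif_eq (capmxSl _ _))) rank_rV vB0.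
by move=> /andP[_ /submx_trans]; apply; exact: capmxSr.
Qed.

(** Multiplying by S1 and by the adjoint of S2, two bases that differ in the order of v and
    [v *m B], makes the pencil block triangular. The two scalar blocks are y (1 - conj z0 X) and y
    (X - z0), where y is the squared norm of [v *m B]. *)
Lemma pencil_step : exists c : C,
  c != 0 /\ c%:P * pencil B = inv_pair z0 * pencil (U *m B *m U^t*).
Proof.
pose S1 : 'M[C]_(1 + (1 + m)) := col_mx (v *m B) (col_mx v U).
pose S2 : 'M[C]_(1 + (1 + m)) := col_mx v (col_mx (v *m B) U).
have d1 : \det S1 != 0.
  rewrite -unitfE -unitmxE -row_free_unit /row_free -addsmxE.
  by rewrite (adds_eqmx (eqmx_refl _) (eqmx_sym (addsmxE _ _))) (adds_eqmx (eqmx_refl _)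
    UW) full_rank.
have d2 : \det S2 != 0.
  rewrite -unitfE -unitmxE -row_free_unit /row_free -addsmxE.
  rewrite (adds_eqmx (eqmx_refl _) (eqmx_sym (addsmxE _ _))) addsmxA (addsmxC v) -addsmxA.
  by rewrite (adds_eqmx (eqmx_refl _) UW) full_rank.
pose y := sform 1%:M (v *m B) (v *m B).
have y0 : y != 0 by rewrite sform1_eq0.
exists (\det S1 * (\det S2)^* / y / y); split.
  by rewrite !mulf_neq0 ?invr_eq0 // conjC_eq0.
have : (\det S1 * (\det S2)^*)%:P * pencil B
    = \det (S1^P *m ('X *: B^P + (B^t*)^P) *m (S2^t*)^P).
  rewrite !det_mulmx -/(pencil B) !det_map_mx det_tr polyCM.
  by rewrite mulrAC.
have -> : S1^P *m ('X *: B^P + (B^t*)^P) *m (S2^t*)^P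
  = block_mx ('X *: (v *m B *m B *m v^t*)^P + (v *m B *m B^t* *m v^t*)^P)
      (row_mx ('X *: (v *m B *m B *m (v *m B)^t*)^P + (v *m B *m B^t* *m (v *m B)^t*)^P)
              ('X *: (v *m B *m B *m U^t*)^P + (v *m B *m B^t* *m U^t*)^P))
      0
      (block_mx ('X *: (v *m B *m (v *m B)^t*)^P + (v *m B^t* *m (v *m B)^t*)^P) 0
         ('X *: (U *m B *m (v *m B)^t*)^P + (U *m B^t* *m (v *m B)^t*)^P)
         ('X *: (U *m B *m U^t*)^P + (U *m B^t* *m U^t*)^P)).
  rewrite /S1 /S2 !(tr_col_mx, map_row_mx, map_col_mx) !mul_col_mx !mul_mx_row !mul_pencil
    !block_mxEv.
  have [vU Uv] := inW' U_W.
  have vBU : v *m B^t* *m U^t* = 0 by rewrite vBa -scalemxAl vU scaler0.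
  have UBv : U *m B^t* *m v^t* = 0.
    by apply: adjmx_inj; rewrite !adjmxM !trmxCK mulmxA vU adjmx0.
  have vBv : v *m B^t* *m v^t* = 0 by rewrite vBa -scalemxAl vv scaler0.
  rewrite vU Uv vBU UBv vv vBv !map_mx0 !scaler0 !addr0.
  by rewrite -[X in col_mx _ X = _]block_mxEv block_mxEh col_mx0.
have yE : v *m B *m (v *m B)^t* = y%:M by rewrite [LHS]mx11_scalar /y /sform mulmx1.
have -> : v *m B *m B *m v^t* = (- z0^* * y)%:M.
  rewrite -[v *m B *m B *m _]mulmxA -[B in B *m v^t*]trmxCK -adjmxM vBa adjmxZ -scalemxAr
    yE rmorphN.
  by rewrite scale_scalar_mx.
have -> : v *m B *m B^t* *m v^t* = y%:M by rewrite -mulmxA -adjmxM.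
rewrite yE.
have -> : v *m B^t* *m (v *m B)^t* = (- z0 * y)%:M by rewrite vBa -scalemxAl yE scale_scalar_mx.
rewrite det_hyperbolic !mxE !mulr1n => h.
have yP : (y%:P : {poly C}) != 0 by rewrite polyC_eq0.
apply: (mulfI yP); apply: (mulfI yP).
rewrite !mulrA -!polyCM.
have -> : y * y * (\det S1 * (\det S2)^* / y / y) = \det S1 * (\det S2)^*.
  by rewrite mulrC !mulrA !divfK.
rewrite h.
have -> : pencil (U *m B *m U^t*) = \det ('X *: (U *m B *m U^t*)^P + (U *m B^t* *m U^t*)^P).
  by rewrite /pencil !adjmxM trmxCK mulmxA.
congr (_ * _); rewrite /inv_pair !polyCM !polyCN.
move: ((z0^*)%:P) (z0%:P) (y%:P) => p q r.
ring.
Qed.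

(* A semidefinite space containing the isotropic vector [v] lies in the
   orthogonal of [v], and one not containing it loses one dimension there. *)
Lemma nonneg_dim_step k : nonneg_dim B k.+1 -> nonneg_dim (U *m B *m U^t*) k.
Proof.
move=> nnB w w1; have [N [rN hN]] := nnB w w1.
have [vU Uv] := inW' U_W.
have NW : (v <= N)%MS -> (N <= W)%MS.
  move=> vN; apply/rV_subP => x xN; rewrite inW sformE.
  suff -> : sform B v x = 0 by rewrite raddf0.
  apply/eqP/negP => /negP y0.
  have d0 : w - w^* * z0 != 0.
    apply: contra z01; rewrite subr_eq0 => /eqP /(congr1 Num.norm).
    rewrite normrM norm_conjC.
    have -> : `|w| = 1 by apply/eqP; rewrite -(@pexpr_eq1 _ _ 2) // normCK w1.
    by rewrite mul1r => <-.
  pose y := sform B v x; pose d := w - w^* * z0.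
  (* As v is isotropic, Re (w B) at x + s v is its value at x plus Re (s y d), and y d is nonzero.
     This s makes the total - 1, against semidefiniteness on N. *)
  pose r := complex.Re (w * sform B x x) + 1.
  pose s := - r%:C / (y * d).
  have : ((x + s *: v)%R <= N)%MS by rewrite addmx_sub // scalemx_sub.
  move=> /hN; rewrite sformDl !sformDr !sformZl !sformZr.
  have -> : sform B v v = 0 by rewrite /sform vv mxE.
  have -> : sform B x v = - (z0 * y)^*.
    have -> : sform B x v = (sform (B^t*) v x)^* by rewrite sform_adj trmxCK.
    by rewrite /sform vBa -scalemxAl mxE mulNr rmorphN.
  have -> : w * (sform B x x + s^* * - (z0 * y)^* + (s * sform B v x + s * (s^* * 0)))
     = w * sform B x x + (s * (y * d) + ((w^* * s * z0 * y) - (w^* * s * z0 * y)^*)).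
    rewrite /d -/y !rmorphM /= conjCK.
    move: (sform B x x) (w^*) (s^*) (z0^*) (y^*) (s) (y) => q w' s' z' y' s0 y1; ring.
  have -> : s * (y * d) = - r%:C by rewrite /s divfK // mulf_neq0.
  have ReD (a b : C) : complex.Re (a + b) = complex.Re a + complex.Re b by case: a b => ? ? [].
  have ReJ (z : C) : complex.Re (- z^*) = - complex.Re z by case: z.
  rewrite !ReD ReJ subrr addr0.
  have -> : complex.Re (- r%:C) = - r by [].
  by rewrite /r opprD addrA subrr sub0r oppr_ge0 ler10.
(* T reads off the U-coordinates of a vector of W and kills v. *)
pose S := pinvmx (col_mx v U) : 'M_(_, 1 + m).
pose T : 'M_(m.+2, m) := rsubmx S.
have hS : col_mx v U *m S = 1%:M by apply: mulmxVp; exact: hyperbolic_free.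
have : col_mx (v *m T) (U *m T) = col_mx 0 1%:M.
  by rewrite -mul_col_mx mulmx_rsub hS scalar_mx_block block_mxEh row_mxKr.
move=> /eq_col_mx[vT UT].
pose A := (N :&: W)%MS.
have xWE (x : 'rV_m.+2) : (x <= W)%MS -> exists c, x = c *: v + (x *m T) *m U.
  rewrite -UW => /sub_addsmxP[[c d] /= ->]; exists (c 0 0).
  rewrite mulmxDl -!mulmxA vT UT mulmx0 mulmx1 add0r.
  by rewrite [c in c *m v]mx11_scalar mul_scalar_mx.
exists <<A *m T>>%MS; split; last first.
  move=> y; rewrite genmxE => /submxP[D ->].
  pose x := D *m A; have xA : (x <= A)%MS by exact: submxMl.
  rewrite mulmxA -/x; have [c xE] := xWE x (submx_trans xA (capmxSr _ _)).
  have := hN x (submx_trans xA (capmxSl _ _)).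
  suff -> : sform B x x = sform (U *m B *m U^t*) (x *m T) (x *m T) by [].
  rewrite [in LHS]xE; move: (x *m T) => y'.
  rewrite sformDl !sformDr !sformZl !sformZr.
  have -> : sform B v v = 0 by rewrite /sform vv mxE.
  have -> : sform B v (y' *m U) = 0 by rewrite /sform adjmxM mulmxA vU mul0mx mxE.
  have -> : sform B (y' *m U) v = 0 by rewrite /sform -[y' *m U *m B]mulmxA -mulmxA Uv
    mulmx0 mxE.
  by rewrite !mulr0 !add0r /sform adjmxM !mulmxA.
rewrite genmxE.
have capv : (A :&: kermx T <= v)%MS.
  apply/rV_subP => x; rewrite sub_capmx => /andP[xA /sub_kermxP xT].
  have [c ->] := xWE x (submx_trans xA (capmxSr _ _)).
  by rewrite xT mul0mx addr0 scalemx_sub.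
have [vN|vN] := boolP (v <= N)%MS.
  have rA : \rank A = \rank N by rewrite /A (capmx_idPl (NW vN)).
  have := mxrankS capv; rewrite rank_rV v0 => rc.
  have rs := mxrank_mul_ker A T.
  rewrite -ltnS; apply: leq_trans rN _; rewrite -rA -rs -[X in (_ <= X)%N]addn1.
  by rewrite leq_add2l.
have cap0 : \rank (A :&: kermx T)%MS = 0%N.
  apply/eqP; apply: contraNT vN; rewrite -lt0n => h.
  have : (A :&: kermx T == v)%MS.
    by rewrite -(geq_leqif (mxrank_leqif_eq capv)) rank_rV v0.
  move=> /andP[_ /submx_trans]; apply.
  by apply: submx_trans (capmxSl _ _) (capmxSl _ _).
have := mxrank_sum_cap N W; rewrite -/A rW => rs.
have rAT := etrans (esym (etrans (congr1 (addn _) cap0) (addn0 _))) (mxrank_mul_ker A T).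
rewrite rAT -(leq_add2l m.+2).
apply: (@leq_trans (\rank (N + W)%MS + \rank A)); last by rewrite leq_add2r rank_leq_col.
by rewrite rs addSnnS addnC leq_add2r.
Qed.

End Step.

Lemma col_mx_isotropic n p q (B : 'M[C]_n) (X : 'M_(p, n)) (Y : 'M_(q, n)) :
  X *m B *m X^t* = 0 -> X *m B *m Y^t* = 0 -> Y *m B *m X^t* = 0 ->
  Y *m B *m Y^t* = 0 -> col_mx X Y *m B *m (col_mx X Y)^t* = 0.
Proof.
move=> XX XY YX YY.
by rewrite tr_col_mx map_row_mx mul_col_mx mul_mx_row !mul_col_mx XX XY YX YY !col_mx0 row_mx0.
Qed.

Lemma isotropic_frame k n (B : 'M[C]_n) (zs : seq C) (r : {poly C}) :
  size zs = k -> all (fun z => `|z| != 1) zs -> r != 0 ->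
  pencil B = \prod_(z <- zs) inv_pair z * r -> nonneg_dim B k.+1 ->
  exists X : 'M[C]_(k.+1, n), row_free X /\ X *m B *m X^t* = 0.
Proof.
elim: k n B zs r => [|k IH] n B zs r.
  move=> _ _ _ _ /isotropic1[x [x0 xB]]; exists x.
  by rewrite /row_free rank_rV x0; split=> //; rewrite sformE xB raddf0.
case: zs => // z0 zs [szs] /andP[z01 zs1] r0; rewrite big_cons => pB nnB.
have : (pencil B).[z0] = 0 by rewrite pB !hornerE subrr !mul0r.
rewrite pencil_horner => /eqP/det0P[v v0 vz].
have n2 : (2 <= n)%N.
  have [|N [rN _]] := nnB 1; first by rewrite rmorph1 mulr1.
  by apply: leq_trans (rank_leq_col N); apply: leq_trans rN.
case: n n2 => [|[|m]] // _ in B pB nnB v v0 vz *.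
rewrite mulmxDr -scalemxAr in vz.
have pB0 : pencil B != 0.
  rewrite pB; apply: mulf_neq0 => //; apply: mulf_neq0; first exact: inv_pair_neq0.
  rewrite prodf_seq_neq0.
  by apply/allP => z _; exact: inv_pair_neq0.
(* Otherwise both B and its adjoint kill v, and the pencil vanishes identically, which r != 0
   excludes. *)
have vB0 : v *m B != 0.
  apply: contraNneq pB0 => vB.
  apply/det0P; exists (map_mx polyC v); first by rewrite map_mx_eq0.
  move: vz; rewrite vB scaler0 add0r => vBa.
  by rewrite mulmxDr -scalemxAr -!map_mxM vB vBa !map_mx0 scaler0 addr0.
have [U [Uf UW]] := hyperbolic_split v0 z01 vz vB0.
have [c [c0 pc]] := pencil_step z01 vz vB0 UW.
have pB' : pencil (U *m B *m U^t*) = \prod_(z <- zs) inv_pair z * (c *: r).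
  apply: (mulfI (inv_pair_neq0 z0)); rewrite -pc pB -mul_polyC; set p := \prod_(_ <- _) _.
  by rewrite mulrCA !mulrA; congr (_ * _); rewrite mulrAC.
have [|X [Xf XB]] := IH _ _ _ _ szs zs1 _ pB' (nonneg_dim_step v0 z01 vz vB0 UW nnB).
  by rewrite scale_poly_eq0 (negPf c0).
exists (col_mx v (X *m U)); split.
  have -> : col_mx v (X *m U) = block_mx 1%:M 0 0 X *m col_mx v U.
    by rewrite mul_block_col !mul0mx mul1mx addr0 add0r.
  rewrite /row_free mxrankMfree ?(hyperbolic_free vB0 UW) //.
  have := @rank_diag_block_mx _ _ _ _ _ (1%:M : 'M[C]_1) X.
  by rewrite mxrank1 (eqP Xf) => ->.
have [vv vU Uv] := hyperbolic_ortho z01 vz UW.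
apply: (@col_mx_isotropic _ 1 k.+1 B v (X *m U)) => //; first by rewrite adjmxM mulmxA vU
  mul0mx.
  by rewrite -[X *m U *m B]mulmxA -mulmxA Uv mulmx0.
by rewrite -XB adjmxM !mulmxA.
Qed.
End Reduction.

(** * Orthonormal frames and eigenvalue counts *)

Section Frames.
Local Open Scope sesquilinear_scope.
Variable R : realType.
Local Notation C := R[i].
Local Notation "x %:C" := (real_complex R x) (format "x %:C") : ring_scope.

Lemma orthonormal_frame k n (X B : 'M[C]_(_, n)) :
  row_free (X : 'M_(k, n)) -> X *m B *m X^t* = 0 ->
  exists Y : 'M[C]_(k, n), Y *m Y^t* = 1%:M /\ Y *m B *m Y^t* = 0.
Proof.
move=> Xf XB.
have kn : (k <= n)%N by rewrite -(eqP Xf) rank_leq_col.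
have /submxP[D DX] : (schmidt X <= X)%MS by rewrite (eqmx_schmidt_free Xf).
exists (schmidt X); split; first exact/unitarymxP/schmidt_unitarymx.
rewrite DX adjmxM mulmxA -[D *m X *m B]mulmxA -[D *m (X *m B) *m _]mulmxA XB.
by rewrite mulmx0 mul0mx.
Qed.

(** Orthonormal frames replace projections: they can be compressed, truncated and passed to the
    limit. *)
Lemma rank_numerical_rangeP n k (A : 'M[C]_n) l :
  rank_numerical_range k A l <->
  exists X : 'M[C]_(k, n), X *m X^t* = 1%:M /\ X *m A *m X^t* = l%:M.
Proof.
split=> [[P [Ph PP rP PAP]]|[X [XX XA]]].
  have PE := eq_row_base P; have Pf := row_base_free P.
  move: (row_base P) PE Pf; rewrite rP => X0 XE Xf.
  have kn : (k <= n)%N by rewrite -rP rank_leq_row.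
  exists (schmidt X0); have /unitarymxP XX := schmidt_unitarymx X0 kn; split=> //.
  have /submxP[D DX] : (schmidt X0 <= P)%MS by rewrite (eqmx_schmidt_free Xf) XE.
  have XP : schmidt X0 *m P = schmidt X0 by rewrite DX -mulmxA PP.
  rewrite -{2}XP adjmxM Ph -{1}XP !mulmxA.
  rewrite -[_ *m P *m A]mulmxA -[_ *m (P *m A) *m P]mulmxA PAP -scalemxAr -scalemxAl XP XX.
  by rewrite scale_scalar_mx mulr1.
exists (X^t* *m X); split.
- by rewrite adjmxM trmxCK.
- by rewrite mulmxA -[_ *m X *m _]mulmxA XX mulmx1.
- apply/eqP; rewrite eqn_leq (leq_trans (mxrankM_maxr _ _)) ?rank_leq_row //=.
  have := mxrankM_maxr X (X^t* *m X); rewrite mulmxA XX mul1mx => /(leq_trans _) -> //.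
  by have := mxrankM_maxl X (X^t*); rewrite XX mxrank1.
- rewrite !mulmxA -[_ *m A]mulmxA -[_ *m (X *m A) *m _]mulmxA XA mul_mx_scalar.
  by rewrite -scalemxAl.
Qed.

Lemma isotropic_shift n k (A X : 'M[C]_(_, n)) l : X *m X^t* = 1%:M ->
  X *m (A - l%:M) *m X^t* = 0 -> (X : 'M_(k, n)) *m A *m X^t* = l%:M.
Proof.
move=> XX; rewrite mulmxBr mulmxBl mul_mx_scalar -scalemxAl XX scale_scalar_mx mulr1.
by move=> /eqP; rewrite subr_eq0 => /eqP.
Qed.

Lemma prod_XsubC_perm (F : fieldType) (s t : seq F) :
  \prod_(x <- s) ('X - x%:P) = \prod_(x <- t) ('X - x%:P) -> perm_eq s t.
Proof.
elim: s t => [|x s IH] t h.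
  have := size_prod_XsubC t id; rewrite -h big_nil size_poly1 => -[].
  by case: t {h}.
have xt : x \in t by rewrite -root_prod_XsubC -h big_cons rootM root_XsubC eqxx.
rewrite perm_sym (perm_trans (perm_to_rem xt)) // perm_cons perm_sym IH //.
have x0 : 'X - x%:P != 0 by rewrite polyXsubC_eq0.
apply: (mulfI x0).
by have := h; rewrite big_cons (perm_big _ (perm_to_rem xt)) big_cons.
Qed.

Lemma char_poly_unitary n (P D : 'M[C]_n) : P \is unitarymx ->
  char_poly (P^t* *m D *m P) = char_poly D.
Proof.
move=> Pu; rewrite /char_poly.
have /unitarymxP PP := Pu; have PP' := mulmx1C PP.
have PPp : map_mx polyC (P^t*) *m map_mx polyC P = 1%:M by rewrite -map_mxM PP' map_mx1.
have -> : char_poly_mx (P^t* *m D *m P)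
    = map_mx polyC (P^t*) *m char_poly_mx D *m map_mx polyC P.
  by rewrite /char_poly_mx mulmxBr mulmxBl !map_mxM mul_mx_scalar -scalemxAl PPp scalemx1.
by rewrite !det_mulmx mulrAC -det_mulmx PPp det1 mul1r.
Qed.

Lemma unitary_rows n (P : 'M[C]_n) (J : {set 'I_n}) : P \is unitarymx ->
  exists N : 'M[C]_n, \rank N = #|J| /\
    forall x : 'rV_n, (x <= N)%MS -> forall j, j \notin J -> (x *m P^t*) 0 j = 0.
Proof.
move=> /unitarymxP PP.
pose N0 := rowsub (fun i : 'I_#|J| => enum_val i) P.
have NP : N0 *m P^t* = rowsub (fun i : 'I_#|J| => enum_val i) 1%:M.
  by rewrite -PP mul_rowsub_mx.
exists <<N0>>%MS; split.
  rewrite genmxE; apply: mxrank_unitary; apply/unitarymxP.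
  apply/matrixP => i j; have /matrixP/(_ (enum_val i) (enum_val j)) := PP.
  rewrite !mxE (inj_eq enum_val_inj) => <-.
  by apply: eq_bigr => k _; rewrite !mxE.
move=> x; rewrite genmxE => /submxP[z ->] j jJ.
rewrite -mulmxA NP mxE big1 // => i _; rewrite !mxE.
case: eqP => [e|_]; last by rewrite mulr0.
by move: jJ; rewrite -e enum_valP.
Qed.

(** The Courant-Fischer principle in counting form. *)
Lemma spectral_count n (H : 'M[C]_n) (ss : seq R) (m : R) (k : nat) :
  H^t* = H -> char_poly H = \prod_(s <- ss) ('X - (s%:C)%:P) ->
  (exists N : 'M[C]_n, (k <= \rank N)%N /\ forall x : 'rV_n, (x <= N)%MS ->
     m * complex.Re (sform 1%:M x x) <= complex.Re (sform H x x))
  <-> (k <= count (>= m) ss)%N.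
Proof.
move=> HH cH.
have Hn : H \is normalmx by apply/normalmxP; rewrite HH.
pose P := spectralmx H; pose d := spectral_diag H.
have Pu : P \is unitarymx := spectral_unitarymx H.
have HE : H = P^t* *m diag_mx d *m P.
  by have /orthomx_spectralP := Hn; rewrite invmx_unitary.
clearbody P d.
have /unitarymxP PP := Pu; have PP' := mulmx1C PP.
have pd : perm_eq [seq d 0 j | j : 'I_n] [seq s%:C | s <- ss].
  apply: prod_XsubC_perm; rewrite [RHS]big_map -cH HE char_poly_unitary // char_poly_trig
    ?diag_mx_is_trig //.
  by rewrite big_image /=; apply: eq_bigr => j _; rewrite mxE eqxx mulr1n.
pose r j := complex.Re (d 0 j).
have dr j : d 0 j = (r j)%:C.
  have : d 0 j \in [seq s%:C | s <- ss] by rewrite -(perm_mem pd) map_f // mem_enum.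
  by rewrite /r => /mapP[s _ ->].
have pr : perm_eq [seq r j | j : 'I_n] ss.
  have e : [seq complex.Re z | z <- [seq s%:C | s <- ss]] = ss.
    by rewrite -map_comp [LHS](_ : _ = map id ss) ?map_id //; apply: eq_map.
  by have := perm_map (@complex.Re R) pd; rewrite e -map_comp.
pose J := [set j | m <= r j]%SET.
have -> : count (>= m) ss = #|J|.
  have /permP/(_ (>= m)) <- := pr.
  by rewrite -sum1_count big_image_cond /= -sum1_card; apply: eq_bigl => j; rewrite inE.
pose q (x : 'rV[C]_n) j := Normc.normc ((x *m P^t*) 0 j) ^+ 2.
have q0 x j : 0 <= q x j by rewrite exprn_ge0 // normc_ge0.
have form x : complex.Re (sform H x x) - m * complex.Re (sform 1%:M x x) = \sum_j (r j - m)
  * q x j.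
  have Px : P *m x^t* = (x *m P^t*)^t* by rewrite adjmxM trmxCK.
  have e1 : sform H x x = (\sum_j r j * q x j)%:C.
    rewrite /sform HE !mulmxA -mulmxA Px mxE rmorph_sum /=.
    apply: eq_bigr => j _; rewrite mul_mx_diag !mxE dr rmorphM /= -mulcJE mxE; ring.
  have e2 : sform 1%:M x x = (\sum_j q x j)%:C.
    rewrite /sform -PP' !mulmxA -mulmxA Px mxE rmorph_sum /=.
    by apply: eq_bigr => j _; rewrite !mxE -mulcJE mxE.
  rewrite e1 e2 /= mulr_sumr -sumrB; apply: eq_bigr => j _; ring.
split.
  move=> [N [kN hN]].
  have [M [rM hM]] := unitary_rows (~: J) Pu.
  (* On the span M of the eigenvectors with eigenvalue below m the form H - m is negative definite,
     so N meets M in 0 and the rank of N is at most the number of the other eigenvalues. *)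
  have NM : (N :&: M)%MS = 0.
    apply/eqP; rewrite -submx0; apply/rV_subP => x; rewrite sub_capmx => /andP[xN xM].
    have := hN x xN; rewrite -subr_ge0 form => h.
    have t0 j : (r j - m) * q x j <= 0.
      have [jJ|jJ] := boolP (j \in J).
        by rewrite /q hM ?finset.in_setC ?negbK // Normc.normc0 expr0n mulr0.
      by rewrite nmulr_rle0 // subr_lt0; move: jJ; rewrite inE ltNge.
    have s0 : \sum_j - ((r j - m) * q x j) = 0.
      apply/eqP; rewrite eq_le; apply/andP; split; first by rewrite sumrN oppr_le0.
      by apply: sumr_ge0 => j _; rewrite oppr_ge0.
    have xP : x *m P^t* = 0.
      apply/rowP => j; rewrite [RHS]mxE.
      have [jJ|jJ] := boolP (j \in J); first by apply: hM => //; rewrite finset.in_setC negbK.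
      have t0' i : true -> 0 <= - ((r i - m) * q x i) by rewrite oppr_ge0.
      have /eqP : - ((r j - m) * q x j) = 0 by exact: (psumr_eq0P t0' s0).
      rewrite oppr_eq0 mulf_eq0 subr_eq0 expf_eq0 /=.
      case/orP => [/eqP e|/eqP/Normc.eq0_normc //].
      by move: jJ; rewrite inE e lexx.
    by rewrite -[x]mulmx1 -PP' mulmxA xP mul0mx submx0.
  have := mxrank_sum_cap N M; rewrite NM mxrank0 addn0 rM.
  have := rank_leq_col (N + M)%MS; move: (\rank (N + M)%MS) => u hu uE.
  apply: leq_trans kN _; rewrite -(leq_add2r #|~: J|) -uE.
  by rewrite cardsC card_ord.
move=> kJ; have [N [rN hN]] := unitary_rows J Pu.
exists N; split; first by rewrite rN.
move=> x xN; rewrite -subr_ge0 form; apply: sumr_ge0 => j _.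
have [jJ|jJ] := boolP (j \in J); last by rewrite /q hN // Normc.normc0 expr0n mulr0.
by rewrite mulr_ge0 // subr_ge0; move: jJ; rewrite inE.
Qed.

End Frames.

(** * Continuants and their factorizations *)

Section Continuant.
Variable K : comNzRingType.

(** Indexing the entries by natural numbers turns a trailing minor into [natmx] of a shifted
    function, so the recurrence iterates without conversions between ordinals. *)
Definition natmx n (a : nat -> nat -> K) : 'M[K]_n := \matrix_(i, j) a i j.

Lemma det_continuant n (a : nat -> nat -> K) :
  (forall j, a 0%N j.+2 = 0) -> (forall i, a i.+2 0%N = 0) ->
  \det (natmx n.+2 a) = a 0 0 * \det (natmx n.+1 (fun i j => a i.+1 j.+1))
    - a 0 1%N * a 1%N 0 * \det (natmx n (fun i j => a i.+2 j.+2)).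
Proof.
move=> h0j hi0; rewrite (expand_det_row _ ord0) !big_ord_recl big1 ?addr0; last first.
  by move=> j _; rewrite mxE /= h0j mul0r.
congr (_ + _).
  rewrite mxE /cofactor addn0 expr0 mul1r; congr (_ * \det _).
  by apply/matrixP => i j; rewrite !mxE.
rewrite mxE /cofactor /= add0n expr1 mulN1r mulrN -mulrA; congr (- (_ * _)).
rewrite (expand_det_col _ ord0) big_ord_recl big1 ?addr0; last first.
  by move=> i _; rewrite !mxE /= hi0 mul0r.
rewrite !mxE /cofactor addn0 expr0 mul1r; congr (_ * \det _).
by apply/matrixP => i j; rewrite !mxE.
Qed.

Lemma det_natmx1 (a : nat -> nat -> K) : \det (natmx 1 a) = a 0 0.
Proof. by rewrite det_mx11 mxE. Qed.

Lemma det_natmx0 (a : nat -> nat -> K) : \det (natmx 0 a) = 1.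
Proof. exact: det_mx00. Qed.

(** The weighted matching polynomial of the path on six vertices: each monomial lists edges no two
    of which share a vertex. *)
Definition path_continuant (L x1 x2 x3 x4 x5 : K) : K :=
  L ^+ 6 - (x1 + x2 + x3 + x4 + x5) * L ^+ 4
    + (x1 * x3 + x1 * x4 + x1 * x5 + x2 * x4 + x2 * x5 + x3 * x5) * L ^+ 2
    - x1 * x3 * x5.

Lemma det_tridiagonal6 (T : 'M[K]_6) (L x1 x2 x3 x4 x5 : K) :
  (forall i j : 'I_6, i.+1 != j -> j.+1 != i -> i != j -> T i j = 0) ->
  (forall i, T i i = L) ->
  T (inord 0) (inord 1) * T (inord 1) (inord 0) = x1 ->
  T (inord 1) (inord 2) * T (inord 2) (inord 1) = x2 ->
  T (inord 2) (inord 3) * T (inord 3) (inord 2) = x3 ->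
  T (inord 3) (inord 4) * T (inord 4) (inord 3) = x4 ->
  T (inord 4) (inord 5) * T (inord 5) (inord 4) = x5 ->
  \det T = path_continuant L x1 x2 x3 x4 x5.
Proof.
move=> T0 Td h1 h2 h3 h4 h5.
pose a i j := if [|| i.+1 == j, j.+1 == i | i == j] then T (inord i) (inord j) else 0.
have -> : T = natmx 6 a.
  apply/matrixP => i j; rewrite mxE /a !inord_val.
  by case: ifPn => // /norP[ij /norP[ji ij']]; apply: T0.
rewrite !det_continuant ?det_natmx1 ?det_natmx0; try by [].
rewrite /a /= !Td h1 h2 h3 h4 h5 /path_continuant.
ring.
Qed.

(* With [S = cos^2 theta] and [T = 1] this is the characteristic polynomial of
   [Re (e^(i theta) A)] at [L]; with [S = (z + 1)^2], [T = 4 z] and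
   [L = mu z + mu^*] it is the pencil of [A - mu]. *)
Definition kippenhahn_poly (f g h c0 c L S T : K) : K :=
  (L ^+ 2 - h ^+ 2 * S - c0 * T)
  * ((L ^+ 2 + f * g * S - c * T) ^+ 2 - (f + g) ^+ 2 * S * L ^+ 2).

Variables (a b g : K).
Hypothesis a3 : a ^+ 3 = a ^+ 2 + 2 * a - 1.
Hypothesis bE : b = a ^+ 2 - a - 1.
Hypothesis gE : g = a ^+ 2 - 2.

(** In the application a, b, - g are 2 cos (j pi / 7) for j = 1, 3, 5, the roots of the cubic. For S
    = 1 and T = 0 the left side is the characteristic polynomial of the path, whose roots 2 cos (j
    pi / 7), j = 1, ..., 6, are a, b, g and their negatives; this is the origin of the foci. The
    equality holds modulo the cubic. *)
Lemma factor_case1 (L S T x : K) :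
  path_continuant L (S + x * T) (S + g * x * T) S (S + g * x * T) (S + x * T)
  = kippenhahn_poly a (- g) b 0 ((1 + g) * x) L S T.
Proof. by rewrite /kippenhahn_poly /path_continuant bE gE; ring: a3. Qed.

Lemma factor_case2_small (L S T x : K) :
  path_continuant L (S + x * T) S (S + b * x * T) (S + (b - 1) ^+ 2 * x * T) (S + b * x * T)
  = kippenhahn_poly a (- g) b (b ^+ 2 * x) x L S T.
Proof. by rewrite /kippenhahn_poly /path_continuant bE gE; ring: a3. Qed.

Lemma factor_case2_large (L S T x : K) :
  path_continuant L (S + x * T) S (S + a * x * T) (S + (a - 1) ^+ 2 * x * T) (S + a * x * T)
  = kippenhahn_poly g (- b) a (a ^+ 2 * x) x L S T.
Proof. by rewrite /kippenhahn_poly /path_continuant bE gE; ring: a3. Qed.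

Lemma path_continuant_rev (L x1 x2 x3 x4 x5 : K) :
  path_continuant L x1 x2 x3 x4 x5 = path_continuant L x5 x4 x3 x2 x1.
Proof. by rewrite /path_continuant; ring. Qed.

End Continuant.

(** * Reciprocal matrices *)

Section Reciprocal.
Local Open Scope sesquilinear_scope.
Variable R : realType.
Local Notation C := R[i].
Local Notation "x %:C" := (real_complex R x) (format "x %:C") : ring_scope.
Local Notation cst x := ((x%:C)%:P : {poly C}).

(** c0 and c are the squared semiminor axes of E0 and E. The variables range over polynomials since
    the pencil and the characteristic polynomial both arise from this identity by substitution. *)
Definition kippenhahn_factor (x : nat -> R) (f g h c0 c : R) : Prop :=
  forall L S T : {poly C},
    path_continuant L (S + cst (x 1%N) * T) (S + cst (x 2) * T) (S + cst (x 3) * T)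
      (S + cst (x 4) * T) (S + cst (x 5) * T)
    = kippenhahn_poly (cst f) (cst g) (cst h) (cst c0) (cst c) L S T.

Variables (A : 'M[C]_6) (f g h c0 c : R).
Hypothesis recA : reciprocal A.
Hypothesis kA : kippenhahn_factor (xi A) f g h c0 c.

Lemma reciprocal_diag i : A i i = 0.
Proof. by apply: recA.1; rewrite eqn_leq ltnn. Qed.

Lemma reciprocal_far (i j : 'I_6) : i.+1 != j -> j.+1 != i -> A i j = 0.
Proof. exact: recA.1. Qed.

Lemma reciprocal_mul (i : nat) : (i < 5)%N ->
  A (inord i) (inord i.+1) * A (inord i.+1) (inord i) = 1.
Proof. by move=> i5; apply: recA.2; rewrite !inordK ?(ltn_trans i5). Qed.

Lemma reciprocal_xi (i : nat) : (i < 5)%N ->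
  A (inord i) (inord i.+1) * (A (inord i) (inord i.+1))^*
   + A (inord i.+1) (inord i) * (A (inord i.+1) (inord i))^* = (4 * xi A i.+1 + 2)%:C.
Proof.
move=> i5; have := congr1 (@Normc.normc R) (reciprocal_mul i5).
rewrite Normc.normcM Normc.normc1 /xi /= !mulcJE -rmorphD /=.
move: (Normc.normc (A (inord i) _)) (Normc.normc (A (inord i.+1) _)) => p q pq; congr (_%:C).
have -> : 4 * ((p - q) ^+ 2 / 4) + 2 = p ^+ 2 + q ^+ 2 - 2 * (p * q) + 2 by field.
by rewrite pq; ring.
Qed.

(** The coefficients of the product are ab = 1, |a|^2 + |b|^2 and conj (ab) = 1; the middle one
    being 4 x + 2, the square of X + 1 splits off and 4 x X remains. *)
Lemma pencil_offdiag (a b : C) (x : R) : a * b = 1 -> a * a^* + b * b^* = (4 * x + 2)%:C ->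
  ('X * a%:P + (b^*)%:P) * ('X * b%:P + (a^*)%:P) = ('X + 1) ^+ 2 + cst x * (4 * 'X) :>
    {poly C}.
Proof.
move=> ab e.
have ab' : (a^*)%:P * (b^*)%:P = 1 :> {poly C} by rewrite -polyCM -rmorphM ab rmorph1.
have abP : a%:P * b%:P = 1 :> {poly C} by rewrite -polyCM ab.
have eP : a%:P * (a^*)%:P + b%:P * (b^*)%:P = 4 * cst x + 2.
  by rewrite -!polyCM -polyCD e rmorphD rmorphM /= polyCD polyCM !rmorph_nat.
have -> : ('X * a%:P + (b^*)%:P) * ('X * b%:P + (a^*)%:P)
  = 'X ^+ 2 * (a%:P * b%:P) + 'X * (a%:P * (a^*)%:P + b%:P * (b^*)%:P) + (a^*)%:P *
    (b^*)%:P :> {poly C} by ring.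
by rewrite ab' abP eP; ring.
Qed.

Lemma pencil_reciprocal (mu : C) :
  pencil (A - mu%:M) = kippenhahn_poly (cst f) (cst g) (cst h) (cst c0) (cst c)
    (mu%:P * 'X + (mu^*)%:P) (('X + 1) ^+ 2) (4 * 'X).
Proof.
rewrite /pencil -kA.
have off (i j : 'I_6) : i != j ->
    ('X *: (map_mx polyC (A - mu%:M)) + map_mx polyC ((A - mu%:M)^t*)) i j = 'X * (A i
      j)%:P + ((A j i)^*)%:P.
  move=> ij; rewrite !mxE !(negPf ij) !mulr0n ?subr0.
  by rewrite eq_sym (negPf ij) mulr0n subr0.
(* The diagonal of the pencil is the negative of the L in the statement. *)
have evenL (L x1 x2 x3 x4 x5 : {poly C}) : path_continuant L x1 x2 x3 x4 x5 =
  path_continuant (- L) x1 x2 x3 x4 x5.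
  by rewrite /path_continuant; ring.
have ne (i : nat) : (i < 5)%N -> (inord i : 'I_6) != inord i.+1.
  by move=> i5; rewrite -val_eqE /= !inordK ?(ltn_trans i5) // neq_ltn leqnn.
rewrite evenL; apply: det_tridiagonal6.
- move=> i j ij ji ij'; rewrite off // !reciprocal_far //.
  by rewrite conjC0 !polyC0 mulr0 addr0.
- move=> i; rewrite !mxE reciprocal_diag eqxx !mulr1n !sub0r !rmorphN /=; ring.
all: rewrite !off ?ne // 1?eq_sym ?ne //; apply: pencil_offdiag; [exact:
  reciprocal_mul|exact: reciprocal_xi].
Qed.

Lemma rotated_offdiag (a b w : C) (x : R) : w * w^* = 1 ->
  a * b = 1 -> a * a^* + b * b^* = (4 * x + 2)%:C ->
  (2^-1 * (w * a + w^* * b^*)) * (2^-1 * (w * b + w^* * a^*)) = ((complex.Re w) ^+ 2 + x)%:C.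
Proof.
move=> w1 ab e.
have ab' : a^* * b^* = 1 by rewrite -rmorphM ab rmorph1.
have -> : (2^-1 * (w * a + w^* * b^*)) * (2^-1 * (w * b + w^* * a^*))
  = 4^-1 * (w ^+ 2 * (a * b) + w * w^* * (a * a^* + b * b^*) + w^* ^+ 2 * (a^* * b^*)) by field.
rewrite ab ab' e w1 mul1r !mulr1.
have -> : w ^+ 2 + (4 * x + 2)%:C + w^* ^+ 2 = (w + w^*) ^+ 2 - 2 * (w * w^*) + (4 * x +
  2)%:C by ring.
rewrite w1; have -> : w + w^* = (2 * complex.Re w)%:C.
  by case: (w) => p q; apply/eqP; rewrite eq_complex /= subrr eqxx andbT; apply/eqP; ring.
have -> : 4^-1 * ((2 * complex.Re w)%:C ^+ 2 - 2 * 1 + (4 * x + 2)%:C) = (4^-1)%:C * ((2 *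
  complex.Re w)%:C ^+ 2 - (2 : R)%:C + (4 * x + 2)%:C).
  by rewrite fmorphV /= !rmorph_nat mulr1.
rewrite -rmorphXn -rmorphB -rmorphD -rmorphM /=; congr (_%:C); by field.
Qed.

Definition re_mx n (M : 'M[C]_n) (w : C) : 'M[C]_n := 2^-1 *: (w *: M + w^* *: M^t*).

Lemma char_poly_re_mx (w : C) : w * w^* = 1 ->
  char_poly (re_mx A w) = kippenhahn_poly (cst f) (cst g) (cst h) (cst c0) (cst c)
    'X (cst (complex.Re w ^+ 2)) 1.
Proof.
move=> w1; rewrite /char_poly -kA.
have offE (i j : 'I_6) : i != j ->
    char_poly_mx (re_mx A w) i j = - (2^-1 * (w * A i j + w^* * (A j i)^*))%:P.
  by move=> ij; rewrite !mxE (negPf ij) mulr0n sub0r.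
have ne (i : nat) : (i < 5)%N -> (inord i : 'I_6) != inord i.+1.
  by move=> i5; rewrite -val_eqE /= !inordK ?(ltn_trans i5) // neq_ltn leqnn.
have prod (i : nat) : (i < 5)%N ->
   char_poly_mx (re_mx A w) (inord i) (inord i.+1) * char_poly_mx (re_mx A w) (inord i.+1)
     (inord i)
   = cst (complex.Re w ^+ 2) + cst (xi A i.+1) * 1.
  move=> i5; rewrite !offE ?ne // 1?eq_sym ?ne //.
  rewrite mulrNN -polyCM (rotated_offdiag w1 (reciprocal_mul i5) (reciprocal_xi i5)).
  by rewrite rmorphD /= polyCD mulr1.
apply: det_tridiagonal6; rewrite ?prod //.
- move=> i j ij ji ij'; rewrite offE // !reciprocal_far //.
  by rewrite conjC0 !mulr0 addr0 mulr0 polyC0 oppr0.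
- by move=> i; rewrite !mxE reciprocal_diag eqxx mulr1n conjC0 !mulr0 addr0 mulr0 polyC0 subr0.
Qed.

End Reciprocal.

(** * Quadratic factors of the pencil *)

Section Suff.
Local Open Scope sesquilinear_scope.
Variable R : realType.
Local Notation C := R[i].
Local Notation "x %:C" := (real_complex R x) (format "x %:C") : ring_scope.
Local Notation cst x := ((x%:C)%:P : {poly C}).

(** The self-inversive quadratics without unimodular root. The unimodular point is written as a
    square because z = w ^+ 2 belongs to the direction w. *)
Definition regular_quad (q : {poly C}) : Prop :=
  (exists (a : C) (rho : R), q = a%:P * 'X ^+ 2 + cst rho * 'X + (a^*)%:P) /\
  forall w : C, w * w^* = 1 -> q.[w ^+ 2] != 0.

Lemma unit_sqrt (z : C) : `|z| = 1 -> exists w : C, w * w^* = 1 /\ w ^+ 2 = z.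
Proof.
move=> z1; exists (sqrtC z); rewrite sqrtCK; split=> //.
by rewrite -normCK -normrX sqrtCK z1.
Qed.

(** With z also 1 / conj z is a root, and the two differ because z is not unimodular, so they
    exhaust the quadratic. For a = 0 the polynomial is rho X, the pair of 0 and infinity. *)
Lemma regular_quad_split q : regular_quad q ->
  exists (k z : C), k != 0 /\ `|z| != 1 /\ q = k%:P * inv_pair z.
Proof.
move=> [[a [rho qE]] qu].
have q1 : q.[1] != 0 by have := qu 1; rewrite expr1n rmorph1 mulr1; apply.
have [a0|a0] := eqVneq a 0.
  exists rho%:C, 0; split.
    by move: q1; rewrite qE a0 conjC0 !hornerE.
  split; first by rewrite normr0 eq_sym oner_eq0.
  by rewrite qE a0 /inv_pair conjC0 !polyC0 !(mul0r, subr0, mulr1, addr0, add0r).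
have [z /rootP z0] : exists z, root q z.
  apply/closed_rootP; apply/eqP => /eqP/size_poly1P[b b0 qb].
  have : q`_2 = 0 by rewrite qb coefC.
  rewrite qE !coefD !coefCM coefXn coefX coefC /= mulr1 mulr0 !addr0 => /eqP.
  by rewrite (negPf a0).
have ev x : q.[x] = a * x ^+ 2 + rho%:C * x + a^* by rewrite qE !hornerE.
have zn0 : z != 0.
  by apply: contra_eq_neq z0 => ->; rewrite ev expr0n !mulr0 !add0r conjC_eq0.
have z1 : `|z| != 1.
  by apply: contra_eqN z0 => /eqP /unit_sqrt[w [w1 <-]]; exact: qu.
have zJ0 : z^* != 0 by rewrite conjC_eq0.
pose y := (z^*)^-1.
have zy : z != y.
  apply: contra z1 => /eqP zy; rewrite -(@pexpr_eq1 _ _ 2) // normCK {1}zy mulVf //.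
have yz : y * z^* = 1 by rewrite mulVf.
have y0 : a * y ^+ 2 + rho%:C * y + a^* = 0.
  have h : a^* * z^* ^+ 2 + rho%:C * z^* + a = 0.
    rewrite -[RHS]conjC0 -z0 ev !rmorphD /= conjCK; congr (_ + _ + _).
      by rewrite rmorphM rmorphXn.
    by rewrite rmorphM /= conj_real.
  have : y ^+ 2 * (a^* * z^* ^+ 2 + rho%:C * z^* + a)
    = a * y ^+ 2 + rho%:C * y * (y * z^*) + a^* * (y * z^*) ^+ 2 by ring.
  by rewrite h mulr0 yz expr1n !mulr1 => <-.
have rE : rho%:C = - a * (z + y).
  have zy0 : z - y != 0 by rewrite subr_eq0.
  apply: (mulIf zy0); move: z0; rewrite ev => z0.
  have : (a * z ^+ 2 + rho%:C * z + a^*) - (a * y ^+ 2 + rho%:C * y + a^*) = 0 by rewrite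
    z0 y0 subrr.
  move=> h; apply/eqP; rewrite -subr_eq0 -h; apply/eqP; ring.
have aE : a^* = a * z * y.
  move: z0; rewrite ev rE => z0; apply/eqP; rewrite -subr_eq0 -z0; apply/eqP; ring.
exists (- (a * y)), z; split; first by rewrite oppr_eq0 mulf_neq0 // invr_eq0.
split=> //; rewrite qE rE aE /inv_pair.
have yzP : y%:P * (z^*)%:P = 1 :> {poly C} by rewrite -polyCM yz.
have -> : (- (a * y))%:P * (('X - z%:P) * (1 - (z^*)%:P * 'X)) = - a%:P * ('X - z%:P) *
  (y%:P - (y%:P * (z^*)%:P) * 'X) :> {poly C}.
  by rewrite polyCN polyCM; ring.
rewrite yzP !polyCM polyCN polyCD; ring.
Qed.

Lemma isotropic_quads n (B : 'M[C]_n) (qs : seq {poly C}) (r : {poly C}) :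
  (forall q, q \in qs -> regular_quad q) -> r != 0 ->
  pencil B = \prod_(q <- qs) q * r -> nonneg_dim B (size qs).+1 ->
  exists X : 'M[C]_((size qs).+1, n), row_free X /\ X *m B *m X^t* = 0.
Proof.
move=> hq r0 pB nnB.
have [zs [k [szs [hz [k0 pE]]]]] : exists (zs : seq C) (k : C), size zs = size qs /\
    all (fun z => `|z| != 1) zs /\ k != 0 /\
    \prod_(q <- qs) q = k%:P * \prod_(z <- zs) inv_pair z.
  elim: qs hq {pB nnB} => [|q qs IH] hq.
    by exists [::], 1; rewrite !big_nil mulr1 oner_eq0.
  have [|zs [k [szs [hz [k0 pE]]]]] := IH; first by move=> q' q'qs; apply: hq; rewrite inE
    q'qs orbT.
  have [|k' [z [k'0 [z1 qE]]]] := @regular_quad_split q; first by apply: hq; rewrite inE eqxx.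
  exists (z :: zs), (k' * k); rewrite /= szs z1 hz mulf_neq0 // !big_cons pE {1}qE polyCM.
  by do !split; rewrite mulrACA.
apply: (@isotropic_frame _ _ _ B zs (k *: r)) => //.
  by rewrite scale_poly_eq0 negb_or k0.
by rewrite pB pE -mul_polyC mulrCA mulrA.
Qed.

End Suff.

(** * Spectra of the rotated real parts, and conics as factors of the pencil *)

Section Spectrum.
Local Open Scope sesquilinear_scope.
Variable R : realType.
Local Notation C := R[i].
Local Notation "x %:C" := (real_complex R x) (format "x %:C") : ring_scope.
Local Notation cst x := ((x%:C)%:P : {poly C}).

(** Half the distance between two parallel tangents of an ellipse with real foci: d is the squared
    semiminor axis, e up to sign half the distance of the foci, and x the cosine of the angle. *)
Definition half_width (d e x : R) : R := Num.sqrt (d + e ^+ 2 * x ^+ 2).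

Lemma half_width_sqr d e x : 0 <= d -> half_width d e x ^+ 2 = d + e ^+ 2 * x ^+ 2.
Proof. by move=> d0; rewrite sqr_sqrtr // addr_ge0 // mulr_ge0 ?sqr_ge0. Qed.

Lemma half_width_ge0 d e x : 0 <= half_width d e x.
Proof. exact: sqrtr_ge0. Qed.

Definition kippenhahn_roots (f g h c0 c x : R) : seq R :=
  let r0 := half_width c0 h x in
  let r := half_width c ((f - g) / 2) x in
  let p := (f + g) / 2 * x in
  [:: r0; - r0; p + r; p - r; - p + r; - p - r].

Lemma kippenhahn_roots_poly (f g h c0 c x : R) : 0 <= c0 -> 0 <= c ->
  kippenhahn_poly (cst f) (cst g) (cst h) (cst c0) (cst c) 'X (cst (x ^+ 2)) 1
  = \prod_(s <- kippenhahn_roots f g h c0 c x) ('X - (s%:C)%:P).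
Proof.
move=> c00 c_0; rewrite /kippenhahn_roots !big_cons big_nil.
have e0 := half_width_sqr h x c00; have e1 := half_width_sqr ((f - g) / 2) x c_0.
move: (half_width c0 h x) (half_width c _ x) e0 e1 => r0 r e0 e1.
pose p := (f + g) / 2 * x; rewrite -/p.
pose e (y : R) : {poly C} := (y%:C)%:P.
have eD y z : e (y + z) = e y + e z by rewrite /e rmorphD polyCD.
have eN y : e (- y) = - e y by rewrite /e rmorphN polyCN.
have eM y z : e (y * z) = e y * e z by rewrite /e rmorphM polyCM.
rewrite /kippenhahn_poly -!/(e _) !mulr1.
have -> : 'X ^+ 2 - e h ^+ 2 * e (x ^+ 2) - e c0 = 'X ^+ 2 - e r0 ^+ 2.
  by rewrite !expr2 -!eM -[r0 * r0]expr2 e0 eD !(eM, expr2); ring.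
have -> : 'X ^+ 2 + e f * e g * e (x ^+ 2) - e c = 'X ^+ 2 + (e p ^+ 2 - e r ^+ 2).
  rewrite -addrA; congr (_ + _).
  rewrite !expr2 -!eM -!eN -!eD; congr (e _); rewrite -(expr2 r) e1 /p; by field.
have -> : (e f + e g) ^+ 2 * e (x ^+ 2) = 4 * e p ^+ 2.
  have -> : (4 : {poly C}) = e 4 by rewrite /e !rmorph_nat.
  by rewrite !expr2 -!eD -!eM; congr (e _); rewrite /p; field.
rewrite !(eD, eN); ring.
Qed.

Lemma re_mx_adj n (M : 'M[C]_n) w : (re_mx M w)^t* = re_mx M w.
Proof.
rewrite /re_mx adjmxZ adjmxD !adjmxZ trmxCK conjCK fmorphV rmorph_nat addrC //.
Qed.

Lemma Re_sform_re_mx n (M : 'M[C]_n) w x :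
  complex.Re (sform (re_mx M w) x x) = complex.Re (w * sform M x x).
Proof.
rewrite /re_mx sformMZ sformMD !sformMZ -sform_adj -rmorphM.
have -> (z : C) : 2^-1 * (z + z^*) = (complex.Re z)%:C.
  case: z => a b; have -> : (a +i* b)%C + (a +i* b)%C^* = 2 * a%:C.
    by apply/eqP; rewrite eq_complex /=; apply/andP; split; apply/eqP; ring.
  by rewrite mulKf // pnatr_eq0.
by [].
Qed.

Variables (A : 'M[C]_6) (f g h c0 c : R).
Hypothesis recA : reciprocal A.
Hypothesis kA : kippenhahn_factor (xi A) f g h c0 c.
Hypothesis c0_ge0 : 0 <= c0.
Hypothesis c_ge0 : 0 <= c.

Lemma nonneg_dimP k (mu : C) : nonneg_dim (A - mu%:M) k <->
  forall w : C, w * w^* = 1 ->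
    (k <= count (>= complex.Re (w * mu))%R (kippenhahn_roots f g h c0 c (complex.Re w)))%N.
Proof.
have key (w : C) (x : 'rV_6) : complex.Re (w * sform (A - mu%:M) x x)
    = complex.Re (sform (re_mx A w) x x) - complex.Re (w * mu) * complex.Re (sform 1%:M x x).
  rewrite Re_sform_re_mx -[mu%:M]scalemx1 -scaleNr sformMD sformMZ mulrDr.
  have -> : sform 1%:M x x = (complex.Re (sform 1%:M x x))%:C.
    by apply: conj_fixedE; rewrite sform_adj adjmx1.
  by case: (sform A x x) (w) mu => [? ?] [? ?] [? ?] /=; ring.
have eqv (w : C) : w * w^* = 1 -> (exists N : 'M[C]_6, (k <= \rank N)%N /\
    forall x : 'rV_6, (x <= N)%MS -> 0 <= complex.Re (w * sform (A - mu%:M) x x)) <->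
    (k <= count (>= complex.Re (w * mu))%R (kippenhahn_roots f g h c0 c (complex.Re w)))%N.
  move=> w1; rewrite -(spectral_count _ _ (re_mx_adj A w)); last first.
    by rewrite (char_poly_re_mx recA kA w1) kippenhahn_roots_poly.
  split=> -[N [kN hN]]; exists N; split=> // x /hN; by rewrite key subr_ge0.
by split=> nn w w1; apply/eqv => //; apply: nn.
Qed.

(** The factor of the pencil that belongs to the ellipse with foci u, v and squared semiminor axis
    d. By [conic_unit] its value at w ^+ 2 is, up to the factor 4 w ^+ 2, the product of the signed
    distances of u and v from the line through mu with normal conj w, minus d. This focal product
    equals d exactly for tangents, and mu lies strictly inside when it is smaller for every w. *)
Definition conic (mu : C) (u v d : R) : {poly C} :=
  (mu%:P * 'X + (mu^*)%:P - cst u * ('X + 1)) * (mu%:P * 'X + (mu^*)%:P - cst v * ('X + 1))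
  - cst d * (4 * 'X).

Lemma pencil_conics mu : pencil (A - mu%:M) =
  conic mu h (- h) c0 * (conic mu f g c * conic mu (- f) (- g) c).
Proof.
rewrite (pencil_reciprocal recA kA) /conic /kippenhahn_poly !rmorphN /=; ring.
Qed.

Lemma conic_unit mu u v d w : w * w^* = 1 ->
  (conic mu u v d).[w ^+ 2] = 4 * w ^+ 2 *
   ((complex.Re (w * mu) - u * complex.Re w) * (complex.Re (w * mu) - v * complex.Re w) - d)%:C.
Proof.
move=> w1.
have -> : conic mu u v d = (mu%:P * 'X + (mu^*)%:P - cst u * ('X + 1))
    * (mu%:P * 'X + (mu^*)%:P - cst v * ('X + 1)) - (4 * d%:C)%:P * 'X.
  by rewrite /conic polyCM rmorph_nat; ring.
have [y yE] : exists y, y = w ^+ 2 by exists (w ^+ 2).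
rewrite -yE !hornerE yE {y yE}.
have e1 : mu * w ^+ 2 + mu^* = 2 * w * (complex.Re (w * mu))%:C.
  have -> : 2 * w * (complex.Re (w * mu))%:C = w * (2 * (complex.Re (w * mu))%:C) by ring.
  have -> : 2 * (complex.Re (w * mu))%:C = w * mu + (w * mu)^* by rewrite addcJ.
  by rewrite rmorphM /= mulrDr (mulrA w w^*) w1; ring.
have e2 : w ^+ 2 + 1 = 2 * w * (complex.Re w)%:C.
  have -> : 2 * w * (complex.Re w)%:C = w * (2 * (complex.Re w)%:C) by ring.
  have -> : 2 * (complex.Re w)%:C = w + w^* by rewrite addcJ.
  by rewrite mulrDr w1; ring.
rewrite e1 e2 rmorphB rmorphM !rmorphB !rmorphM /=.
ring.
Qed.

Lemma regular_conic mu u v d :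
  (forall w, w * w^* = 1 -> (complex.Re (w * mu) - u * complex.Re w)
     * (complex.Re (w * mu) - v * complex.Re w) < d) ->
  regular_quad (conic mu u v d).
Proof.
move=> hw; split; last first.
  move=> w w1; rewrite conic_unit //.
  have w0 : w != 0 by apply: contra_eq_neq w1 => ->; rewrite mul0r eq_sym oner_eq0.
  rewrite !mulf_neq0 ?expf_neq0 ?pnatr_eq0 //.
  by rewrite eq_complex /= eqxx andbT subr_eq0 lt_eqF // hw.
exists ((mu - u%:C) * (mu - v%:C)), (2 * complex.Re ((mu - u%:C) * (mu^* - v%:C)) - 4 * d).
have -> : cst (2 * complex.Re ((mu - u%:C) * (mu^* - v%:C)) - 4 * d)
   = (mu%:P - cst u) * ((mu^*)%:P - cst v) + ((mu^*)%:P - cst u) * (mu%:P - cst v) - 4 * cst d.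
  pose z := (mu - u%:C) * (mu^* - v%:C).
  have zJ : z^* = (mu^* - u%:C) * (mu - v%:C) by rewrite rmorphM !rmorphB /= conjCK !conj_real.
  have -> : (2 * complex.Re z - 4 * d)%:C = z + z^* - 4 * d%:C.
    by rewrite [z + z^*]addcJ rmorphB !rmorphM /= !rmorph_nat.
  by rewrite zJ polyCB polyCD !polyCM !polyCB rmorph_nat.
have aJ : ((mu - u%:C) * (mu - v%:C))^* = (mu^* - u%:C) * (mu^* - v%:C).
  by rewrite rmorphM !rmorphB /= !conj_real.
rewrite aJ !polyCM !polyCB /conic; ring.
Qed.

(** One direction w suffices here. The lemma serves the factors that are not spent on reductions:
    they form the cofactor r of [rank_range_quads], which must be nonzero. *)
Lemma conic_neq0 mu u v d w : w * w^* = 1 ->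
  (complex.Re (w * mu) - u * complex.Re w) * (complex.Re (w * mu) - v * complex.Re w) != d ->
  conic mu u v d != 0.
Proof.
move=> w1 hd; apply/eqP => /(congr1 (fun q => q.[w ^+ 2])).
rewrite conic_unit // horner0 => /eqP.
have w0 : w != 0 by apply: contra_eq_neq w1 => ->; rewrite mul0r eq_sym oner_eq0.
by apply/negP; rewrite !mulf_neq0 ?expf_neq0 ?pnatr_eq0 // eq_complex /= eqxx andbT subr_eq0.
Qed.

Lemma rank_range_quads mu qs r : (forall q, q \in qs -> regular_quad q) -> r != 0 ->
  pencil (A - mu%:M) = \prod_(q <- qs) q * r -> nonneg_dim (A - mu%:M) (size qs).+1 ->
  rank_numerical_range (size qs).+1 A mu.
Proof.
move=> hq r0 pB nnB; have [X [Xf XB]] := isotropic_quads hq r0 pB nnB.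
have [Y [YY YB]] := orthonormal_frame Xf XB.
by apply/rank_numerical_rangeP; exists Y; split=> //; exact: isotropic_shift.
Qed.

Lemma rank_range1 mu : nonneg_dim (A - mu%:M) 1 -> rank_numerical_range 1 A mu.
Proof.
move=> /isotropic1[x [x0 xB]].
have [||Y [YY YB]] := @orthonormal_frame _ 1 6 x (A - mu%:M).
- by rewrite /row_free rank_rV x0.
- by rewrite sformE xB raddf0.
by apply/rank_numerical_rangeP; exists Y; split=> //; exact: isotropic_shift.
Qed.

Lemma rank_range_nonneg k mu : rank_numerical_range k A mu -> nonneg_dim (A - mu%:M) k.
Proof.
move=> /rank_numerical_rangeP[X [XX XA]] w w1; exists <<X>>%MS; split.
  by rewrite genmxE mxrank_unitary //; apply/unitarymxP.
move=> x; rewrite genmxE => /submxP[y ->].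
have -> : sform (A - mu%:M) (y *m X) (y *m X) = 0; last by rewrite mulr0.
rewrite /sform adjmxM mulmxA -[y *m X *m _]mulmxA -[y *m _ *m X^t*]mulmxA mulmxBr mulmxBl XA.
by rewrite mul_mx_scalar -scalemxAl XX scale_scalar_mx mulr1 subrr mulmx0 mul0mx mxE.
Qed.

Lemma rank_range_le k l mu : (l <= k)%N ->
  rank_numerical_range k A mu -> rank_numerical_range l A mu.
Proof.
move=> lk /rank_numerical_rangeP[X [XX XA]]; apply/rank_numerical_rangeP.
exists (rowsub (widen_ord lk) X).
have sub (M : 'M[C]_6) : rowsub (widen_ord lk) X *m M *m (rowsub (widen_ord lk) X)^t*
    = mxsub (widen_ord lk) (widen_ord lk) (X *m M *m X^t*).
  apply/matrixP => i j; rewrite !mxE; apply: eq_bigr => t _; rewrite !mxE; congr (_ * _).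
  by apply: eq_bigr => s _; rewrite !mxE.
have := sub 1%:M; rewrite !mulmx1 XX => ->; rewrite sub XA.
by split; apply/matrixP => i j; rewrite !mxE.
Qed.

End Spectrum.

(** * Half-plane intersections and convex hulls of ellipses *)

Section Convex.
Local Open Scope sesquilinear_scope.
Variable R : realType.
Local Notation C := R[i].
Local Notation "x %:C" := (real_complex R x) (format "x %:C") : ring_scope.

Lemma unitcP (w : C) : w * w^* = 1 <-> complex.Re w ^+ 2 + complex.Im w ^+ 2 = 1.
Proof.
rewrite mulcJE normcX2; split=> [/(congr1 (@complex.Re R))//|->].
by [].
Qed.

Lemma Re_mulc (w z : C) : complex.Re (w * z)
  = complex.Re w * complex.Re z - complex.Im w * complex.Im z.
Proof. by case: w z => [a b] []. Qed.

(** The bound depends on w through its real part alone because all the sets in question are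
    symmetric about the real axis. *)
Definition half_planes (s : R -> R) : set C :=
  [set z | forall w : C, w * w^* = 1 -> complex.Re (w * z) <= s (complex.Re w)].

Local Open Scope convex_scope.

Lemma convcE (l : {i01 R}) (x y : convex_lmodType (Rcomplex R)) :
  x <| l |> y = (l%:num)%:C * (x : C) + (1 - l%:num)%:C * (y : C) :> C.
Proof.
case: x y => [a b] [c d]; apply/eqP; rewrite eq_complex /= !mul0r !addr0 !subr0.
by rewrite !eqxx.
Qed.

Lemma half_planes_convex s : @convex_set R (Rcomplex R) (half_planes s).
Proof.
move=> x y l; rewrite !inE => hx hy w w1.
rewrite convcE.
have -> : complex.Re (w * ((l%:num)%:C * (x : C) + (1 - l%:num)%:C * (y : C))) =
    l%:num * complex.Re (w * x) + (1 - l%:num) * complex.Re (w * y).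
  by case: (x) (y) (w) => [? ?] [? ?] [? ?] /=; ring.
have := hx w w1; have := hy w w1.
have l0 : 0 <= l%:num :> R by [].
have l1 : l%:num <= 1 :> R by [].
move: (l%:num) l0 l1 => t t0 t1; nra.
Qed.

Lemma conv_sub_half_planes s S : S `<=` half_planes s -> conv S `<=` half_planes s.
Proof. by move=> h; apply: smallest_sub => //; exact: half_planes_convex. Qed.

Lemma sub_conv (S : set C) : S `<=` conv S.
Proof. exact: sub_gen_smallest. Qed.

Lemma conv_segment (S : set C) (x1 x2 x y : R) :
  conv S (Complex x1 y) -> conv S (Complex x2 y) -> x1 <= x <= x2 -> conv S (Complex x y).
Proof.
move=> h1 h2 /andP[x1x xx2].
have [e|ne] := eqVneq x1 x2.
  by have -> : x = x1 by apply/eqP; rewrite eq_le x1x e xx2.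
have d0 : 0 < x2 - x1 by rewrite subr_gt0 lt_neqAle ne (le_trans x1x).
pose t := (x2 - x) / (x2 - x1).
have t0 : 0 <= t by rewrite divr_ge0 ?subr_ge0 // (le_trans x1x).
have t1 : t <= 1 by rewrite ler_pdivrMr // mul1r lerD2l lerN2.
move=> T [cT ST].
have := cT _ _ (Itv01 t0 t1) (mem_set (h1 T (conj cT ST))) (mem_set (h2 T (conj cT ST))).
rewrite inE convcE /=.
have -> : (t%:C * Complex x1 y + (1 - t)%:C * Complex x2 y) = Complex x y :> C.
  apply/eqP; rewrite eq_complex /= !mul0r !addr0 !subr0; apply/andP; split; apply/eqP; last
    by ring.
  by rewrite /t; field; rewrite gt_eqF.
by [].
Qed.

Lemma half_widthN (d e x : R) : half_width d (- e) x = half_width d e x.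
Proof. by rewrite /half_width sqrrN. Qed.

Lemma half_width_opp (d e x : R) : half_width d e (- x) = half_width d e x.
Proof. by rewrite /half_width sqrrN. Qed.

Lemma half_width_norm (d e x : R) : 0 <= d -> `|e * x| <= half_width d e x.
Proof.
move=> d0; rewrite -sqrtr_sqr; apply: ler_wsqrtr.
by rewrite exprMn lerDr.
Qed.

Section OneEllipse.
Variables (E : ellipse R) (f g : R).
Hypothesis E1 : focus1 E = f%:C.
Hypothesis E2 : focus2 E = g%:C.
Let b := semiminor E.
Let p := (f + g) / 2.
Let e := (f - g) / 2.
Let a := semimajor E.

Let b_ge0 : 0 <= b := semiminor_ge0 E.
Let fE : f = p + e. Proof. by rewrite /p /e; field. Qed.
Let gE : g = p - e. Proof. by rewrite /p /e; field. Qed.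

Lemma semimajor_sqr : a ^+ 2 = b ^+ 2 + e ^+ 2.
Proof.
rewrite /a /semimajor sqr_sqrtr ?addr_ge0 ?sqr_ge0 //; congr (_ + _).
have -> : (focus1 E - focus2 E) / 2 = e%:C.
  by rewrite E1 E2 /e rmorphM rmorphB fmorphV rmorph_nat.
by rewrite /= expr0n addr0 sqr_sqrtr ?sqr_ge0.
Qed.

Let a_ge0 : 0 <= a. Proof. exact: sqrtr_ge0. Qed.

(** Both directions pass through the focal distances, which are a - e u / a and a + e u / a for u =
    x - p. *)
Lemma ellipse_pointsP (x y : R) : 0 < b ->
  points E (Complex x y) <-> b ^+ 2 * (x - p) ^+ 2 + a ^+ 2 * y ^+ 2 = a ^+ 2 * b ^+ 2.
Proof.
move=> b0; rewrite /points gt_eqF // E1 E2 /= -/a.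
have -> : Num.sqrt ((x - f) ^+ 2 + (y - 0) ^+ 2) = Num.sqrt ((x - p - e) ^+ 2 + y ^+ 2).
  by rewrite subr0 fE; congr (Num.sqrt (_ ^+ 2 + _)); ring.
have -> : Num.sqrt ((x - g) ^+ 2 + (y - 0) ^+ 2) = Num.sqrt ((x - p + e) ^+ 2 + y ^+ 2).
  by rewrite subr0 gE; congr (Num.sqrt (_ ^+ 2 + _)); ring.
move: (x - p) => u.
have a0 : 0 < a by rewrite lt_neqAle a_ge0 andbT; apply: contra_eq_neq semimajor_sqr => <-;
  rewrite expr0n /= lt_eqF // ltr_wpDr ?sqr_ge0 // exprn_gt0.
have s1 := sqr_sqrtr (addr_ge0 (sqr_ge0 (u - e)) (sqr_ge0 y)).
have s2 := sqr_sqrtr (addr_ge0 (sqr_ge0 (u + e)) (sqr_ge0 y)).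
split=> [|h].
  move: s1 s2; move: (Num.sqrt ((u - e) ^+ 2 + y ^+ 2)) (Num.sqrt ((u + e) ^+ 2 + y ^+ 2))
    => r1 r2 s1 s2 rr.
  have d : a * (r1 - r2) = - (2 * e * u).
    have : (r1 + r2) * (r1 - r2) = - (4 * e * u).
      have -> : (r1 + r2) * (r1 - r2) = r1 ^+ 2 - r2 ^+ 2 by ring.
      by rewrite s1 s2; ring.
    by rewrite rr; lra.
  have ar1 : a * r1 = a ^+ 2 - e * u by nra.
  have : a ^+ 2 * r1 ^+ 2 = (a ^+ 2 - e * u) ^+ 2 by rewrite -ar1; ring.
  rewrite s1.
  have -> : b ^+ 2 = a ^+ 2 - e ^+ 2 by rewrite semimajor_sqr; ring.
  move=> h; apply/eqP; rewrite -subr_eq0; apply/eqP.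
  have -> : (a ^+ 2 - e ^+ 2) * u ^+ 2 + a ^+ 2 * y ^+ 2 - a ^+ 2 * (a ^+ 2 - e ^+ 2)
    = a ^+ 2 * ((u - e) ^+ 2 + y ^+ 2) - (a ^+ 2 - e * u) ^+ 2 by ring.
  by rewrite h subrr.
have an0 : a != 0 by rewrite gt_eqF.
have b2 : 0 < b ^+ 2 by rewrite exprn_gt0.
have ua : u ^+ 2 <= a ^+ 2.
  by rewrite -(ler_pM2l b2) [b ^+ 2 * a ^+ 2]mulrC -h lerDl mulr_ge0 ?sqr_ge0.
have eu : `|e * u| <= a ^+ 2.
  rewrite -ler_sqr ?nnegrE ?normr_ge0 ?sqr_ge0 // real_normK ?num_real // exprMn expr2.
  by apply: ler_pM => //; rewrite ?sqr_ge0 // semimajor_sqr lerDr sqr_ge0.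
have [eu1 eu2] : - a ^+ 2 <= e * u /\ e * u <= a ^+ 2 by apply/andP; rewrite -ler_norml.
have sq (s : R) : (s ^+ 2 = e ^+ 2) -> 0 <= a + s * u / a ->
    Num.sqrt ((u + s) ^+ 2 + y ^+ 2) = a + s * u / a.
  move=> se s0; rewrite -[RHS]ger0_norm // -sqrtr_sqr; congr Num.sqrt.
  have y2 : y ^+ 2 = b ^+ 2 - b ^+ 2 * u ^+ 2 / a ^+ 2.
    apply: (mulfI (expf_neq0 2 an0)); rewrite mulrBr -h; field.
    by rewrite an0.
  rewrite y2; have -> : b ^+ 2 = a ^+ 2 - s ^+ 2 by rewrite se semimajor_sqr; ring.
  by field.
have pos (s : R) : - a ^+ 2 <= s * u -> 0 <= a + s * u / a.
  move=> h'; rewrite -(pmulr_rge0 _ a0); have -> : a * (a + s * u / a) = a ^+ 2 + s * u by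
    field.
  by lra.
rewrite (sq (- e)) ?(sq e) ?sqrrN //; last by apply: pos; rewrite mulNr; lra.
- by field.
- exact: pos.
Qed.

(** om is half the horizontal chord at height y, and every point of that height beyond the chord is
    cut off by a half-plane. The sign of [complex.Re w] is recorded for the hull of E and -E, whose
    bound involves its absolute value. *)
Lemma ellipse_chord (y : R) : `|y| <= b ->
  exists om : R, [/\ 0 <= om, points E (Complex (p + om) y), points E (Complex (p - om) y) &
    forall u, om < u -> exists w : C, [/\ w * w^* = 1, 0 <= complex.Re w &
      half_width (b ^+ 2) e (complex.Re w) < complex.Re w * u - complex.Im w * y]].
Proof.
move=> yb.
have [b0|b0] := eqVneq b 0.
  have y0 : y = 0 by apply/eqP; rewrite -normr_le0 -b0.
  have pt s : s = e \/ s = - e -> points E (Complex (p + s) y).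
    rewrite /points -/b b0 eqxx y0 /foci E1 E2 => -[] ->; [left|right]; rewrite /=.
      by rewrite fE.
    by rewrite gE.
  exists `|e|; split=> //.
  - by apply: pt; case: (ler0P e) => _; [right|left].
  - by apply: pt; case: (ler0P e) => _; [left|right]; rewrite ?opprK.
  move=> u ue; exists 1; split; rewrite ?rmorph1 ?mulr1 //=.
  rewrite b0 /half_width expr1n mulr1 mul0r subr0 mul1r expr0n add0r sqrtr_sqr //.
have bp : 0 < b by rewrite lt_neqAle eq_sym b0 b_ge0.
have a2p : 0 < a ^+ 2 by rewrite semimajor_sqr ltr_wpDr ?sqr_ge0 // exprn_gt0.
have b2p : 0 < b ^+ 2 by rewrite exprn_gt0.
have d0 : 0 <= 1 - y ^+ 2 / b ^+ 2.
  rewrite subr_ge0 ler_pdivrMr // mul1r -(@real_normK _ y) ?num_real //.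
  by rewrite ler_sqr ?nnegrE.
have om2 := sqr_sqrtr d0; set om := Num.sqrt _ in om2.
have om_ge0 : 0 <= om by exact: sqrtr_ge0.
exists (a * om); split; first by rewrite mulr_ge0.
- apply/ellipse_pointsP => //; rewrite addrAC subrr add0r exprMn om2; field.
  by rewrite gt_eqF.
- apply/ellipse_pointsP => //; rewrite addrAC subrr add0r sqrrN exprMn om2; field.
  by rewrite gt_eqF.
move=> u ou; have u0 : 0 < u by apply: le_lt_trans ou; rewrite mulr_ge0.
have u2 : a ^+ 2 * om ^+ 2 < u ^+ 2.
  by rewrite -exprMn ltr_sqr ?nnegrE ?mulr_ge0 // ltW.
(* q is the value at (u, y) of the quadratic form that is 1 on the centered ellipse, and (n1, n2) is
   half its gradient, with the second sign reversed as Re (w z) contains - Im w. For w = (n1, n2) /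
   N the two sides are sqrt q / N and q / N, and q > 1. *)
pose q := u ^+ 2 / a ^+ 2 + y ^+ 2 / b ^+ 2.
have q1 : 1 < q.
  have : om ^+ 2 < u ^+ 2 / a ^+ 2 by rewrite ltr_pdivlMr // mulrC.
  by rewrite om2 /q; lra.
have [n1 n1E] : exists n1, n1 = u / a ^+ 2 by exists (u / a ^+ 2).
have [n2 n2E] : exists n2, n2 = - (y / b ^+ 2) by exists (- (y / b ^+ 2)).
have n1p : 0 < n1 by rewrite n1E divr_gt0.
have N2 : 0 < n1 ^+ 2 + n2 ^+ 2 by rewrite ltr_wpDr ?sqr_ge0 // exprn_gt0.
pose N := Num.sqrt (n1 ^+ 2 + n2 ^+ 2).
have Np : 0 < N by rewrite sqrtr_gt0.
have NN : N ^+ 2 = n1 ^+ 2 + n2 ^+ 2 by rewrite sqr_sqrtr // ltW.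
exists (Complex (n1 / N) (n2 / N)); split.
- apply/unitcP; rewrite /= !expr_div_n -mulrDl -NN divff // expf_neq0 // gt_eqF //.
- by rewrite /= divr_ge0 // ltW.
rewrite /=.
have -> : n1 / N * u - n2 / N * y = q / N.
  rewrite /q n1E n2E; field.
  by rewrite b0 (gt_eqF Np) /= -sqrf_eq0 gt_eqF.
have q0 : 0 < q by apply: lt_trans q1.
have qN : 0 <= q / N by rewrite divr_ge0 // ltW.
rewrite -[ltRHS]ger0_norm // -sqrtr_sqr; rewrite ltr_sqrt ?exprn_gt0 ?divr_gt0 //.
have -> : b ^+ 2 + e ^+ 2 * (n1 / N) ^+ 2 = q / N ^+ 2.
  have -> : e ^+ 2 = a ^+ 2 - b ^+ 2 by rewrite semimajor_sqr; ring.
  have -> : b ^+ 2 + (a ^+ 2 - b ^+ 2) * (n1 / N) ^+ 2 = (a ^+ 2 * n1 ^+ 2 + b ^+ 2 * (N ^+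
    2 - n1 ^+ 2)) / N ^+ 2.
    by field; rewrite gt_eqF.
  rewrite NN n1E n2E /q; congr (_ / _); field.
  by rewrite b0 -sqrf_eq0 gt_eqF.
rewrite exprMn exprVn ltr_pM2r ?invr_gt0 ?exprn_gt0 //.
by rewrite expr2 ltr_pMr.
Qed.

Lemma points_half_planes z : points E z ->
  half_planes (fun x => p * x + half_width (b ^+ 2) e x) z.
Proof.
case: z => x y hz w /unitcP w1; rewrite Re_mulc /=.
move: (complex.Re w) (complex.Im w) w1 => c s w1.
have [b0|b0] := eqVneq b 0.
  move: hz; rewrite /points -/b b0 eqxx /foci E1 E2 /= => -[] [-> ->]; rewrite mulr0 subr0.
    have := half_width_norm e c (lexx (0 : R)); rewrite expr0n /= ler_norml => /andP[_ h].
    by rewrite {1}fE; lra.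
  have := half_width_norm e c (lexx (0 : R)); rewrite expr0n /= ler_norml => /andP[h _].
  by rewrite {1}gE; lra.
have bp : 0 < b by rewrite lt_neqAle eq_sym b0 b_ge0.
move/ellipse_pointsP: hz => /(_ bp) h.
have a2p : 0 < a ^+ 2 by rewrite semimajor_sqr ltr_wpDr ?sqr_ge0 // exprn_gt0.
have b2p : 0 < b ^+ 2 by rewrite exprn_gt0.
rewrite -lerBlDl; have -> : c * x - s * y - p * c = c * (x - p) - s * y by ring.
move: (x - p) h => u h.
apply: le_trans (ler_norm _) _; rewrite -sqrtr_sqr; apply: ler_wsqrtr.
have -> : b ^+ 2 + e ^+ 2 * c ^+ 2 = a ^+ 2 * c ^+ 2 + b ^+ 2 * s ^+ 2.
  have -> : s ^+ 2 = 1 - c ^+ 2 by rewrite -w1; ring.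
  by rewrite semimajor_sqr; ring.
have ab : 0 < a ^+ 2 * b ^+ 2 by rewrite mulr_gt0.
rewrite -(ler_pM2l ab) -subr_ge0.
(* The Cauchy-Schwarz inequality through Lagrange's identity: the difference is a perfect square. *)
have -> : a ^+ 2 * b ^+ 2 * (a ^+ 2 * c ^+ 2 + b ^+ 2 * s ^+ 2) - a ^+ 2 * b ^+ 2 * (c * u
  - s * y) ^+ 2
   = (a ^+ 2 * c ^+ 2 + b ^+ 2 * s ^+ 2) * (b ^+ 2 * u ^+ 2 + a ^+ 2 * y ^+ 2) - a ^+ 2 * b
     ^+ 2 * (c * u - s * y) ^+ 2.
  by rewrite h; ring.
have -> : (a ^+ 2 * c ^+ 2 + b ^+ 2 * s ^+ 2) * (b ^+ 2 * u ^+ 2 + a ^+ 2 * y ^+ 2) - a ^+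
  2 * b ^+ 2 * (c * u - s * y) ^+ 2
   = (a ^+ 2 * c * y + b ^+ 2 * s * u) ^+ 2 by ring.
exact: sqr_ge0.
Qed.

Lemma half_planes_height q x y :
  half_planes (fun t => q * t + half_width (b ^+ 2) e t) (Complex x y) -> `|y| <= b.
Proof.
have r0 : half_width (b ^+ 2) e 0 = b by rewrite /half_width expr0n mulr0 addr0 sqrtr_sqr
  ger0_norm.
move=> h; rewrite ler_norml; apply/andP; split.
  have := h (Complex 0 1); rewrite unitcP Re_mulc /= expr0n expr1n add0r !mul0r sub0r mul1r
    mulr0 add0r r0.
  by move=> /(_ erefl); lra.
have := h (Complex 0 (-1)); rewrite unitcP Re_mulc /= expr0n sqrrN expr1n add0r !mul0r
  sub0r mulN1r opprK mulr0 add0r r0.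
by move=> /(_ erefl).
Qed.

(** A point satisfying all the half-planes lies on the horizontal chord of E at its height, since
    the half-planes of [ellipse_chord] cut off everything beyond the ends. *)
Lemma conv_ellipse :
  conv (points E) = half_planes (fun x => p * x + half_width (b ^+ 2) e x).
Proof.
apply/seteqP; split; first by apply: conv_sub_half_planes; exact: points_half_planes.
case=> x y hz; have yb := half_planes_height hz.
have [om [om0 p1 p2 far]] := ellipse_chord yb.
apply: (conv_segment (x1 := p - om) (x2 := p + om)); try exact: sub_conv.
apply/andP; split; rewrite leNgt; apply/negP => hx.
  have [|w [w1 w0 hw]] := far (p - x); first by lra.
  move/unitcP: w1 => w1.
  have := hz (Complex (- complex.Re w) (complex.Im w)); rewrite unitcP Re_mulc /= sqrrN
    half_width_opp.
  by move=> /(_ w1); lra.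
have [|w [w1 w0 hw]] := far (x - p); first by lra.
by have := hz w w1; rewrite Re_mulc /=; lra.
Qed.

(** The horizontal segment now runs from the left end of the chord of -E to the right end of the
    chord of E. Beyond these ends the directions of [ellipse_chord] have a sign for which the bound
    is that of -E or of E alone. *)
Lemma conv_ellipse_opp : 0 <= p ->
  conv (points E `|` [set - z | z in points E])
  = half_planes (fun x => p * `|x| + half_width (b ^+ 2) e x).
Proof.
move=> p0; apply/seteqP; split.
  apply: conv_sub_half_planes => z [hz|[z' hz' <-]] w w1.
    apply: le_trans (points_half_planes hz w1) _; rewrite lerD2r.
    by rewrite ler_wpM2l // ler_norm.
  have w1' : (- w) * (- w)^* = 1 by rewrite rmorphN mulrNN.
  rewrite mulrN -mulNr; apply: le_trans (points_half_planes hz' w1') _.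
  have -> : complex.Re (- w) = - complex.Re w by case: (w).
  rewrite half_width_opp lerD2r.
  by rewrite ler_wpM2l // -normrN ler_norm.
case=> x y hz.
have hz0 (w : C) : w * w^* = 1 -> 0 <= complex.Re w ->
   complex.Re w * x - complex.Im w * y <= p * complex.Re w + half_width (b ^+ 2) e
     (complex.Re w).
  by move=> w1 w0; have := hz w w1; rewrite Re_mulc /= (ger0_norm w0).
have hz1 (w : C) : w * w^* = 1 -> 0 <= complex.Re w ->
   complex.Re w * (- x) - complex.Im w * y <= p * complex.Re w + half_width (b ^+ 2) e
     (complex.Re w).
  move=> /unitcP w1 w0; have := hz (Complex (- complex.Re w) (complex.Im w)).
  by rewrite unitcP Re_mulc /= sqrrN half_width_opp normrN (ger0_norm w0) => /(_ w1); lra.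
have r0 : half_width (b ^+ 2) e 0 = b by rewrite /half_width expr0n mulr0 addr0 sqrtr_sqr
  ger0_norm.
have yb : `|y| <= b.
  rewrite ler_norml; apply/andP; split.
    have := hz0 (Complex 0 1); rewrite unitcP /= expr0n expr1n add0r !mul0r sub0r mul1r
      mulr0 add0r r0.
    by move=> /(_ erefl (lexx _)); lra.
  have := hz0 (Complex 0 (-1)); rewrite unitcP /= expr0n sqrrN expr1n add0r !mul0r sub0r
    mulN1r opprK mulr0 add0r r0.
  by move=> /(_ erefl (lexx _)).
have [om [om0 p1 p2 far]] := ellipse_chord yb.
have yb' : `|- y| <= b by rewrite normrN.
have [om' [om'0 p1' p2' far']] := ellipse_chord yb'.
apply: (conv_segment (x1 := - (p + om')) (x2 := p + om)).
- apply: sub_conv; right; exists (Complex (p + om') (- y)) => //.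
  by apply/eqP; rewrite eq_complex /= opprK !eqxx.
- by apply: sub_conv; left.
apply/andP; split; rewrite leNgt; apply/negP => hx.
  have [|w [w1 w0 hw]] := far' (- x - p); first by lra.
  move/unitcP: w1 => w1.
  have := hz (Complex (- complex.Re w) (- complex.Im w)).
  rewrite unitcP Re_mulc /= !sqrrN half_width_opp normrN (ger0_norm w0).
  by move=> /(_ w1); lra.
have [|w [w1 w0 hw]] := far (x - p); first by lra.
by have := hz0 w w1 w0; lra.
Qed.

End OneEllipse.
End Convex.

(** * Tangent lines *)

Section Tangents.
Local Open Scope sesquilinear_scope.
Variable R : realType.
Local Notation C := R[i].
Local Notation "x %:C" := (real_complex R x) (format "x %:C") : ring_scope.

Lemma expi_conj (t : R) : (expi t)^* = expi (- t).
Proof. by rewrite /expi cosN sinN. Qed.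

Lemma expi_unit (t : R) : expi t * (expi t)^* = 1.
Proof. by apply/unitcP; rewrite /= cos2Dsin2. Qed.

Lemma lineP (t s : R) z : line t s z <-> complex.Re (expi t * z) = s.
Proof.
split=> [[u ->]|h].
  by rewrite mulrA -expi_conj expi_unit mul1r.
exists (complex.Im (expi t * z)).
have -> : Complex s (complex.Im (expi t * z)) = expi t * z by rewrite -h; case: (expi t * z).
by rewrite mulrA -expi_conj [_^* * _]mulrC expi_unit mul1r.
Qed.

Lemma line_inj (t : R) : injective (line t).
Proof.
move=> s1 s2 e; have : line t s1 (expi (- t) * s1%:C) by exists 0.
move=> h; have /lineP e1 := h; rewrite e in h; have /lineP e2 := h.
by rewrite -e1 e2.
Qed.

Section OneEllipse.
Variables (E : ellipse R) (f g : R).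
Hypothesis E1 : focus1 E = f%:C.
Hypothesis E2 : focus2 E = g%:C.
Local Notation b := (semiminor E).
Local Notation a := (semimajor E).
Local Notation p := ((f + g) / 2).
Local Notation e := ((f - g) / 2).

Lemma tangent_point (t sg : R) : 0 < b -> sg ^+ 2 = 1 ->
  exists z, line t (p * cos t + sg * half_width (b ^+ 2) e (cos t)) `&` points E = [set z].
Proof.
move=> b0 sg2; have a2 := semimajor_sqr E1 E2.
have b2p : 0 < b ^+ 2 by rewrite exprn_gt0.
have r2 := half_width_sqr e (cos t) (sqr_ge0 b).
have r0 := half_width_ge0 (b ^+ 2) e (cos t).
move: (half_width _ _ _) r2 r0 => r r2 r0.
have rn0 : r != 0.
  by rewrite -sqrf_eq0 r2 gt_eqF // ltr_wpDr // mulr_ge0 ?sqr_ge0.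
have rE : r ^+ 2 = a ^+ 2 * cos t ^+ 2 + b ^+ 2 * sin t ^+ 2.
  by rewrite r2 sin2cos2 a2; ring.
(* The point of contact: relative to the center it is the gradient of the support function at the
   normal (cos t, - sin t), with the side chosen by sg. *)
exists (Complex (p + sg * (a ^+ 2 * cos t) / r) (- sg * (b ^+ 2 * sin t) / r)).
have lP z : line t (p * cos t + sg * r) z <->
    cos t * (complex.Re z - p) - sin t * complex.Im z = sg * r.
  rewrite lineP Re_mulc /= mulrBr; split=> h; last by rewrite -h; ring.
  by apply/eqP; rewrite -subr_eq0 -(subrr (p * cos t + sg * r)) -{1}h; apply/eqP; ring.
move: (cos t) (sin t) rE lP => c s rE lP.
have rr : r = (a ^+ 2 * c ^+ 2 + b ^+ 2 * s ^+ 2) / r by rewrite -rE expr2 mulfK.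
apply/seteqP; split=> [[u y] [/lP /= l1 /(ellipse_pointsP E1 E2 _ _ b0) l2]|z ->] /=.
  move: (u - p) (subrK p u) l1 l2 => v <- l1 l2.
  (* Equality in Lagrange's identity forces this linear relation, which together with the line
     determines the point. *)
  have h : a ^+ 2 * c * y + b ^+ 2 * s * v = 0.
    apply/eqP; rewrite -sqrf_eq0.
    have -> : (a ^+ 2 * c * y + b ^+ 2 * s * v) ^+ 2
      = (a ^+ 2 * c ^+ 2 + b ^+ 2 * s ^+ 2) * (b ^+ 2 * v ^+ 2 + a ^+ 2 * y ^+ 2) - a ^+ 2
        * b ^+ 2 * (c * v - s * y) ^+ 2 by ring.
    by rewrite l2 -rE l1 exprMn sg2; apply/eqP; ring.
  congr Complex.
    rewrite addrC; congr (_ + _); apply: (mulIf (expf_neq0 2 rn0)).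
    have -> : sg * (a ^+ 2 * c) / r * r ^+ 2 = a ^+ 2 * c * (sg * r) by field.
    rewrite -l1 rE; apply/eqP; rewrite -subr_eq0.
    have -> : v * (a ^+ 2 * c ^+ 2 + b ^+ 2 * s ^+ 2) - a ^+ 2 * c * (c * v - s * y) = s *
      (a ^+ 2 * c * y + b ^+ 2 * s * v) by ring.
    by rewrite h mulr0.
  apply: (mulIf (expf_neq0 2 rn0)).
  have -> : - sg * (b ^+ 2 * s) / r * r ^+ 2 = - (b ^+ 2 * s * (sg * r)) by field.
  rewrite -l1 rE; apply/eqP; rewrite -subr_eq0.
  have -> : y * (a ^+ 2 * c ^+ 2 + b ^+ 2 * s ^+ 2) - - (b ^+ 2 * s * (c * v - s * y)) = c
    * (a ^+ 2 * c * y + b ^+ 2 * s * v) by ring.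
  by rewrite h mulr0.
split.
  apply/lP => /=; rewrite [RHS](_ : _ = sg * ((a ^+ 2 * c ^+ 2 + b ^+ 2 * s ^+ 2) / r));
    last by rewrite -rr.
  by field.
apply/(ellipse_pointsP E1 E2 _ _ b0).
have -> : p + sg * (a ^+ 2 * c) / r - p = sg * (a ^+ 2 * c) / r by ring.
have -> : b ^+ 2 * (sg * (a ^+ 2 * c) / r) ^+ 2 + a ^+ 2 * (- sg * (b ^+ 2 * s) / r) ^+ 2
  = sg ^+ 2 * (a ^+ 2 * b ^+ 2 * (a ^+ 2 * c ^+ 2 + b ^+ 2 * s ^+ 2)) / r ^+ 2 by field.
by rewrite sg2 -rE mul1r mulfK // expf_neq0.
Qed.

(** The order is left open because for a pair of foci the sign of e cos t decides which focus
    carries the larger value. *)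
Lemma tangent_pair_exists (t : R) : exists s1 s2 : R,
  tangent_pair t E (line t s1, line t s2) /\
  perm_eq [:: s1; s2] [:: p * cos t + half_width (b ^+ 2) e (cos t);
                          p * cos t - half_width (b ^+ 2) e (cos t)].
Proof.
have [b0|b0] := eqVneq b 0.
  exists (f * cos t), (g * cos t); split.
    rewrite /tangent_pair b0 eqxx /=; split; [by exists (f * cos t)|by exists (g * cos t)|].
    by rewrite E1 E2; split; apply/lineP; rewrite Re_mulc /= mulr0 subr0 mulrC.
  rewrite b0 /half_width expr0n add0r -exprMn sqrtr_sqr.
  have fE : f * cos t = p * cos t + e * cos t by field.
  have gE : g * cos t = p * cos t - e * cos t by field.
  rewrite {1}fE {1}gE; case: (ger0P (e * cos t)) => _ //.
  by rewrite opprK (perm_catC [:: _] [:: _]).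
have bp : 0 < b by rewrite lt_neqAle eq_sym b0 semiminor_ge0.
have rp : 0 < half_width (b ^+ 2) e (cos t).
  by rewrite sqrtr_gt0 ltr_wpDr ?exprn_gt0 // mulr_ge0 ?sqr_ge0.
have [z1 h1] := @tangent_point t 1 bp (expr1n _ _).
have [z2 h2] := @tangent_point t (-1) bp (etrans (sqrrN 1) (expr1n _ _)).
rewrite mul1r in h1; rewrite mulN1r in h2.
exists (p * cos t + half_width (b ^+ 2) e (cos t)), (p * cos t - half_width (b ^+ 2) e (cos
  t)); split=> //.
rewrite /tangent_pair (negPf b0) /=; split; [by eexists|by eexists|split; [|by exists z1|by
  exists z2]].
by move=> /line_inj; lra.
Qed.

(** The lines of angle pi / 2 are horizontal, and the horizontal tangents of an ellipse with real
    foci depend on its semiminor axis alone. This makes the axes recoverable from the spectrum. *)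
Lemma tangent_pair_vertical (L : set C * set C) : tangent_pair (pi / 2) E L ->
  perm_eq [:: L.1; L.2] [:: line (pi / 2) b; line (pi / 2) (- b)].
Proof.
have lP (s : R) (z : C) : line (pi / 2) s z <-> complex.Im z = - s.
  apply: (iff_trans (lineP _ _ _)).
  rewrite Re_mulc /= cos_pihalf sin_pihalf mul0r mul1r sub0r.
  by split=> [<-|->]; rewrite opprK.
case: L => L1 L2 [[s1 _ <-] [s2 _ <-]] /=.
have [b0|b0] := eqVneq b 0.
  rewrite E1 E2 b0 oppr0 => -[/lP /= /esym /eqP + /lP /= /esym /eqP].
  by rewrite !oppr_eq0 => /eqP -> /eqP ->.
have bp : 0 < b by rewrite lt_neqAle eq_sym b0 semiminor_ge0.
have ab : 0 < semimajor E ^+ 2.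
  by rewrite (semimajor_sqr E1 E2) ltr_wpDr ?sqr_ge0 // exprn_gt0.
(* Reflection in x = p preserves the ellipse and each horizontal line, so a single common point has
   x = p and height b or - b. *)
have key s : (exists z, line (pi / 2) s `&` points E = [set z]) -> s = b \/ s = - b.
  move=> [[x y] h].
  have [l1 l2] : (line (pi / 2) s `&` points E) (Complex x y) by rewrite h.
  have l1' : y = - s by move/lP: l1.
  have h2 := (ellipse_pointsP E1 E2 x y bp).1 l2.
  have : (line (pi / 2) s `&` points E) (Complex (2 * p - x) y).
    split; first exact/lP.
    apply/(ellipse_pointsP E1 E2 _ _ bp); rewrite -h2; ring.
  rewrite h => -[] xp.
  have xp' : x - p = 0 by lra.
  move: h2; rewrite xp' expr0n mulr0 add0r => /(mulfI (lt0r_neq0 ab))/eqP.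
  by rewrite l1' sqrrN eqf_sqr => /orP[] /eqP; [left|right].
case=> ne /key k1 /key k2; move: ne.
case: k1 => ->; case: k2 => -> ne; [by case: ne|exact: perm_refl| |by case: ne].
by rewrite (perm_catC [:: _] [:: _]).
Qed.

End OneEllipse.

Lemma eigenvaluesE n (H : 'M[C]_n) (ss : seq R) :
  char_poly H = \prod_(s <- ss) ('X - (s%:C)%:P) -> perm_eq (eigenvalues H) ss.
Proof.
move=> hH; rewrite /eigenvalues perm_sort; case: closed_field_poly_normal => r /= rE.
have : \prod_(z <- r) ('X - z%:P) = \prod_(z <- [seq s%:C | s <- ss]) ('X - z%:P).
  by rewrite big_map -hH rE (monicP (char_poly_monic H)) scale1r.
move=> /prod_XsubC_perm/(perm_map (@complex.Re R)); rewrite -map_comp.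
by rewrite [X in perm_eq _ X](_ : _ = map id ss) ?map_id //; apply: eq_map.
Qed.

End Tangents.

(** * Existence of the ellipses, and their recovery from the spectrum *)

Section Kippenhahn.
Local Open Scope sesquilinear_scope.
Variable R : realType.
Local Notation C := R[i].
Local Notation "x %:C" := (real_complex R x) (format "x %:C") : ring_scope.

Variables (A : 'M[C]_6) (f g h b0 b : R).
Hypothesis recA : reciprocal A.
Hypothesis kA : kippenhahn_factor (xi A) f g h (b0 ^+ 2) (b ^+ 2).
Hypothesis b0_ge0 : 0 <= b0.
Hypothesis b_ge0 : 0 <= b.

Lemma eigenvalues_rotated (t : R) :
  perm_eq (eigenvalues (rotated_re A t)) (kippenhahn_roots f g h (b0 ^+ 2) (b ^+ 2) (cos t)).
Proof.
apply: eigenvaluesE; rewrite /rotated_re -expi_conj -/(re_mx A (expi t)).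
by rewrite (char_poly_re_mx recA kA (expi_unit t)) kippenhahn_roots_poly ?sqr_ge0.
Qed.

Lemma real_complexN (x : R) : - x%:C = (- x)%:C.
Proof. by apply/eqP; rewrite eq_complex /= oppr0 !eqxx. Qed.

Lemma kippenhahn_ellipses_exist : 0 < f + g ->
  exists E0 E : ellipse R, kippenhahn_ellipses A f g h E0 E.
Proof.
move=> fg; exists (Ellipse h%:C (- h%:C) b0_ge0), (Ellipse f%:C g%:C b_ge0).
split=> //.
- by rewrite /Defs.center /= subrr mul0r.
- exists ((f + g) / 2); first by rewrite divr_gt0.
  by rewrite /Defs.center /= rmorphM rmorphD fmorphV rmorph_nat.
move=> t _.
set E0 := Ellipse _ _ b0_ge0; set E := Ellipse _ _ b_ge0.
have [s1 [s2 [t0 p0]]] := @tangent_pair_exists _ E0 h (- h) erefl (real_complexN _) t.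
have [s3 [s4 [t1 p1]]] := @tangent_pair_exists _ E f g erefl erefl t.
have [s5 [s6 [t2 p2]]] := @tangent_pair_exists _ (opp_ellipse E) (- f) (- g) (real_complexN
  _) (real_complexN _) t.
exists [:: (line t s1, line t s2); (line t s3, line t s4); (line t s5, line t s6)]; split.
  by do 3 (apply: List.Forall2_cons => //).
rewrite /= -[X in perm_eq _ X]/[seq line t s | s <- [:: s1; s2; s3; s4; s5; s6]].
apply: perm_map; apply: perm_trans (eigenvalues_rotated t) _; rewrite perm_sym.
rewrite (_ : [:: s1; s2; s3; s4; s5; s6] = [:: s1; s2] ++ [:: s3; s4] ++ [:: s5; s6]) //.
apply: perm_trans (perm_cat p0 (perm_cat p1 p2)) _.
rewrite /kippenhahn_roots /=.
have -> : (h - - h) / 2 = h by field.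
have -> : (- f - - g) / 2 = - ((f - g) / 2) by field.
have -> : (- f - g) / 2 * cos t = - ((f + g) / 2 * cos t) by field.
by rewrite subrr mul0r mul0r add0r sub0r half_widthN.
Qed.

Lemma set2_eq (T : Type) (x y u v : T) : [set x; y] = [set u; v] ->
  (x = u /\ y = v) \/ (x = v /\ y = u).
Proof.
move=> e.
have xe : [set u; v] x by rewrite -e; left.
have ye : [set u; v] y by rewrite -e; right.
have ue : [set x; y] u by rewrite e; left.
have ve : [set x; y] v by rewrite e; right.
by case: xe ye ue ve => /= -> [] -> [] ? [] ?; [left|left|right|right|..]; subst; auto.
Qed.

(** The foci are prescribed up to order, so the semiminor axes remain. The angle pi / 2 determines
    them: the eigenvalues there are b0, b, b and their negatives. *)
Lemma kippenhahn_ellipses_unique (E0 E : ellipse R) :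
  kippenhahn_ellipses A f g h E0 E ->
  [/\ semiminor E0 = b0, semiminor E = b,
      (focus1 E0 = h%:C /\ focus2 E0 = (- h)%:C) \/
      (focus1 E0 = (- h)%:C /\ focus2 E0 = h%:C) &
      (focus1 E = f%:C /\ focus2 E = g%:C) \/
      (focus1 E = g%:C /\ focus2 E = f%:C)].
Proof.
move=> [[_ fE0] _ fE hK].
have F0 := set2_eq fE0; rewrite -rmorphN in F0.
have F1 := set2_eq fE.
have t2 : 0 <= (pi / 2 : R) < 2 * pi.
  have p0 := pi_gt0 R; apply/andP; split; lra.
have [Ls [hF hp]] := hK _ t2.
have [L0 [L1 [L2 [LsE [h0 [h1 h2]]]]]] : exists L0 L1 L2, Ls = [:: L0; L1; L2] /\
    tangent_pair (pi / 2) E0 L0 /\ tangent_pair (pi / 2) E L1 /\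
    tangent_pair (pi / 2) (opp_ellipse E) L2.
  inversion hF as [|? L0 ? Ls1 h0 hF1]; subst.
  inversion hF1 as [|? L1 ? Ls2 h1 hF2]; subst.
  inversion hF2 as [|? L2 ? Ls3 h2 hF3]; subst.
  inversion hF3; subst.
  by exists L0, L1, L2.
have v0 : perm_eq [:: L0.1; L0.2] [:: line (pi / 2) (semiminor E0); line (pi / 2) (-
  semiminor E0)].
  by case: F0 => -[e1 e2]; exact: tangent_pair_vertical e1 e2 _ h0.
have v1 : perm_eq [:: L1.1; L1.2] [:: line (pi / 2) (semiminor E); line (pi / 2) (-
  semiminor E)].
  by case: F1 => -[e1 e2]; exact: tangent_pair_vertical e1 e2 _ h1.
have v2 : perm_eq [:: L2.1; L2.2] [:: line (pi / 2) (semiminor E); line (pi / 2) (-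
  semiminor E)].
  have fo (z : C) (s : R) : z = s%:C -> - z = (- s)%:C by move=> ->; rewrite rmorphN.
  by case: F1 => -[e1 e2]; exact: (@tangent_pair_vertical _ (opp_ellipse E) _ _ (fo _ _ e1)
    (fo _ _ e2) _ h2).
move: hp; rewrite LsE /= -[X in perm_eq _ X]/([:: L0.1; L0.2] ++ [:: L1.1; L1.2] ++ [::
  L2.1; L2.2]).
move=> hp; have := perm_trans hp (perm_cat v0 (perm_cat v1 v2)).
move: (semiminor_ge0 E0) (semiminor_ge0 E); move: (semiminor E0) (semiminor E) => s0 s
  s0_ge0 s_ge0.
move=> {}hp.
have {hp} : perm_eq (kippenhahn_roots f g h (b0 ^+ 2) (b ^+ 2) (cos (pi / 2))) [:: s0; -
  s0; s; - s; s; - s].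
  have hE : perm_eq (eigenvalues (rotated_re A (pi / 2))) [:: s0; - s0; s; - s; s; - s].
    apply: (perm_map_inj (@line_inj _ (pi / 2))); exact: hp.
  by apply: perm_trans hE; rewrite perm_sym; exact: eigenvalues_rotated.
rewrite cos_pihalf /kippenhahn_roots /half_width expr0n !mulr0 !addr0 !sqrtr_sqr !ger0_norm
  // oppr0 !add0r.
move=> hp.
(* Membership in the list does not tell b0 from the doubled b; the sum of squares does. *)
have sum2 : b0 ^+ 2 + 2 * b ^+ 2 = s0 ^+ 2 + 2 * s ^+ 2.
  have : \sum_(x <- [:: b0; - b0; b; - b; b; - b]) x ^+ 2
    = \sum_(x <- [:: s0; - s0; s; - s; s; - s]) x ^+ 2 by exact: perm_big.
  by rewrite !big_cons !big_nil; lra.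
have m0 : s0 \in [:: b0; - b0; b; - b; b; - b] by rewrite (perm_mem hp) inE eqxx.
have m1 : s \in [:: b0; - b0; b; - b; b; - b] by rewrite (perm_mem hp) !inE eqxx !orbT.
have red x : 0 <= x -> x \in [:: b0; - b0; b; - b; b; - b] -> x = b0 \/ x = b.
  rewrite !inE => x0; case/orP=> [/eqP ->|]; first by left.
  case/orP=> [/eqP xE|]; first by left; move: b0_ge0 => ?; lra.
  case/orP=> [/eqP ->|]; first by right.
  case/orP=> [/eqP xE|]; first by right; move: b_ge0 => ?; lra.
  case/orP=> [/eqP ->|/eqP xE]; first by right.
  by right; move: b_ge0 => ?; lra.
have [e0 e1] : s0 = b0 /\ s = b.
  have sq x y : 0 <= x -> 0 <= y -> x ^+ 2 = y ^+ 2 -> x = y.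
    by move=> x0 y0 /eqP; rewrite eqrXn2 // => /eqP.
  case: (red _ s0_ge0 m0) (red _ s_ge0 m1) => e0 [] e1; subst; split=> //; apply: sq => //; lra.
by split.
Qed.

End Kippenhahn.

(** * Rank-k numerical ranges with positive parameters *)

Section Ranges.
Local Open Scope sesquilinear_scope.
Variable R : realType.
Local Notation C := R[i].
Local Notation "x %:C" := (real_complex R x) (format "x %:C") : ring_scope.

Lemma count_sorted6 (m s1 s2 s3 s4 s5 s6 : R) (l : seq R) :
  perm_eq l [:: s1; s2; s3; s4; s5; s6] ->
  s2 <= s1 -> s3 <= s2 -> s4 <= s3 -> s5 <= s4 -> s6 <= s5 ->
  [/\ (1 <= count (>= m)%R l)%N = (m <= s1), (2 <= count (>= m)%R l)%N = (m <= s2) &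
      (3 <= count (>= m)%R l)%N = (m <= s3)].
Proof.
move=> /permP -> h2 h3 h4 h5 h6 /=.
split.
- case: (lerP m s1) => [//|m1]; rewrite !leNgt.
  have -> : s2 < m by lra. have -> : s3 < m by lra. have -> : s4 < m by lra.
  have -> : s5 < m by lra. by have -> : s6 < m by lra.
- case: (lerP m s2) => [m2|m2]; first by have -> : m <= s1 by lra.
  rewrite !(leNgt m).
  have -> : s3 < m by lra. have -> : s4 < m by lra.
  have -> : s5 < m by lra. have -> : s6 < m by lra.
  by case: (s1 < m).
- case: (lerP m s3) => [m3|m3].
    have -> : m <= s1 by lra. by have -> : m <= s2 by lra.
  rewrite !(leNgt m).
  have -> : s4 < m by lra. have -> : s5 < m by lra. have -> : s6 < m by lra.
  by case: (s1 < m); case: (s2 < m).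
Qed.

Lemma exists_unit_perp (z : C) : exists w : C, w * w^* = 1 /\ complex.Re (w * z) = 0.
Proof.
have [->|z0] := eqVneq z 0; first by exists 1; rewrite rmorph1 mulr1 mulr0.
have nz : Normc.normc z != 0 by apply: contra z0 => /eqP/Normc.eq0_normc ->.
have nz2 : complex.Re z ^+ 2 + complex.Im z ^+ 2 = Normc.normc z ^+ 2 by rewrite normcX2.
exists (Complex (complex.Im z / Normc.normc z) (complex.Re z / Normc.normc z)).
rewrite unitcP Re_mulc /=; split.
  by rewrite !expr_div_n -mulrDl addrC nz2 divff // expf_neq0.
by field.
Qed.

Lemma unitcN (w : C) : w * w^* = 1 -> (- w) * (- w)^* = 1.
Proof. by move=> w1; rewrite rmorphN mulrNN. Qed.

Lemma ReN (z : C) : complex.Re (- z) = - complex.Re z.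
Proof. by case: z. Qed.

Lemma half_planes_abs (s : R -> R) (z w : C) : (forall x, s (- x) = s x) ->
  half_planes s z -> w * w^* = 1 -> `|complex.Re (w * z)| <= s (complex.Re w).
Proof.
move=> sN hz w1; rewrite ler_norml hz // andbT.
have := hz _ (unitcN w1); rewrite mulNr !ReN sN; lra.
Qed.

Variables (A : 'M[C]_6) (f g h c0 c : R).
Hypothesis recA : reciprocal A.
Hypothesis kA : kippenhahn_factor (xi A) f g h c0 c.
Hypothesis c0_ge0 : 0 <= c0.
Hypothesis c_ge0 : 0 <= c.

Local Notation p := ((f + g) / 2).
Local Notation r := (half_width c ((f - g) / 2)).
Local Notation r0 := (half_width c0 h).

Hypothesis p_ge0 : 0 <= p.

(** Written with |x|, the list can be put in decreasing order uniformly in the sign of x, as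
    [count_sorted6] requires. *)
Lemma kippenhahn_roots_perm (x : R) :
  perm_eq (kippenhahn_roots f g h c0 c x)
    [:: p * `|x| + r x; r x - p * `|x|; r0 x; - r0 x; p * `|x| - r x; - (p * `|x|) - r x].
Proof.
have perm6 (u v a1 a2 a3 a4 : R) :
    perm_eq [:: u; v; a1; a2; a3; a4] [:: a1; a3; u; v; a2; a4] /\
    perm_eq [:: u; v; a1; a2; a3; a4] [:: a3; a1; u; v; a4; a2].
  by split; apply/permP => a /=;
    move: (a u) (a v) (a a1) (a a2) (a a3) (a a4) => [] [] [] [] [] [].
rewrite /kippenhahn_roots; case: (ger0P x) => _.
  by rewrite [r x - _]addrC; exact: (perm6 _ _ _ _ _ _).1.
by rewrite mulrN opprK [r x + _]addrC; exact: (perm6 _ _ _ _ _ _).2.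
Qed.

Lemma closure_rank_range k mu :
  (forall t, 0 < t < 1 -> rank_numerical_range k A (t%:C * mu)) ->
  rank_numerical_range k A mu.
Proof.
move=> hmu; apply/rank_numerical_rangeP.
(* Starting at n + 2 keeps t n strictly between 0 and 1. *)
pose t (n : nat) : R := 1 - (n.+2%:R)^-1.
apply: (@frame_limit _ k 6 A mu (fun=> A) (fun n => (t n)%:C * mu) (Normc.normc mu)).
- by move=> n i j; rewrite subrr Normc.normc0 divr_ge0 ?normc_ge0 ?ler0n.
- move=> n; have -> : (t n)%:C * mu - mu = (- (n.+2%:R)^-1)%:C * mu.
    by rewrite -[X in _ - X]mul1r -mulrBl -[1 in LHS](rmorph1 (real_complex R)) -rmorphB /t
      addrAC subrr add0r.
  rewrite Normc.normcM mulrC ler_wpM2l ?normc_ge0 //= expr0n addr0 sqrtr_sqr normrN.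
  rewrite ger0_norm ?invr_ge0 ?ler0n // lef_pV2 ?posrE ?ltr0n // ler_nat //.
- move=> n; apply/rank_numerical_rangeP/hmu; rewrite /t subr_gt0 ltrBlDr ltrDl invr_gt0
  ltr0n andbT.
  by rewrite invf_lt1 ?ltr0n // ltr1n.
Qed.

Hypothesis fg_le0 : f * g <= 0.

Lemma center_sqr x : r x ^+ 2 = (p * `|x|) ^+ 2 + (c + - (f * g) * x ^+ 2).
Proof.
have -> : (p * `|x|) ^+ 2 = p ^+ 2 * x ^+ 2 by rewrite exprMn real_normK ?num_real.
by rewrite half_width_sqr //; field.
Qed.

(** f g <= 0 places 0 between the foci, hence in the convex hulls of E and of -E. *)
Lemma center_le x : p * `|x| <= r x.
Proof.
have px : 0 <= p * `|x| by rewrite mulr_ge0.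
rewrite -ler_sqr ?nnegrE ?px ?half_width_ge0 // center_sqr lerDl.
by rewrite addr_ge0 // mulr_ge0 ?oppr_ge0 ?sqr_ge0.
Qed.

(* Support functions of the rank-[k] numerical ranges when [E0] encloses
   [E] and [-E]. *)
Definition large_bound (k : nat) (x : R) : R :=
  if k is 1%N then r0 x else if k is 2 then p * `|x| + r x else r x - p * `|x|.

Lemma large_nonneg k mu : (forall x, p * `|x| + r x <= r0 x) -> (1 <= k <= 3)%N ->
  nonneg_dim (A - mu%:M) k <-> half_planes (large_bound k) mu.
Proof.
move=> order k13; rewrite (nonneg_dimP recA kA) //.
have key (m x : R) : (k <= count (>= m)%R (kippenhahn_roots f g h c0 c x))%N = (m <=
  large_bound k x).
  have h0 := half_width_ge0 c ((f - g) / 2) x; have h1 := order x.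
  have h2 : 0 <= p * `|x| by rewrite mulr_ge0.
  have h3 := center_le x.
  have pm := kippenhahn_roots_perm x.
  have perm6 (u1 u2 u3 u4 u5 u6 : R) : perm_eq [:: u1; u2; u3; u4; u5; u6] [:: u3; u1; u2;
    u5; u6; u4].
    apply/permP => a /=.
    by move: (a u1) (a u2) (a u3) (a u4) (a u5) (a u6) => [] [] [] [] [] [].
  have [||||||e1 e2 e3] := @count_sorted6 m (r0 x) (p * `|x| + r x) (r x - p * `|x|)
    (p * `|x| - r x) (- (p * `|x|) - r x) (- r0 x) (kippenhahn_roots f g h c0 c x); try lra.
    exact: perm_trans pm (perm6 _ _ _ _ _ _).
  by case: k k13 => [|[|[|[|k]]]] //.
by split=> hw w w1; have := hw w w1; rewrite key.
Qed.

(* Support functions of the rank-[k] numerical ranges when [E0] lies in the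
   intersection of [conv E] and [conv (-E)]. *)
Definition small_bound (k : nat) (x : R) : R :=
  if k is 1%N then p * `|x| + r x else if k is 2 then r x - p * `|x| else r0 x.

Lemma small_nonneg k mu : (forall x, p * `|x| + r0 x <= r x) -> (1 <= k <= 3)%N ->
  nonneg_dim (A - mu%:M) k <-> half_planes (small_bound k) mu.
Proof.
move=> order k13; rewrite (nonneg_dimP recA kA) //.
have key (m x : R) : (k <= count (>= m)%R (kippenhahn_roots f g h c0 c x))%N = (m <=
  small_bound k x).
  have h0 := half_width_ge0 c0 h x; have h1 := order x.
  have h2 : 0 <= p * `|x| by rewrite mulr_ge0.
  have [|||||e1 e2 e3] := count_sorted6 m (kippenhahn_roots_perm x); try lra.
  by case: k k13 => [|[|[|[|k]]]] //.
by split=> hw w w1; have := hw w w1; rewrite key.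
Qed.

Section Positive.
Hypothesis c_gt0 : 0 < c.

Let pr x : p * `|x| < r x.
Proof.
have px : 0 <= p * `|x| by rewrite mulr_ge0.
rewrite -ltr_sqr ?nnegrE ?px ?half_width_ge0 // center_sqr ltrDl.
by rewrite ltr_wpDr // mulr_ge0 ?oppr_ge0 ?sqr_ge0.
Qed.

Let ReZt (t : R) (w z : C) : complex.Re (w * (t%:C * z)) = t * complex.Re (w * z).
Proof. by rewrite mulrCA ReZ. Qed.

(** Completing the square at the center: with m - q the signed distance of the line from the center,
    the focal product is (m - q)^2 - ((u - v) / 2)^2 x^2, which is below c when |m - q| is below the
    half width. *)
Let scale_conic u v z (w : C) : (u + v = f + g \/ u + v = - (f + g)) -> u * v = f * g ->
  `|complex.Re (w * z)| + p * `|complex.Re w| < r (complex.Re w) ->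
  (complex.Re (w * z) - u * complex.Re w) * (complex.Re (w * z) - v * complex.Re w) < c.
Proof.
move=> uv fg; move: (complex.Re (w * z)) (complex.Re w) => m x hm.
have [q [qE qn]] : exists q, q = (u + v) / 2 * x /\ `|q| = p * `|x|.
  exists ((u + v) / 2 * x); split=> //; rewrite normrM; congr (_ * _).
  by case: uv => ->; rewrite ?mulNr ?normrN ger0_norm.
have : (m - q) ^+ 2 < c + ((f - g) / 2) ^+ 2 * x ^+ 2.
  rewrite -half_width_sqr // -real_normK ?num_real // ltr_sqr ?nnegrE ?half_width_ge0 //.
  by apply: le_lt_trans hm; rewrite -qn; exact: ler_normB.
have -> : (m - u * x) * (m - v * x) = (m - q) ^+ 2 - (((u + v) / 2) ^+ 2 - u * v) * x ^+ 2.
  by rewrite qE; field.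
have -> : ((u + v) / 2) ^+ 2 = p ^+ 2 by case: uv => ->; rewrite ?mulNr ?sqrrN.
have -> : p ^+ 2 - u * v = ((f - g) / 2) ^+ 2 by rewrite fg; field.
by lra.
Qed.

Let regular_pm mu : (forall w, w * w^* = 1 ->
    `|complex.Re (w * mu)| + p * `|complex.Re w| < r (complex.Re w)) ->
  regular_quad (conic mu f g c) /\ regular_quad (conic mu (- f) (- g) c).
Proof.
move=> hm; split; apply: regular_conic => w w1; apply: scale_conic; try exact: hm.
- by left.
- by [].
- by right; rewrite opprD.
- by rewrite mulrNN.
Qed.

Section Small.
Hypothesis order : forall x, p * `|x| + r0 x <= r x.
Hypothesis h_neq0 : h != 0.

Lemma small_range3 mu : half_planes (small_bound 3) mu -> rank_numerical_range 3 A mu.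
Proof.
move=> hmu; apply: closure_rank_range => t /andP[t0 t1].
have ab w : w * w^* = 1 -> `|complex.Re (w * mu)| <= r0 (complex.Re w).
  by move=> w1; apply: (half_planes_abs (s := r0)) => // x; exact: half_width_opp.
have nn : nonneg_dim (A - (t%:C * mu)%:M) 3.
  apply/small_nonneg => // w w1; rewrite ReZt /=.
  have := ab w w1; have := half_width_ge0 c0 h (complex.Re w).
  by have := ler_norm (complex.Re (w * mu)); nra.
have [qp qm] : regular_quad (conic (t%:C * mu) f g c) /\ regular_quad (conic (t%:C * mu) (-
  f) (- g) c).
  apply: regular_pm => w w1; rewrite ReZt normrM (gtr0_norm t0).
  have := ab w w1; have := order (complex.Re w); have := pr (complex.Re w).
  by have := mulr_ge0 p_ge0 (normr_ge0 (complex.Re w)); nra.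
(* Tested at w = 1, where h != 0 gives c0 + h^2 > 0; with t < 1 the inequality is strict even when
   E0 is a pair of foci. *)
have q0 : conic (t%:C * mu) h (- h) c0 != 0.
  apply: (@conic_neq0 _ _ _ _ _ 1); first by rewrite rmorph1 mulr1.
  have w1 : (1 : C) * 1^* = 1 by rewrite rmorph1 mulr1.
  have := ab 1 w1; rewrite ReZt; move: (complex.Re (1 * mu)) => m /=.
  have r2 := half_width_sqr h 1 c0_ge0; rewrite expr1n mulr1 in r2.
  rewrite -ler_sqr ?nnegrE ?half_width_ge0 // real_normK ?num_real // r2 => m2.
  have h2 : 0 < h ^+ 2 by rewrite lt_neqAle eq_sym sqrf_eq0 h_neq0 sqr_ge0.
  rewrite lt_eqF //.
  have -> : (t * m - h * 1) * (t * m - - h * 1) = t ^+ 2 * m ^+ 2 - h ^+ 2 by ring.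
  have m0 := sqr_ge0 m; have tt : t ^+ 2 < 1 by rewrite expr_lt1 // ltW.
  have t20 : 0 < t ^+ 2 by rewrite exprn_gt0.
  have e1 : 0 <= t ^+ 2 * (c0 + h ^+ 2 - m ^+ 2) by apply: mulr_ge0; [exact: ltW | rewrite
    subr_ge0].
  have e2 : 0 < (1 - t ^+ 2) * (c0 + h ^+ 2) by apply: mulr_gt0; [rewrite subr_gt0 | apply:
    ltr_wpDl].
  by move: e1 e2; rewrite !mulrBr !mulrBl; lra.
apply: (@rank_range_quads _ A (t%:C * mu) [:: conic (t%:C * mu) f g c; conic (t%:C * mu) (-
  f) (- g) c] (conic (t%:C * mu) h (- h) c0)) => //.
  by move=> q; rewrite !inE => /orP[] /eqP ->.
by rewrite (pencil_conics recA kA) big_cons big_seq1 mulrC.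
Qed.

Lemma small_range2 mu : half_planes (small_bound 2) mu -> rank_numerical_range 2 A mu.
Proof.
move=> hmu; apply: closure_rank_range => t /andP[t0 t1].
have ab w : w * w^* = 1 -> `|complex.Re (w * mu)| <= r (complex.Re w) - p * `|complex.Re w|.
  move=> w1; apply: (half_planes_abs (s := small_bound 2)) => // x.
  by rewrite /= half_width_opp normrN.
have nn : nonneg_dim (A - (t%:C * mu)%:M) 2.
  apply/small_nonneg => // w w1; rewrite ReZt /=.
  have := ab w w1; have := pr (complex.Re w).
  by have := ler_norm (complex.Re (w * mu)); nra.
have [qp qm] : regular_quad (conic (t%:C * mu) f g c) /\ regular_quad (conic (t%:C * mu) (-
  f) (- g) c).
  apply: regular_pm => w w1; rewrite ReZt normrM (gtr0_norm t0).
  have := ab w w1; have := pr (complex.Re w).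
  by have := mulr_ge0 p_ge0 (normr_ge0 (complex.Re w)); nra.
(* The pencil vanishes identically when [E0] is a pair of foci and [t mu] is one
   of them; then [t mu] even lies in the rank-3 range. *)
have [q0|q0] := eqVneq (conic (t%:C * mu) h (- h) c0) 0.
  apply: (@rank_range_le _ _ 3) => //; apply: small_range3 => w w1.
  apply: le_trans (ler_norm _) _.
  rewrite -ler_sqr ?nnegrE ?half_width_ge0 // real_normK ?num_real // half_width_sqr //.
  rewrite leNgt; apply/negP => hlt; move/eqP: q0; apply/negP.
  apply: (conic_neq0 w1); rewrite gt_eqF //.
  move: hlt; move: (complex.Re (w * _)) (complex.Re w) => m x hlt.
  have -> : (m - h * x) * (m - - h * x) = m ^+ 2 - h ^+ 2 * x ^+ 2 by ring.
  by lra.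
apply: (@rank_range_quads _ A (t%:C * mu) [:: conic (t%:C * mu) f g c]
  (conic (t%:C * mu) h (- h) c0 * conic (t%:C * mu) (- f) (- g) c)) => //.
- by move=> q; rewrite !inE => /eqP ->.
- have qm0 : conic (t%:C * mu) (- f) (- g) c != 0.
    by apply: contraTneq isT => qm0; have := qm.2 1; rewrite qm0 horner0 eqxx rmorph1 mulr1
      => /(_ erefl).
  exact: mulf_neq0.
- rewrite (pencil_conics recA kA) big_seq1; ring.
Qed.

Lemma small_range k mu : (1 <= k <= 3)%N ->
  half_planes (small_bound k) mu -> rank_numerical_range k A mu.
Proof.
case: k => [|[|[|[|k]]]] // _.
- by move=> hmu; apply: rank_range1; apply/small_nonneg.
- exact: small_range2.
- exact: small_range3.
Qed.

End Small.

Section Large.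
Hypothesis order : forall x, p * `|x| + r x < r0 x.
Hypothesis c0_gt0 : 0 < c0.

Let order' x : p * `|x| + r x <= r0 x := ltW (order x).

Lemma large_range3 mu : half_planes (large_bound 3) mu -> rank_numerical_range 3 A mu.
Proof.
move=> hmu; apply: closure_rank_range => t /andP[t0 t1].
have ab w : w * w^* = 1 -> `|complex.Re (w * mu)| <= r (complex.Re w) - p * `|complex.Re w|.
  move=> w1; apply: (half_planes_abs (s := large_bound 3)) => // x.
  by rewrite /= half_width_opp normrN.
have nn : nonneg_dim (A - (t%:C * mu)%:M) 3.
  apply/large_nonneg => // w w1; rewrite ReZt /=.
  have := ab w w1; have := pr (complex.Re w).
  by have := ler_norm (complex.Re (w * mu)); nra.
have [qp qm] : regular_quad (conic (t%:C * mu) f g c) /\ regular_quad (conic (t%:C * mu) (-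
  f) (- g) c).
  apply: regular_pm => w w1; rewrite ReZt normrM (gtr0_norm t0).
  have := ab w w1; have := pr (complex.Re w).
  by have := mulr_ge0 p_ge0 (normr_ge0 (complex.Re w)); nra.
(* The line through t mu and the center 0 of E0 has focal product - h^2 x^2 <= 0 < c0. *)
have q0 : conic (t%:C * mu) h (- h) c0 != 0.
  have [w [w1 w0]] := exists_unit_perp (t%:C * mu).
  apply: (conic_neq0 w1); rewrite w0 lt_eqF //.
  apply: le_lt_trans c0_gt0; have := mulr_ge0 (sqr_ge0 h) (sqr_ge0 (complex.Re w)).
  move: (complex.Re w) => x hx.
  have -> : (0 - h * x) * (0 - - h * x) = - (h ^+ 2 * x ^+ 2) by ring.
  by lra.
apply: (@rank_range_quads _ A (t%:C * mu) [:: conic (t%:C * mu) f g c; conic (t%:C * mu) (-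
  f) (- g) c] (conic (t%:C * mu) h (- h) c0)) => //.
  by move=> q; rewrite !inE => /orP[] /eqP ->.
by rewrite (pencil_conics recA kA) big_cons big_seq1 mulrC.
Qed.

(** With respect to a line through mu and the center the foci are on opposite sides or on the line,
    so the focal product is at most 0 < c. *)
Let conic_pm_neq0 mu u v : u + v = f + g \/ u + v = - (f + g) -> u * v = f * g ->
  conic mu u v c != 0.
Proof.
move=> uv fg; have [w [w1 w0]] := exists_unit_perp (mu - ((u + v) / 2)%:C).
apply: (conic_neq0 w1); rewrite lt_eqF //.
have wm : complex.Re (w * mu) = (u + v) / 2 * complex.Re w.
  by move: w0; rewrite mulrBr; case: (w) (mu) => [? ?] [? ?] /=; lra.
rewrite wm; move: (complex.Re w) => x.
have -> : ((u + v) / 2 * x - u * x) * ((u + v) / 2 * x - v * x) = - (((u - v) / 2) ^+ 2 * x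
  ^+ 2) by field.
by apply: le_lt_trans c_gt0; rewrite oppr_le0 mulr_ge0 ?sqr_ge0.
Qed.

(** The strict order puts the hull of E and -E strictly inside E0, so mu is treated directly. The
    factor of E0 is the one to spend, as mu may lie outside E or -E. *)
Lemma large_range2 mu : half_planes (large_bound 2) mu -> rank_numerical_range 2 A mu.
Proof.
move=> hmu.
have ab w : w * w^* = 1 -> `|complex.Re (w * mu)| <= p * `|complex.Re w| + r (complex.Re w).
  move=> w1; apply: (half_planes_abs (s := large_bound 2)) => // x.
  by rewrite /= half_width_opp normrN.
have nn : nonneg_dim (A - mu%:M) 2 by apply/large_nonneg.
have q0 : regular_quad (conic mu h (- h) c0).
  apply: regular_conic => w w1.
  have := le_lt_trans (ab w w1) (order (complex.Re w)).
  rewrite -ltr_sqr ?nnegrE ?half_width_ge0 // real_normK ?num_real // half_width_sqr //.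
  move: (complex.Re (w * _)) (complex.Re w) => m x hm.
  have -> : (m - h * x) * (m - - h * x) = m ^+ 2 - h ^+ 2 * x ^+ 2 by ring.
  by lra.
apply: (@rank_range_quads _ A mu [:: conic mu h (- h) c0] (conic mu f g c * conic mu (- f)
  (- g) c)) => //.
- by move=> q; rewrite !inE => /eqP ->.
- apply: mulf_neq0; apply: conic_pm_neq0; rewrite ?mulrNN //; first by left.
  by right; rewrite opprD.
- by rewrite (pencil_conics recA kA) big_seq1.
Qed.

Lemma large_range k mu : (1 <= k <= 3)%N ->
  half_planes (large_bound k) mu -> rank_numerical_range k A mu.
Proof.
case: k => [|[|[|[|k]]]] // _.
- by move=> hmu; apply: rank_range1; apply/large_nonneg.
- exact: large_range2.
- exact: large_range3.
Qed.

End Large.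
End Positive.
End Ranges.

(** * Vanishing parameters *)

Section Perturbation.
Local Open Scope sesquilinear_scope.
Variable R : realType.
Local Notation C := R[i].
Local Notation "x %:C" := (real_complex R x) (format "x %:C") : ring_scope.

Lemma normc_real (x : R) : Normc.normc x%:C = `|x|.
Proof. by rewrite /= expr0n addr0 sqrtr_sqr. Qed.

(** The positive solution s of s - 1 / s = 2 sqrt k e, so that (s - 1 / s)^2 / 4 = k e^2. *)
Definition stretch (k e : R) : R := Num.sqrt k * e + Num.sqrt (1 + k * e ^+ 2).

Lemma stretchP (k e : R) : 0 <= k -> 0 <= e ->
  [/\ 0 < stretch k e, stretch k e - (stretch k e)^-1 = 2 * (Num.sqrt k * e),
      `|stretch k e - 1| <= 2 * (Num.sqrt k * e) &
      `|(stretch k e)^-1 - 1| <= 2 * (Num.sqrt k * e)].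
Proof.
move=> k0 e0; rewrite /stretch.
have d0 : 0 <= 1 + k * e ^+ 2 by rewrite addr_ge0 // mulr_ge0 ?sqr_ge0.
have q2 := sqr_sqrtr d0; have u2 : (Num.sqrt k * e) ^+ 2 = k * e ^+ 2 by rewrite exprMn
  sqr_sqrtr.
have u0 : 0 <= Num.sqrt k * e by rewrite mulr_ge0 ?sqrtr_ge0.
have q0 := sqrtr_ge0 (1 + k * e ^+ 2).
move: (Num.sqrt (1 + _)) (Num.sqrt k * e) q2 u2 u0 q0 => q u q2 u2 u0 q0.
have q1 : 1 <= q.
  by rewrite -ler_sqr ?nnegrE // expr1n q2 -u2 lerDl sqr_ge0.
have s0 : 0 < u + q by lra.
have sV : (u + q)^-1 = q - u.
  apply: (mulfI (lt0r_neq0 s0)); rewrite mulfV ?gt_eqF //.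
  have -> : (u + q) * (q - u) = q ^+ 2 - u ^+ 2 by ring.
  by rewrite q2 u2; ring.
have sV1 : q - u <= 1 by rewrite -sV invf_le1 //; lra.
rewrite sV; split=> //; first by ring.
  by rewrite ger0_norm; lra.
by rewrite ler0_norm; lra.
Qed.

(* Multiplying [a_(j,j+1)] by [s] and dividing [a_(j+1,j)] by [s] raises
   [xi_j] from 0 to [(s - 1/s)^2 / 4]. *)
Lemma perturbation (A : 'M[C]_6) (k : nat -> R) :
  reciprocal A -> (forall j, (1 <= j <= 5)%N -> xi A j = 0) -> (forall j, 0 <= k j) ->
  exists (A_ : nat -> 'M[C]_6) (K : R),
    [/\ forall t, reciprocal (A_ t),
        forall t j, (1 <= j <= 5)%N -> xi (A_ t) j = k j * (t.+1%:R^-1) ^+ 2 &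
        forall t i j, Normc.normc (A_ t i j - A i j) <= K / t.+1%:R].
Proof.
move=> recA xiA k0.
pose s (t l : nat) := stretch (k l) (t.+1%:R^-1).
(* The scale of xi_j is attached to the larger of its two row numbers j - 1 and j; above the
   diagonal it multiplies, below it divides. *)
pose sc (t i j : nat) : R := if j == i.+1 then s t j else if i == j.+1 then (s t i)^-1 else 1.
have e0 (t : nat) : 0 <= t.+1%:R^-1 :> R by rewrite invr_ge0 ler0n.
have sP t l := stretchP (k0 l) (e0 t).
exists (fun t => \matrix_(i, j) (A i j * (sc t i j)%:C)), (2 * \sum_(l < 6) Num.sqrt (k l)).
(* xi_j = 0 makes the two moduli equal, and their product is 1. *)
have norm1 j : (1 <= j <= 5)%N ->
    Normc.normc (A (inord j.-1) (inord j)) = 1 /\ Normc.normc (A (inord j) (inord j.-1)) = 1.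
  case: j => // j /= j5.
  have := congr1 (@Normc.normc R) (reciprocal_mul recA j5); rewrite Normc.normcM Normc.normc1.
  have := xiA j.+1 j5; rewrite /xi /=.
  move: (normc_ge0 (A (inord j) (inord j.+1))) (normc_ge0 (A (inord j.+1) (inord j))).
  move: (Normc.normc (A (inord j) _)) (Normc.normc (A (inord j.+1) _)) => x y x0 y0 h xy.
  have xyE : x = y.
    apply/eqP; rewrite -subr_eq0 -sqrf_eq0; move: h => /eqP; rewrite mulf_eq0 invr_eq0.
    by rewrite (negPf (_ : (4 : R) != 0)) ?orbF // pnatr_eq0.
  move: xy; rewrite -{}xyE -expr2 => /eqP; rewrite sqrf_eq1 => /orP[] /eqP xE //.
  by split; lra.
have nsc t i j : (sc t i j * sc t j i) = 1 \/ (j != i.+1 /\ i != j.+1).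
  rewrite /sc; have [->|ji] := eqVneq j i.+1.
    have -> : (i == i.+2) = false by apply: ltn_eqF.
    left; rewrite mulfV // gt_eqF //; by have [] := sP t i.+1.
  have [->|ij] := eqVneq i j.+1; last by right.
  left; rewrite mulVf // gt_eqF //; by have [] := sP t j.+1.
split.
- move=> t; split=> [i j ij ji|i j ji].
    by rewrite mxE reciprocal_far // mul0r.
  rewrite !mxE mulrACA recA.2 // mul1r -rmorphM /=.
  case: (nsc t i j) => [->//|[]]; by rewrite ji eqxx.
- move=> t j j15; have [n1 n2] := norm1 j j15.
  case: j j15 n1 n2 => // j j5 n1 n2; rewrite /= in n1 n2 *.
  have j5' : (j < 5)%N by [].
  have jE : (j == j.+2) = false by apply: ltn_eqF.
  rewrite /xi !mxE !Normc.normcM !normc_real /= n1 n2 /sc !inordK ?(ltn_trans j5') // eqxx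
    jE !mul1r.
  have [s0 sV _ _] := sP t j.+1.
  rewrite ger0_norm ?ltW // ger0_norm ?invr_ge0 ?ltW // sV exprMn exprMn sqr_sqrtr //.
  by field; rewrite addrC natr1 pnatr_eq0.
- move=> t i j; rewrite mxE -[X in _ - X]mulr1 -mulrBr Normc.normcM.
  have -> : Normc.normc ((sc t i j)%:C - 1) = `|sc t i j - 1|.
    by rewrite -[1 in LHS](rmorph1 (real_complex R)) -rmorphB normc_real.
  have sk (l : nat) : (l < 6)%N -> Num.sqrt (k l) <= \sum_(l < 6) Num.sqrt (k l).
    move=> l6; rewrite (bigD1 (Ordinal l6)) //= lerDl sumr_ge0 // => ? _; exact: sqrtr_ge0.
  have bnd (l : nat) : (l < 6)%N -> 2 * (Num.sqrt (k l) * t.+1%:R^-1) <= (2 * \sum_(l < 6)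
    Num.sqrt (k l)) / t.+1%:R.
    by move=> l6; rewrite -mulrA ler_pM2l // ler_wpM2r // sk.
  have S0 : 0 <= (2 * \sum_(l < 6) Num.sqrt (k l)) / t.+1%:R.
    by apply: le_trans (bnd 0%N _) => //; rewrite !mulr_ge0 ?sqrtr_ge0.
  rewrite /sc; have [ji|ji] := eqVneq (j : nat) i.+1.
    have j15 : (1 <= j <= 5)%N by have := ltn_ord j; rewrite ji.
    have [n1 _] := norm1 j j15.
    have -> : A i j = A (inord j.-1) (inord j) by rewrite inord_val ji /= inord_val.
    by rewrite n1 mul1r; have [_ _ h _] := sP t j; apply: le_trans h (bnd j _).
  have [ij|ij] := eqVneq (i : nat) j.+1.
    have i15 : (1 <= i <= 5)%N by have := ltn_ord i; rewrite ij.
    have [_ n1] := norm1 i i15.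
    have -> : A i j = A (inord i) (inord i.-1) by rewrite inord_val ij /= inord_val.
    by rewrite n1 mul1r; have [_ _ _ h] := sP t i; apply: le_trans h (bnd i _).
  by rewrite subrr normr0 mulr0.
Qed.

Lemma half_width_le (c d e x : R) : 0 <= c -> c <= d -> half_width c e x <= half_width d e x.
Proof. by move=> c0 cd; apply: ler_wsqrtr; rewrite lerD2r. Qed.

Section Pattern.
Variables (k : nat -> R) (f g h k0 k1 : R).
Hypothesis k_ge0 : forall j, 0 <= k j.
Hypothesis k0_ge0 : 0 <= k0.
Hypothesis k1_gt0 : 0 < k1.
Hypothesis kP : forall x, kippenhahn_factor (fun j => k j * x) f g h (k0 * x) (k1 * x).
Hypothesis p_ge0 : 0 <= (f + g) / 2.
Hypothesis fg_le0 : f * g <= 0.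

Lemma kippenhahn_factor_pattern (A : 'M[C]_6) x :
  (forall j, (1 <= j <= 5)%N -> xi A j = k j * x) ->
  kippenhahn_factor (xi A) f g h (k0 * x) (k1 * x).
Proof. by move=> hx L S T; rewrite !hx //; exact: kP. Qed.

(** The bounds at y dominate those at 0, so a point satisfying them at 0 lies in the range of every
    perturbed matrix; in the limit the matrix moves and the point stays. *)
Let limit_range (bound : R -> R -> R) l :
  (forall y x, 0 <= y -> bound 0 x <= bound y x) ->
  (forall (A : 'M[C]_6) y, reciprocal A -> 0 < y ->
     (forall j, (1 <= j <= 5)%N -> xi A j = k j * y) ->
     half_planes (bound y) `<=` rank_numerical_range l A) ->
  forall A : 'M[C]_6, reciprocal A -> (forall j, (1 <= j <= 5)%N -> xi A j = 0) ->
    half_planes (bound 0) `<=` rank_numerical_range l A.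
Proof.
move=> mono pos A recA xiA mu hmu; apply/rank_numerical_rangeP.
have [A_ [K [recA_ xiA_ cvA]]] := perturbation recA xiA k_ge0.
have K0 : 0 <= K.
  by have := le_trans (normc_ge0 _) (cvA 0%N 0 0); rewrite divr1.
apply: (@frame_limit _ l 6 A mu A_ (fun=> mu) K) => // t.
  by rewrite subrr Normc.normc0 divr_ge0 // ler0n.
apply/rank_numerical_rangeP; apply: (pos _ (t.+1%:R^-1 ^+ 2)) => //.
  by move=> j j15; exact: xiA_.
move=> w w1; apply: le_trans (hmu w w1) (mono _ _ _).
by rewrite sqr_ge0.
Qed.

Lemma small_pattern (A : 'M[C]_6) x l :
  h != 0 ->
  (forall y z, 0 <= y -> (f + g) / 2 * `|z| + half_width (k0 * y) h z
     <= half_width (k1 * y) ((f - g) / 2) z) ->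
  reciprocal A -> 0 <= x -> (forall j, (1 <= j <= 5)%N -> xi A j = k j * x) -> (1 <= l <=
    3)%N ->
  rank_numerical_range l A = half_planes (small_bound f g h (k0 * x) (k1 * x) l).
Proof.
move=> h0 order recA x0 hx l13.
have kA := kippenhahn_factor_pattern hx.
have k0x : 0 <= k0 * x by rewrite mulr_ge0.
have k1x : 0 <= k1 * x by rewrite mulr_ge0 // ltW.
apply/seteqP; split=> [mu /rank_range_nonneg|].
  by move/(small_nonneg recA kA k0x k1x p_ge0 mu (fun z => order x z x0) l13).
have [xp|xn] := ltP 0 x.
  move=> mu; apply: (small_range recA kA) => //; first by rewrite mulr_gt0.
  by move=> z; exact: order.
have x00 : x = 0 by apply/eqP; rewrite eq_le xn x0.
rewrite x00 in hx *.
apply: (@limit_range (fun y => small_bound f g h (k0 * y) (k1 * y) l)) => //.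
- move=> y z y0; rewrite !mulr0.
  have m0 := half_width_le h z (lexx 0) (mulr_ge0 k0_ge0 y0).
  have m1 := half_width_le ((f - g) / 2) z (lexx 0) (mulr_ge0 (ltW k1_gt0) y0).
  by case: l l13 => [|[|[|[|l]]]] //= _; lra.
- move=> B y recB y0 hy mu; apply: (small_range recB (kippenhahn_factor_pattern hy)) => //;
    by [rewrite mulr_ge0 // ltW | rewrite mulr_gt0 | move=> z; apply: order; exact: ltW].
- by move=> j j15; rewrite hx // mulr0.
Qed.

Lemma large_pattern (A : 'M[C]_6) x l :
  0 < k0 ->
  (forall y z, 0 <= y -> (f + g) / 2 * `|z| + half_width (k1 * y) ((f - g) / 2) z
     <= half_width (k0 * y) h z) ->
  (forall y z, 0 < y -> (f + g) / 2 * `|z| + half_width (k1 * y) ((f - g) / 2) z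
     < half_width (k0 * y) h z) ->
  reciprocal A -> 0 <= x -> (forall j, (1 <= j <= 5)%N -> xi A j = k j * x) -> (1 <= l <=
    3)%N ->
  rank_numerical_range l A = half_planes (large_bound f g h (k0 * x) (k1 * x) l).
Proof.
move=> k0_gt0 order orderS recA x0 hx l13.
have kA := kippenhahn_factor_pattern hx.
have k0x : 0 <= k0 * x by rewrite mulr_ge0.
have k1x : 0 <= k1 * x by rewrite mulr_ge0 // ltW.
apply/seteqP; split=> [mu /rank_range_nonneg|].
  by move/(large_nonneg recA kA k0x k1x p_ge0 fg_le0 mu (fun z => order x z x0) l13).
have [xp|xn] := ltP 0 x.
  move=> mu; apply: (large_range recA kA) => //; try by rewrite mulr_gt0.
  by move=> z; exact: orderS.
have x00 : x = 0 by apply/eqP; rewrite eq_le xn x0.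
rewrite x00 in hx *.
apply: (@limit_range (fun y => large_bound f g h (k0 * y) (k1 * y) l)) => //.
- move=> y z y0; rewrite !mulr0.
  have m0 := half_width_le h z (lexx 0) (mulr_ge0 k0_ge0 y0).
  have m1 := half_width_le ((f - g) / 2) z (lexx 0) (mulr_ge0 (ltW k1_gt0) y0).
  by case: l l13 => [|[|[|[|l]]]] //= _; lra.
- move=> B y recB y0 hy mu; apply: (large_range recB (kippenhahn_factor_pattern hy)) => //;
    by [rewrite mulr_ge0 // ltW | rewrite mulr_gt0 | move=> z; exact: orderS].
- by move=> j j15; rewrite hx // mulr0.
Qed.

End Pattern.
End Perturbation.

(** * Conclusion *)

Section Final.
Local Open Scope sesquilinear_scope.
Variable R : realType.
Local Notation C := R[i].
Local Notation "x %:C" := (real_complex R x) (format "x %:C") : ring_scope.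

Section Links.
Variables (E : ellipse R) (f g : R).
Hypothesis fE : (focus1 E = f%:C /\ focus2 E = g%:C) \/ (focus1 E = g%:C /\ focus2 E = f%:C).
Local Notation p := ((f + g) / 2).
Local Notation r := (half_width (semiminor E ^+ 2) ((f - g) / 2)).

Let swap_center : (g + f) / 2 = p. Proof. by rewrite addrC. Qed.
Let swap_width b x : half_width b ((g - f) / 2) x = half_width b ((f - g) / 2) x.
Proof. by rewrite -opprB mulNr half_widthN. Qed.

Lemma conv_points : conv (points E) = half_planes (fun x => p * x + r x).
Proof.
case: fE => -[e1 e2]; rewrite (conv_ellipse e1 e2) //; congr half_planes.
by apply/funext => x; rewrite swap_center swap_width.
Qed.

Lemma conv_points_opp : conv [set - z | z in points E] = half_planes (fun x => - p * x + r x).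
Proof.
have fo (z : C) (s : R) : z = s%:C -> - z = (- s)%:C by move=> ->; rewrite rmorphN.
rewrite -points_opp_ellipse.
have aux s t : focus1 E = s%:C -> focus2 E = t%:C ->
    conv (points (opp_ellipse E)) = half_planes (fun x => - ((s + t) / 2) * x + half_width
      (semiminor E ^+ 2) ((s - t) / 2) x).
  move=> e1 e2; rewrite (@conv_ellipse _ (opp_ellipse E) (- s) (- t) (fo _ _ e1) (fo _ _ e2)).
  congr half_planes; apply/funext => x /=.
  have -> : (- s + - t) / 2 = - ((s + t) / 2) by field.
  have -> : (- s - - t) / 2 = - ((s - t) / 2) by field.
  by rewrite half_widthN.
case: fE => -[e1 e2]; rewrite (aux _ _ e1 e2) //; congr half_planes.
by apply/funext => x; rewrite swap_center swap_width.
Qed.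

Lemma conv_points_union : 0 <= p -> conv (points E `|` [set - z | z in points E])
  = half_planes (fun x => p * `|x| + r x).
Proof.
move=> p0; case: fE => -[e1 e2]; rewrite (conv_ellipse_opp e1 e2) ?swap_center //; congr
  half_planes.
by apply/funext => x; rewrite swap_width.
Qed.

End Links.

Lemma half_planes_inter (p : R) (r : R -> R) : 0 <= p ->
  half_planes (fun x => r x - p * `|x|)
  = half_planes (fun x => p * x + r x) `&` half_planes (fun x => - p * x + r x).
Proof.
move=> p0; apply/seteqP; split=> [z hz|z [h1 h2] w w1].
  split=> w w1; have := hz w w1.
    have := ler_wpM2l p0 (ler_norm (- complex.Re w)); rewrite normrN; lra.
  have := ler_wpM2l p0 (ler_norm (complex.Re w)); lra.
have := h1 w w1; have := h2 w w1.
by case: (ger0P (complex.Re w)) => _; lra.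
Qed.

Section Assemble.
Variables (k : nat -> R) (f g h k0 k1 : R).
Hypothesis k_ge0 : forall j, 0 <= k j.
Hypothesis k0_ge0 : 0 <= k0.
Hypothesis k1_gt0 : 0 < k1.
Hypothesis kP : forall x, kippenhahn_factor (fun j => k j * x) f g h (k0 * x) (k1 * x).
Hypothesis fg_gt0 : 0 < f + g.
Hypothesis fg_le0 : f * g <= 0.
Variables (A : 'M[C]_6) (x : R).
Hypothesis recA : reciprocal A.
Hypothesis x_ge0 : 0 <= x.
Hypothesis xiA : forall j, (1 <= j <= 5)%N -> xi A j = k j * x.

Let p_ge0 : 0 <= (f + g) / 2. Proof. by rewrite divr_ge0 // ltW. Qed.

Let b0 := Num.sqrt (k0 * x).
Let b := Num.sqrt (k1 * x).
Let b0E : b0 ^+ 2 = k0 * x. Proof. by rewrite sqr_sqrtr // mulr_ge0. Qed.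
Let bE : b ^+ 2 = k1 * x. Proof. by rewrite sqr_sqrtr // mulr_ge0 // ltW. Qed.
Let kA : kippenhahn_factor (xi A) f g h (b0 ^+ 2) (b ^+ 2).
Proof. by rewrite b0E bE; exact: kippenhahn_factor_pattern kP _ _ xiA. Qed.

Lemma pattern_ellipses_exist : exists E0 E : ellipse R, kippenhahn_ellipses A f g h E0 E.
Proof. by apply: (kippenhahn_ellipses_exist recA kA); rewrite ?sqrtr_ge0. Qed.

Lemma pattern_ellipses (E0 E : ellipse R) : kippenhahn_ellipses A f g h E0 E ->
  [/\ conv (points E0) = half_planes (half_width (k0 * x) h),
      conv (points E `|` [set - z | z in points E])
       = half_planes (fun z => (f + g) / 2 * `|z| + half_width (k1 * x) ((f - g) / 2) z) &
      conv (points E) `&` conv [set - z | z in points E]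
       = half_planes (fun z => half_width (k1 * x) ((f - g) / 2) z - (f + g) / 2 * `|z|)].
Proof.
move=> hE.
have [e0 e1 F0 F1] := kippenhahn_ellipses_unique recA kA (sqrtr_ge0 _) (sqrtr_ge0 _) hE.
split.
- rewrite (conv_points F0) e0 b0E subrr mul0r; congr half_planes; apply/funext => z.
  by rewrite mul0r add0r; congr half_width; field.
- by rewrite (conv_points_union F1) // e1 bE.
- by rewrite (conv_points F1) (conv_points_opp F1) e1 bE half_planes_inter.
Qed.

Lemma small_conclusion : h != 0 ->
  (forall y z, 0 <= y -> (f + g) / 2 * `|z| + half_width (k0 * y) h z
     <= half_width (k1 * y) ((f - g) / 2) z) ->
  (exists E0 E : ellipse R, kippenhahn_ellipses A f g h E0 E) /\
  (forall E0 E : ellipse R, kippenhahn_ellipses A f g h E0 E ->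
    [/\ rank_numerical_range 1 A = conv (points E `|` [set - z | z in points E]),
        rank_numerical_range 2 A = conv (points E) `&` conv [set - z | z in points E] &
        rank_numerical_range 3 A = conv (points E0)]).
Proof.
move=> h0 order; split; first exact: pattern_ellipses_exist.
move=> E0 E /pattern_ellipses[-> -> ->].
by split; rewrite (small_pattern k_ge0 k0_ge0 k1_gt0 kP p_ge0 fg_le0 h0 order recA x_ge0 xiA).
Qed.

Lemma large_conclusion : 0 < k0 ->
  (forall y z, 0 <= y -> (f + g) / 2 * `|z| + half_width (k1 * y) ((f - g) / 2) z
     <= half_width (k0 * y) h z) ->
  (forall y z, 0 < y -> (f + g) / 2 * `|z| + half_width (k1 * y) ((f - g) / 2) z
     < half_width (k0 * y) h z) ->
  (exists E0 E : ellipse R, kippenhahn_ellipses A f g h E0 E) /\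
  (forall E0 E : ellipse R, kippenhahn_ellipses A f g h E0 E ->
    [/\ rank_numerical_range 1 A = conv (points E0),
        rank_numerical_range 2 A = conv (points E `|` [set - z | z in points E]) &
        rank_numerical_range 3 A = conv (points E) `&` conv [set - z | z in points E]]).
Proof.
move=> k0p order orderS; split; first exact: pattern_ellipses_exist.
move=> E0 E /pattern_ellipses[-> -> ->].
by split; rewrite (large_pattern k_ge0 k0_ge0 k1_gt0 kP p_ge0 fg_le0 k0p order orderS recA
  x_ge0 xiA).
Qed.

End Assemble.

(** * Cosines of the heptagon and the order of the ellipses *)

Section Heptagon.

Lemma heptagon : let a : R := 2 * cos (pi / 7) in
  let g : R := 2 * cos (2 * pi / 7) in let b : R := 2 * cos (3 * pi / 7) in
  [/\ a ^+ 3 = a ^+ 2 + 2 * a - 1, b = a ^+ 2 - a - 1, g = a ^+ 2 - 2,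
      0 < b & b < g].
Proof.
move=> a g b.
have p0 := pi_gt0 R.
pose x : R := pi / 7.
have x2 : 2 * pi / 7 = x + x by rewrite /x; field.
have x3 : 3 * pi / 7 = x + x + x by rewrite /x; field.
have x4 : x + x + (x + x) = pi - (x + x + x) by rewrite /x; field.
pose c := cos x.
have c2 : cos (x + x) = 2 * c ^+ 2 - 1.
  by rewrite cosD -!expr2 sin2cos2 /c; ring.
have c3 : cos (x + x + x) = 4 * c ^+ 3 - 3 * c.
  rewrite cosD c2 sinD.
  have -> : (sin x * cos x + cos x * sin x) * sin x = 2 * c * (sin x ^+ 2) by rewrite /c; ring.
  by rewrite sin2cos2 /c; ring.
have c4 : cos (x + x + (x + x)) = 8 * c ^+ 4 - 8 * c ^+ 2 + 1.
  rewrite cosD -!expr2 sin2cos2 c2; ring.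
have cpi : cos (x + x + (x + x)) = - cos (x + x + x).
  by rewrite x4 cosB cospi sinpi mul0r addr0 mulN1r.
have cp : 0 < c by rewrite cos_gt0_pihalf // /x; apply/andP; split; lra.
have b0 : 0 < cos (x + x + x) by rewrite cos_gt0_pihalf // /x; apply/andP; split; lra.
have gb : cos (x + x + x) < cos (x + x).
  rewrite ltr_cos ?in_itv /=; first by rewrite /x; lra.
    by rewrite /x; apply/andP; split; lra.
  by rewrite /x; apply/andP; split; lra.
(* From 4 x = pi - 3 x, the relation cos 4x = - cos 3x is a quartic in c whose root - 1 is excluded
   by c > 0. *)
have cubic : 8 * c ^+ 3 = 4 * c ^+ 2 + 4 * c - 1.
  have h : (c + 1) * (8 * c ^+ 3 - 4 * c ^+ 2 - 4 * c + 1) = 0.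
    have : 8 * c ^+ 4 - 8 * c ^+ 2 + 1 = - (4 * c ^+ 3 - 3 * c) by rewrite -c4 cpi c3.
    move=> h; apply/eqP; rewrite -subr_eq0; apply/eqP.
    have -> : (c + 1) * (8 * c ^+ 3 - 4 * c ^+ 2 - 4 * c + 1) - 0
      = (8 * c ^+ 4 - 8 * c ^+ 2 + 1) + (4 * c ^+ 3 - 3 * c) by ring.
    by rewrite h; ring.
  move/eqP: h; rewrite mulf_eq0 => /orP[] /eqP; lra.
rewrite /a /b /g x2 x3 -/x -/c c2 c3 in b0 gb *.
split; lra.
Qed.

End Heptagon.

Section Conditions.
Variables a g b : R.
Hypothesis a3 : a ^+ 3 = a ^+ 2 + 2 * a - 1.
Hypothesis bE : b = a ^+ 2 - a - 1.
Hypothesis gE : g = a ^+ 2 - 2.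
Hypothesis b_gt0 : 0 < b.
Hypothesis bg : b < g.

(** 0 < b and b < g single out the largest root of X^3 - X^2 - 2 X + 1. This cubic is - 1 / 125 at 9
    / 5 and positive at 37 / 20; dividing it by X - 9 / 5 and by X - 37 / 20 leaves quotients that
    are nonnegative at a, so the two values locate a. *)
Lemma heptagon_bounds : 9 / 5 < a < 37 / 20.
Proof.
have a1 : 1 < a by move: bg; rewrite bE gE; lra.
have a2 : 8 / 5 < a.
  rewrite ltNge; apply/negP => h.
  have := mulr_ge0 (ltW (lt_trans ltr01 a1)) (_ : 0 <= 8 / 5 - a).
  by rewrite subr_ge0 h => /(_ isT); move: b_gt0; rewrite bE; lra.
apply/andP; split; rewrite ltNge; apply/negP => h.
  have e : (a - 9 / 5) * (a ^+ 2 + 4 / 5 * a - 14 / 25) = a ^+ 3 - (a ^+ 2 + 2 * a - 1) + 1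
    / 125 by field.
  have s0 : 0 <= a ^+ 2 + 4 / 5 * a - 14 / 25 by have := sqr_ge0 a; lra.
  have := mulr_ge0 s0 (_ : 0 <= 9 / 5 - a); rewrite subr_ge0 h => /(_ isT).
  by move: e; rewrite a3; lra.
have e : (a - 37 / 20) * (a ^+ 2 + 17 / 20 * a - 171 / 400)
  = a ^+ 3 - (a ^+ 2 + 2 * a - 1) - (1 - 37 / 20 * (171 / 400)) by field.
have s0 : 0 <= a ^+ 2 + 17 / 20 * a - 171 / 400 by have := sqr_ge0 a; lra.
have := mulr_ge0 s0 (_ : 0 <= a - 37 / 20); rewrite subr_ge0 h => /(_ isT).
by move: e; rewrite a3; lra.
Qed.

Lemma heptagon_products :
  [/\ a * g = a ^+ 2 - 1, a * b = a - 1, g * b = 1 - b & b ^+ 2 = 2 - a].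
Proof. by split; rewrite ?bE ?gE; ring: a3. Qed.

(** E0 is a pair of foci, and at the level of foci the claim reads (a - g) / 2 + b <= (a + g) / 2,
    that is b <= g. *)
Lemma order_case1 (y z : R) : 0 <= y ->
  (a + - g) / 2 * `|z| + half_width (0 * y) b z <= half_width ((1 + g) * y) ((a - - g) / 2) z.
Proof.
move=> y0; have /andP[a1 a2] := heptagon_bounds.
have g0 : 0 < g by apply: lt_trans bg.
rewrite {1}/half_width mul0r add0r -exprMn sqrtr_sqr normrM (gtr0_norm b_gt0).
apply: (@le_trans _ _ `|(a - - g) / 2 * z|); last by apply: half_width_norm; rewrite
  mulr_ge0 // ltW // addr_gt0.
have e0 : 0 <= (a - - g) / 2 by rewrite divr_ge0 // opprK; lra.
rewrite normrM (ger0_norm e0).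
by rewrite -mulrDl; apply: ler_wpM2r => //; move: bg; lra.
Qed.

(** E0 has half width b s with s = sqrt (y + z^2). Squaring turns the claim into a quadratic form in
    s and t = |z| <= s, which the product formulas for a, b, g rewrite as (1 - b) s^2 + (a^2 - 2)
    t^2 + (a - 2 + b) s (s - t), with all three terms nonnegative. *)
Lemma order_small (y z : R) : 0 <= y ->
  (a + - g) / 2 * `|z| + half_width (b ^+ 2 * y) b z <= half_width (1 * y) ((a - - g) / 2) z.
Proof.
move=> y0; have /andP[a1 a2] := heptagon_bounds.
have yz : 0 <= y + z ^+ 2 by rewrite addr_ge0 ?sqr_ge0.
have s2 := sqr_sqrtr yz; have s0 := sqrtr_ge0 (y + z ^+ 2).
have -> : half_width (b ^+ 2 * y) b z = b * Num.sqrt (y + z ^+ 2).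
  by rewrite /half_width -mulrDr sqrtrM ?sqr_ge0 // sqrtr_sqr gtr0_norm.
have zs : `|z| <= Num.sqrt (y + z ^+ 2) by rewrite -sqrtr_sqr ler_wsqrtr // lerDr.
move: (Num.sqrt (y + _)) s2 s0 zs => s s2 s0 zs.
have z0 := normr_ge0 z; have z2 : `|z| ^+ 2 = z ^+ 2 by rewrite real_normK ?num_real.
have p0 : 0 <= (a + - g) / 2 by rewrite divr_ge0 // gE; nra.
have lhs0 : 0 <= (a + - g) / 2 * `|z| + b * s by apply: addr_ge0; apply: mulr_ge0 => //;
  exact: ltW.
rewrite -ler_sqr ?nnegrE ?half_width_ge0 // half_width_sqr; last by rewrite mul1r.
rewrite mul1r -z2.
have -> : y = s ^+ 2 - `|z| ^+ 2 by rewrite s2 z2; ring.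
move: (`|z|) z0 zs => t t0 ts.
have [ag ab gb b2] := heptagon_products.
rewrite -subr_ge0.
have -> : s ^+ 2 - t ^+ 2 + ((a - - g) / 2) ^+ 2 * t ^+ 2 - ((a + - g) / 2 * t + b * s) ^+ 2
  = (1 - b ^+ 2) * s ^+ 2 + (a * g - 1) * t ^+ 2 - (a * b - g * b) * (s * t) by field.
rewrite ag ab gb b2.
have -> : (1 - (2 - a)) * s ^+ 2 + (a ^+ 2 - 1 - 1) * t ^+ 2 - (a - 1 - (1 - b)) * (s * t)
  = (1 - b) * s ^+ 2 + (a ^+ 2 - 2) * t ^+ 2 + (a - 2 + b) * (s * (s - t)) by ring.
have t1 : 0 <= (1 - b) * s ^+ 2 by rewrite mulr_ge0 ?sqr_ge0 // bE; nra.
have t2 : 0 <= (a ^+ 2 - 2) * t ^+ 2 by rewrite mulr_ge0 ?sqr_ge0 //; nra.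
have t3 : 0 <= (a - 2 + b) * (s * (s - t)).
  by apply: mulr_ge0; [rewrite bE; nra | rewrite mulr_ge0 // subr_ge0].
by rewrite !addr_ge0.
Qed.

(** Everything is compared with s = sqrt (y + z^2): |z| <= s, and the half width of E is at most s
    because (g + b) / 2 <= 1. So the left side is at most ((g - b) / 2 + 1) s = (a + 1) s / 2 < a s.
    For y = z = 0 both sides vanish, whence the second hypothesis. *)
Lemma order_large (y z : R) : 0 <= y -> 0 < y + z ^+ 2 ->
  (g + - b) / 2 * `|z| + half_width (1 * y) ((g - - b) / 2) z < half_width (a ^+ 2 * y) a z.
Proof.
move=> y0 yz; have /andP[a1 a2] := heptagon_bounds.
have s2 := sqr_sqrtr (ltW yz).
have s0 : 0 < Num.sqrt (y + z ^+ 2) by rewrite sqrtr_gt0.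
have a0 : 0 < a by lra.
have -> : half_width (a ^+ 2 * y) a z = a * Num.sqrt (y + z ^+ 2).
  by rewrite /half_width -mulrDr sqrtrM ?sqr_ge0 // sqrtr_sqr gtr0_norm.
have zs : `|z| <= Num.sqrt (y + z ^+ 2) by rewrite -sqrtr_sqr ler_wsqrtr // lerDr.
have e0 : 0 <= (g - - b) / 2 by rewrite divr_ge0 // opprK addr_ge0 // ltW // (lt_trans b_gt0).
have e1 : (g - - b) / 2 <= 1 by rewrite gE bE; nra.
have rs : half_width (1 * y) ((g - - b) / 2) z <= Num.sqrt (y + z ^+ 2).
  rewrite ler_wsqrtr // mul1r lerD2l ler_piMl ?sqr_ge0 //.
  by rewrite expr_le1.
move: (half_width _ _ z) (Num.sqrt (y + _)) s2 s0 zs rs => r s s2 s0 zs rs.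
have z0 := normr_ge0 z.
have p0 : 0 <= (g + - b) / 2 by rewrite divr_ge0 // subr_ge0 ltW.
have : (g + - b) / 2 * `|z| <= (g + - b) / 2 * s by rewrite ler_wpM2l.
have p1 : (g + - b) / 2 + 1 < a by rewrite gE bE; lra.
have : ((g + - b) / 2 + 1) * s < a * s by rewrite ltr_pM2r.
by lra.
Qed.

End Conditions.
End Final.

(** * The three conditions on the parameters *)

Section Cases.
Variable R : realType.
Local Notation C := R[i].
Local Notation "x %:C" := (real_complex R x) (format "x %:C") : ring_scope.
Local Notation cst x := ((x%:C)%:P : {poly C}).
Variables a g b : R.
Hypothesis a3 : a ^+ 3 = a ^+ 2 + 2 * a - 1.
Hypothesis bE : b = a ^+ 2 - a - 1.
Hypothesis gE : g = a ^+ 2 - 2.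
Hypothesis b_gt0 : 0 < b.
Hypothesis bg : b < g.

Let g_gt0 : 0 < g := lt_trans b_gt0 bg.
Let a_gt1 : 1 < a. Proof. by move: bg; rewrite bE gE; lra. Qed.
Let ag : 0 < a - g.
Proof. have /andP[a1 a2] := heptagon_bounds a3 bE gE b_gt0 bg; rewrite gE; nra. Qed.

Let cstD x y : cst (x + y) = cst x + cst y. Proof. by rewrite rmorphD polyCD. Qed.
Let cstN x : cst (- x) = - cst x. Proof. by rewrite rmorphN polyCN. Qed.
Let cstM x y : cst (x * y) = cst x * cst y. Proof. by rewrite rmorphM polyCM. Qed.
Let cst1 : cst 1 = 1. Proof. by rewrite rmorph1. Qed.
Let cst0 : cst 0 = 0. Proof. by rewrite rmorph0. Qed.
Let cstX x n : cst (x ^+ n) = cst x ^+ n. Proof. by rewrite rmorphXn polyC_exp. Qed.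
Let cstE := (cstD, cstN, cstM, cst1, cst0, cstX).

Let a3' : cst a ^+ 3 = cst a ^+ 2 + 2 * cst a - 1.
Proof. by rewrite -cstX a3 !cstE ?rmorph_nat. Qed.
Let bE' : cst b = cst a ^+ 2 - cst a - 1. Proof. by rewrite bE !cstE. Qed.
Let gE' : cst g = cst a ^+ 2 - 2. Proof. by rewrite gE !cstE ?rmorph_nat. Qed.

(** The leading 0 fills the slot j = 0, as [xi] is numbered from 1. *)
Definition weights (s : seq R) (j : nat) : R := nth 0 (0 :: s) j.

Lemma weights_ge0 s : all (>= 0)%R s -> forall j, 0 <= weights s j.
Proof.
move=> /allP h [|j]; rewrite /weights //=.
have [js|js] := ltnP j (size s); last by rewrite nth_default.
exact/h/mem_nth.
Qed.

Lemma weights_factor1 x : kippenhahn_factor (fun j => weights [:: 1; g; 0; g; 1] j * x)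
  a (- g) b (0 * x) ((1 + g) * x).
Proof.
move=> L S T; rewrite /weights /= !cstE !mul1r !mul0r addr0.
exact: factor_case1.
Qed.

Lemma weights_factor2_small x :
  kippenhahn_factor (fun j => weights [:: 1; 0; b; (b - 1) ^+ 2; b] j * x)
  a (- g) b (b ^+ 2 * x) (1 * x).
Proof.
move=> L S T; rewrite /weights /= !cstE !mul1r !mul0r addr0.
exact: factor_case2_small.
Qed.

Lemma weights_factor2_large x :
  kippenhahn_factor (fun j => weights [:: 1; 0; a; (a - 1) ^+ 2; a] j * x)
  g (- b) a (a ^+ 2 * x) (1 * x).
Proof.
move=> L S T; rewrite /weights /= !cstE !mul1r !mul0r addr0.
exact: factor_case2_large.
Qed.

Lemma weights_factor_rev x1 x2 x3 x4 x5 f g' h c0 c x :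
  kippenhahn_factor (fun j => weights [:: x1; x2; x3; x4; x5] j * x) f g' h c0 c ->
  kippenhahn_factor (fun j => weights [:: x5; x4; x3; x2; x1] j * x) f g' h c0 c.
Proof. by move=> hk L S T; rewrite path_continuant_rev -hk. Qed.

Lemma xi_ge0 n (A : 'M[C]_n.+1) j : 0 <= xi A j.
Proof. by rewrite /xi divr_ge0 // sqr_ge0. Qed.

Lemma xi_weights (A : 'M[C]_6) x x1 x2 x3 x4 x5 :
  [/\ xi A 1 = x1 * x, xi A 2 = x2 * x, xi A 3 = x3 * x, xi A 4 = x4 * x & xi A 5 = x5 * x] ->
  forall j, (1 <= j <= 5)%N -> xi A j = weights [:: x1; x2; x3; x4; x5] j * x.
Proof. by move=> [? ? ? ? ?] [|[|[|[|[|[|j]]]]]]. Qed.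

Lemma ranges_case1 (A : 'M[C]_6) : reciprocal A ->
  [/\ xi A 2 = g * xi A 1, xi A 4 = g * xi A 1, xi A 3 = 0 & xi A 5 = xi A 1] ->
  (exists E0 E : ellipse R, kippenhahn_ellipses A a (- g) b E0 E) /\
  (forall E0 E : ellipse R, kippenhahn_ellipses A a (- g) b E0 E ->
    [/\ rank_numerical_range 1 A = conv (points E `|` [set - z | z in points E]),
        rank_numerical_range 2 A = conv (points E) `&` conv [set - z | z in points E] &
        rank_numerical_range 3 A = conv (points E0)]).
Proof.
move=> recA [h2 h4 h3 h5].
apply: (@small_conclusion _ (weights [:: 1; g; 0; g; 1]) a (- g) b 0 (1 + g) _ _ _
  weights_factor1 _ _ A (xi A 1)) => //.
- by apply: weights_ge0; rewrite /= ler01 lexx (ltW g_gt0).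
- by rewrite addr_gt0.
- by rewrite mulrN oppr_le0 mulr_ge0 // ltW // (lt_trans ltr01).
- exact: xi_ge0.
- by apply: xi_weights; rewrite h2 h3 h4 h5 !mul1r mul0r.
- by rewrite gt_eqF.
- by move=> y z; apply: order_case1.
Qed.

Lemma ranges_small (A : 'M[C]_6) x s : reciprocal A -> 0 <= x ->
  s = [:: 1; 0; b; (b - 1) ^+ 2; b] \/ s = [:: b; (b - 1) ^+ 2; b; 0; 1] ->
  (forall j, (1 <= j <= 5)%N -> xi A j = weights s j * x) ->
  (exists E0 E : ellipse R, kippenhahn_ellipses A a (- g) b E0 E) /\
  (forall E0 E : ellipse R, kippenhahn_ellipses A a (- g) b E0 E ->
    [/\ rank_numerical_range 1 A = conv (points E `|` [set - z | z in points E]),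
        rank_numerical_range 2 A = conv (points E) `&` conv [set - z | z in points E] &
        rank_numerical_range 3 A = conv (points E0)]).
Proof.
move=> recA x0 sE xiA.
have s0 : forall j, 0 <= weights s j.
  by case: sE => ->; apply: weights_ge0; rewrite /= ?ler01 ?lexx ?sqr_ge0 (ltW b_gt0).
have sP y : kippenhahn_factor (fun j => weights s j * y) a (- g) b (b ^+ 2 * y) (1 * y).
  case: sE => ->; first exact: weights_factor2_small.
  exact/weights_factor_rev/weights_factor2_small.
apply: (@small_conclusion _ (weights s) a (- g) b (b ^+ 2) 1 s0 _ _ sP _ _ A x) => //.
- exact: sqr_ge0.
- by rewrite mulrN oppr_le0 mulr_ge0 // ltW // (lt_trans ltr01).
- by rewrite gt_eqF.
- by move=> y z; apply: order_small.
Qed.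

Lemma ranges_large (A : 'M[C]_6) x s : reciprocal A -> 0 <= x ->
  s = [:: 1; 0; a; (a - 1) ^+ 2; a] \/ s = [:: a; (a - 1) ^+ 2; a; 0; 1] ->
  (forall j, (1 <= j <= 5)%N -> xi A j = weights s j * x) ->
  (exists E0 E : ellipse R, kippenhahn_ellipses A g (- b) a E0 E) /\
  (forall E0 E : ellipse R, kippenhahn_ellipses A g (- b) a E0 E ->
    [/\ rank_numerical_range 1 A = conv (points E0),
        rank_numerical_range 2 A = conv (points E `|` [set - z | z in points E]) &
        rank_numerical_range 3 A = conv (points E) `&` conv [set - z | z in points E]]).
Proof.
move=> recA x0 sE xiA.
have a0 : 0 < a by exact: lt_trans ltr01 a_gt1.
have s0 : forall j, 0 <= weights s j.
  by case: sE => ->; apply: weights_ge0; rewrite /= ?ler01 ?lexx ?sqr_ge0 (ltW a0).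
have sP y : kippenhahn_factor (fun j => weights s j * y) g (- b) a (a ^+ 2 * y) (1 * y).
  case: sE => ->; first exact: weights_factor2_large.
  exact/weights_factor_rev/weights_factor2_large.
have bnd y z : 0 <= y -> 0 < y + z ^+ 2 -> (g + - b) / 2 * `|z| + half_width (1 * y) ((g -
  - b) / 2) z
   < half_width (a ^+ 2 * y) a z by exact: order_large.
apply: (@large_conclusion _ (weights s) g (- b) a (a ^+ 2) 1 s0 _ _ sP _ _ A x) => //.
- by rewrite sqr_ge0.
- by rewrite subr_gt0.
- by rewrite mulrN oppr_le0 mulr_ge0 // ltW.
- by rewrite exprn_gt0.
(* The weak inequality has to include y = z = 0, where both sides are 0. *)
- move=> y z y0; have [yz|yz] := ltP 0 (y + z ^+ 2); first exact/ltW/bnd.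
  have z2 := sqr_ge0 z.
  have /eqP : z ^+ 2 = 0 by lra.
  rewrite sqrf_eq0 => /eqP z0; have y00 : y = 0 by lra.
  by rewrite z0 y00 normr0 /half_width !mulr0 expr0n !mulr0 addr0 sqrtr0.
- by move=> y z y0; apply: bnd; [exact: ltW | rewrite ltr_wpDr ?sqr_ge0].
Qed.

End Cases.

Theorem corollary7 (R : realType) (A : 'M[R[i]]_6) (hA : reciprocal A) :
  ([\/ condition1 A,
       condition2 (2 * cos (3 * pi / 7)) A |
       condition3 (2 * cos (3 * pi / 7)) A] ->
   (exists E0 E : ellipse R,
      kippenhahn_ellipses A (2 * cos (pi / 7)) (- (2 * cos (2 * pi / 7)))
        (2 * cos (3 * pi / 7)) E0 E) /\
   (forall E0 E : ellipse R,
      kippenhahn_ellipses A (2 * cos (pi / 7)) (- (2 * cos (2 * pi / 7)))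
        (2 * cos (3 * pi / 7)) E0 E ->
      [/\ rank_numerical_range 1 A
            = conv (points E `|` [set - z | z in points E]),
          rank_numerical_range 2 A
            = conv (points E) `&` conv [set - z | z in points E] &
          rank_numerical_range 3 A = conv (points E0)]))
  /\
  (condition2 (2 * cos (pi / 7)) A \/ condition3 (2 * cos (pi / 7)) A ->
   (exists E0 E : ellipse R,
      kippenhahn_ellipses A (2 * cos (2 * pi / 7)) (- (2 * cos (3 * pi / 7)))
        (2 * cos (pi / 7)) E0 E) /\
   (forall E0 E : ellipse R,
      kippenhahn_ellipses A (2 * cos (2 * pi / 7)) (- (2 * cos (3 * pi / 7)))
        (2 * cos (pi / 7)) E0 E ->
      [/\ rank_numerical_range 1 A = conv (points E0),
          rank_numerical_range 2 A
            = conv (points E `|` [set - z | z in points E]) &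
          rank_numerical_range 3 A
            = conv (points E) `&` conv [set - z | z in points E]])).
Proof.
have [a3 bE gE b0 bg] := heptagon R.
split=> [[]|[]].
- case=> h2 h4 h3 h5; apply: (ranges_case1 a3 bE gE b0 bg hA); split=> //.
    by rewrite h2 mulrAC.
  by rewrite h4 mulrAC.
- case=> h3 h5 h2 h4; apply: (ranges_small a3 bE gE b0 bg hA (xi_ge0 A 1) (or_introl erefl)).
  by apply: xi_weights; rewrite mul1r mul0r.
(* Condition (3) is condition (2) along the reversed path, with xi_5 as the scale. *)
- case=> h1 h3 h2 h4; apply: (ranges_small a3 bE gE b0 bg hA (xi_ge0 A 5) (or_intror erefl)).
  by apply: xi_weights; rewrite mul1r mul0r.
- case=> h3 h5 h2 h4; apply: (ranges_large a3 bE gE b0 bg hA (xi_ge0 A 1) (or_introl erefl)).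
  by apply: xi_weights; rewrite mul1r mul0r.
- case=> h1 h3 h2 h4; apply: (ranges_large a3 bE gE b0 bg hA (xi_ge0 A 5) (or_intror erefl)).
  by apply: xi_weights; rewrite mul1r mul0r.
Qed.
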